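(* Let $M$ be a connected closed smooth Riemannian manifold, $(\Omega,d_\Omega)$ a compact metric space, $\theta:\Omega\to\Omega$ a homeomorphism, $F:\Omega\to \mathrm{Diff}^2(M)$, $\omega\mapsto F_\omega$, a continuous map, and $\Theta(\omega,x)=(\theta\omega,F_\omega x)$ the induced skew product on $\Omega\times M$. Assume that $\Theta$ is Anosov on fibers and topological mixing on fibers. Then $\Theta$ has the fiber specification property. Moreover, the random dynamical system $F$ corresponding to $\Theta$ has the specification property in the sense of Gundlach and Kifer.
   Context: **Setting.** $d_M$ is the Riemannian distance on $M$; $\mathrm{Diff}^2(M)$ is the space of $C^2$ diffeomorphisms of $M$ with the $C^2$ topology. For $n>0$, $F_\omega^n=F_{\theta^{n-1}\omega}\circ\cdots\circ F_\omega$; $F_\omega^0=\mathrm{id}$; for $n<0$, $F_\omega^n=(F_{\theta^n\omega})^{-1}\circ\cdots\circ(F_{\theta^{-1}\omega})^{-1}$. So $\Theta^n(\omega,x)=(\theta^n\omega,F^n_\omega x)$. The random dynamical system (RDS) corresponding to $\Theta$ is $(n,\omega,x)\mapsto F_\omega^n x$. **Anosov on fibers.** For every $(\omega,x)\in\Omega\times M$ there is a splitting $T_xM_\omega=E^s_{(\omega,x)}\oplus E^u_{(\omega,x)}$ of the tangent space at $x$ of $M_\omega=\{\omega\}\times M$, depending continuously on $(\omega,x)$, with $\dim E^s_{(\omega,x)},\dim E^u_{(\omega,x)}>0$, $D_xF_\omega E^{u}_{(\omega,x)}=E^{u}_{\Theta(\omega,x)}$, $D_xF_\omega E^{s}_{(\omega,x)}=E^{s}_{\Theta(\omega,x)}$,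 and $|D_xF_\omega\xi|\ge e^{\lambda_0}|\xi|$ for $\xi\in E^u_{(\omega,x)}$, $|D_xF_\omega\zeta|\le e^{-\lambda_0}|\zeta|$ for $\zeta\in E^s_{(\omega,x)}$, where $\lambda_0>0$ is a constant. **Topological mixing on fibers.** For any nonempty open sets $U,V\subset M$ there exists $N>0$ such that for all $n\ge N$ and all $\omega\in\Omega$, $\Theta^n(\{\omega\}\times U)\cap(\{\theta^n\omega\}\times V)\neq\emptyset$. **Fiber specification property.** For $\omega\in\Omega$, an $\omega$-specification $S_\omega=(\omega,\tau,P_\omega)$ consists of a finite collection $\tau=\{I_1,\dots,I_k\}$ of intervals $I_i=[a_i,b_i]\subset\mathbb Z$ and a map $P_\omega:\bigcup_{i=1}^kI_i\to M$ such that $F_{\theta^{t_1}\omega}^{t_2-t_1}(P_\omega(t_1))=P_\omega(t_2)$ whenever $t_1,t_2\in I\in\tau$. It is $m$-spaced if $a_{i+1}>b_i+m$ for all $i\in\{1,\dots,k-1\}$. $\Theta$ has the fiber specification property if for every $\epsilon>0$ there is $m=m(\epsilon)>0$ such that for every $\omega\in\Omega$ and every $m$-spaced $\omega$-specification $S_\omega=(\omega,\tau,P_\omega)$ there is $x\in M$ with $d_M(P_\omega(t),F_\omega^tx)<\epsilon$ for all $t\in I\in\tau$. **Specification in the sense of Gundlach and Kifer.** Let $P$ be a $\theta$-invariant Borel probability measure on $\Omega$. In the present setting $F$ has a constant expansive characteristic: there is a constant $\eta>0$ such that for every $\omega\in\Omega$, if $d_M(F_\omega^nx,F_\omega^ny)\le\eta$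 for all $n\in\mathbb Z$, then $x=y$; fix such $\eta$. $F$ has the specification property if for each constant $c>0$ and $P$-a.s. $\omega$ there exists an $\mathbb N$-valued random variable $L_c=L_c(\omega)\ge1$, independent of $k$, such that for every $k\ge 1$, any points $x_0,\dots,x_k\in M$ and any integers $-\infty\le b_0<a_1<b_1<\cdots<a_k<b_k<a_{k+1}\le\infty$ (where $b_0=-\infty$ and $a_{k+1}=\infty$ are allowed) with $a_{i+1}\ge b_i+L_c(\theta^{b_i}\omega)$ for $i=0,1,\dots,k$, there is $z\in M$ with $$\max_{a_i\le j\le b_i}d_M(F_\omega^j(x_i),F_\omega^j(z))\le c\,\eta\quad(i=1,\dots,k),$$ $$d_M(F_\omega^j(x_0),F_\omega^j(z))\le c\,\eta\quad\text{for all } j\ge a_{k+1}\text{ and all }j\le b_0.$$ (The spacing condition at an infinite endpoint is vacuous.) *)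

(* Defs.v *)
From HB Require Import structures.
From mathcomp Require Import all_boot all_order all_algebra.
From mathcomp Require Import all_classical all_reals all_analysis.

Set Implicit Arguments.
Unset Strict Implicit.
Unset Printing Implicit Defensive.

Import Order.TTheory GRing.Theory Num.Theory numFieldNormedType.Exports.

Local Open Scope classical_set_scope.
Local Open Scope ring_scope.

Section Differentiability.
Context {R : realType} {V W : normedModType R}.

(* D_{v_1} (... (D_{v_n} f)) for vs = [:: v_1; ...; v_n]. *)
Definition nderiv (vs : seq V) (f : V -> W) : V -> W :=
  foldr (fun v h x => 'd h x v) f vs.

(* f is C^k on A, which is meant to be open: differentials are taken with
   respect to full neighbourhoods. *)
Definition C_on (k : nat) (A : set V) (f : V -> W) : Prop :=
  forall vs : seq V, (size vs <= k)%N -> forall x, A x ->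
    {for x, continuous (nderiv vs f)} /\
    ((size vs < k)%N -> differentiable (nderiv vs f) x).

Definition smooth_on (A : set V) (f : V -> W) : Prop := forall k, C_on k A f.

End Differentiability.

(* A d-dimensional smooth manifold without boundary, on the space M.
   [ichart i] is only meaningful on the open set chart i @` dom i.
   [chart_at x] selects a chart at x in which the tangent vectors at x are
   read; the choice need not depend on x in any regular way. *)
Record smooth_manifold (R : realType) (d : nat) (M : topologicalType) := {
  chart_index : Type;
  dom : chart_index -> set M;
  chart : chart_index -> M -> 'rV[R]_d;
  ichart : chart_index -> 'rV[R]_d -> M;
  chart_at : M -> chart_index;
  manifold_hausdorff : hausdorff_space M;
  manifold_second_countable : @second_countable M;
  dom_open : forall i, open (dom i);
  chart_img_open : forall i, open (chart i @` dom i);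
  chartK : forall i x, dom i x -> ichart i (chart i x) = x;
  chart_continuous : forall i x, dom i x -> {for x, continuous (chart i)};
  ichart_continuous : forall i y, (chart i @` dom i) y ->
    {for y, continuous (ichart i)};
  transition_smooth : forall i j,
    smooth_on (chart i @` (dom i `&` dom j)) (chart j \o ichart i);
  dom_chart_at : forall x, dom (chart_at x) x
}.

Section Manifold.
Context {R : realType} {d : nat} {M : topologicalType}.
Variable S : smooth_manifold R d M.

(* T_x M is 'rV[R]_d, a vector being identified with its coordinates in the
   chart [chart_at S x]. *)
Definition tangent (x : M) : Type := 'rV[R]_d.

Definition to_coord (i : chart_index S) (x : M) (v : tangent x) : 'rV[R]_d :=
  'd (chart i \o ichart (chart_at S x)) (chart (chart_at S x) x) v.

Definition of_coord (i : chart_index S) (x : M) (w : 'rV[R]_d) : tangent x :=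
  'd (chart (chart_at S x) \o ichart i) (chart i x) w.

Definition tangent_map (f : M -> M) (x : M) (v : tangent x) : tangent (f x) :=
  'd (chart (chart_at S (f x)) \o f \o ichart (chart_at S x))
     (chart (chart_at S x) x) v.

(* The representative of f : M -> M in the charts i and j. *)
Definition local_rep (i j : chart_index S) (f : M -> M) :
  'rV[R]_d -> 'rV[R]_d := chart j \o f \o ichart i.

Definition C2_map (f : M -> M) : Prop :=
  continuous f /\ forall i j : chart_index S,
    C_on 2 (chart i @` (dom i `&` f @^-1` dom j)) (local_rep i j f).

Record diff2 := Diff2 {
  diff2_fun :> M -> M;
  diff2_inv : M -> M;
  diff2_funK : cancel diff2_fun diff2_inv;
  diff2_invK : cancel diff2_inv diff2_fun;
  diff2_C2 : C2_map diff2_fun;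
  diff2_inv_C2 : C2_map diff2_inv
}.

HB.instance Definition _ := gen_eqMixin diff2.
HB.instance Definition _ := gen_choiceMixin diff2.

Definition C2_nbhd (f : diff2) (i j : chart_index S) (K : set M) (eps : R) :
  set diff2 := [set h : diff2 | h @` K `<=` dom j /\
    forall s : seq 'I_d, (size s <= 2)%N -> forall x, K x ->
      let vs := map (fun a => delta_mx 0 a : 'rV[R]_d) s in
      `| nderiv vs (local_rep i j h) (chart i x)
         - nderiv vs (local_rep i j f) (chart i x) | < eps].

Definition C2_subbase : set (set diff2) :=
  [set N | exists f i j K eps, [/\ compact K, K `<=` dom i,
     (f : diff2) @` K `<=` dom j, 0 < eps & N = C2_nbhd f i j K eps]].

HB.instance Definition _ :=
  @isSubBaseTopological.Build diff2 (set diff2) C2_subbase id.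

Definition inner (G : M -> 'M[R]_d) (x : M) (v w : tangent x) : R :=
  ((v : 'rV[R]_d) *m G x *m (w : 'rV[R]_d)^T) 0 0.

(* [gram x] is the Gram matrix of the inner product of T_x M in the
   coordinates of [chart_at S x]; smoothness is required of the coefficients
   in every chart. *)
Record riemannian_metric := {
  gram :> M -> 'M[R]_d;
  gram_sym : forall x, (gram x)^T = gram x;
  gram_pos : forall x (v : tangent x), v != 0 :> 'rV[R]_d ->
    0 < inner gram v v;
  gram_smooth : forall (i : chart_index S) (v w : 'rV[R]_d),
    smooth_on (chart i @` dom i) (fun y : 'rV[R]_d =>
      inner gram (of_coord i (ichart i y) v) (of_coord i (ichart i y) w) : R)
}.

Variable g : riemannian_metric.

Definition tnorm (x : M) (v : tangent x) : R := Num.sqrt (inner g v v).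

Definition velocity (c : R -> M) (t : R) : tangent (c t) :=
  derive1 (chart (chart_at S (c t)) \o c) t.

Definition C1_curve_on (U : set R) (c : R -> M) : Prop :=
  (forall t, U t -> {for t, continuous c}) /\
  forall i : chart_index S, C_on 1 (U `&` c @^-1` dom i) (chart i \o c).

(* On each closed piece, C^1 means: extends to a C^1 curve on a
   neighbourhood. *)
Definition piecewise_C1 (c : R -> M) : Prop :=
  exists s : seq R, itv_partition 0 1 s /\
    forall k, (k < size s)%N ->
      let I := `[nth 0 (0 :: s) k, nth 0 (0 :: s) k.+1] in
      exists U c', [/\ open U, [set` I] `<=` U, C1_curve_on U c' &
                       {in I, c =1 c'}].

Definition curve_length (c : R -> M) : R :=
  Rintegral lebesgue_measure `[0, 1] (fun t => tnorm (velocity c t)).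

Definition rdist (x y : M) : R :=
  inf [set l | exists c, [/\ piecewise_C1 c, c 0 = x, c 1 = y &
                             l = curve_length c]].

End Manifold.

Section SkewProduct.
Context {R : realType} {d : nat} {M : topologicalType}.
Variables (S : smooth_manifold R d M) (g : riemannian_metric S).
Context {Omega : metricType R}.
Variables (theta thetaV : Omega -> Omega) (F : Omega -> diff2 S).

Definition skew (p : Omega * M) : Omega * M := (theta p.1, F p.1 p.2).

Definition theta_iter (n : int) (w : Omega) : Omega :=
  match n with
  | Posz n => iter n theta w
  | Negz n => iter n.+1 thetaV w
  end.

Fixpoint fiber_pos (n : nat) (w : Omega) (x : M) : M :=
  if n is n'.+1 then F (iter n' theta w) (fiber_pos n' w x) else x.

Fixpoint fiber_neg (n : nat) (w : Omega) (x : M) : M :=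
  if n is n'.+1 then diff2_inv (F (iter n'.+1 thetaV w)) (fiber_neg n' w x)
  else x.

Definition fiber_iter (n : int) (w : Omega) (x : M) : M :=
  match n with
  | Posz n => fiber_pos n w x
  | Negz n => fiber_neg n.+1 w x
  end.

(* E is, locally, spanned by a continuous frame; continuity of a vector field
   is read in a fixed chart. *)
Definition continuous_subbundle (E : Omega -> M -> {vspace 'rV[R]_d}) : Prop :=
  forall p0 : Omega * M, exists k,
  exists e : 'I_k -> forall p : Omega * M, tangent (R := R) (d := d) p.2,
    \forall p \near p0,
      basis_of (E p.1 p.2) [seq (e a p : 'rV[R]_d) | a <- enum 'I_k] /\
      forall a, {for p, continuous
        (fun q : Omega * M => to_coord (chart_at S p0.2) (e a q))}.

Definition anosov_on_fibers : Prop :=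
  exists (Es Eu : Omega -> M -> {vspace 'rV[R]_d}) (lambda0 : R),
  [/\ 0 < lambda0,
      continuous_subbundle Es /\ continuous_subbundle Eu,
      forall w x, [/\ (Es w x + Eu w x)%VS = fullv,
                      (Es w x :&: Eu w x)%VS = 0%VS,
                      (0 < \dim (Es w x))%N & (0 < \dim (Eu w x))%N],
      forall w x,
        tangent_map S (F w) (x := x) @` [set` Eu w x]
          = [set` Eu (theta w) (F w x)] /\
        tangent_map S (F w) (x := x) @` [set` Es w x]
          = [set` Es (theta w) (F w x)] &
      forall w x,
        (forall v : tangent x, v \in Eu w x ->
           expR lambda0 * tnorm g v <= tnorm g (tangent_map S (F w) v)) /\
        (forall v : tangent x, v \in Es w x ->
           tnorm g (tangent_map S (F w) v) <= expR (- lambda0) * tnorm g v)].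

Definition mixing_on_fibers : Prop :=
  forall U V : set M, open U -> U !=set0 -> open V -> V !=set0 ->
  exists2 N : nat, (0 < N)%N & forall n : nat, (N <= n)%N -> forall w : Omega,
    (iter n skew @` ([set w] `*` U)) `&` ([set iter n theta w] `*` V) !=set0.

(* The finite collection of intervals is a list of pairs of endpoints, and the
   map is total on int: only its values on the union of the intervals matter. *)
Definition is_specification (w : Omega) (tau : seq (int * int)) (P : int -> M) :
  Prop :=
  (forall I, I \in tau -> I.1 <= I.2) /\
  forall I, I \in tau -> forall t1 t2 : int,
    I.1 <= t1 <= I.2 -> I.1 <= t2 <= I.2 ->
    fiber_iter (t2 - t1) (theta_iter t1 w) (P t1) = P t2.

Definition spaced (m : nat) (tau : seq (int * int)) : Prop :=
  sorted (fun I J : int * int => I.2 + m%:Z < J.1) tau.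

Definition fiber_specification : Prop :=
  forall eps : R, 0 < eps -> exists2 m : nat, (0 < m)%N &
  forall (w : Omega) (tau : seq (int * int)) (P : int -> M),
    is_specification w tau P -> spaced m tau ->
    exists x : M, forall I, I \in tau -> forall t : int, I.1 <= t <= I.2 ->
      rdist g (P t) (fiber_iter t w x) < eps.

Definition expansive_characteristic (eta : R) : Prop :=
  0 < eta /\ forall (w : Omega) (x y : M),
    (forall n : int, rdist g (fiber_iter n w x) (fiber_iter n w y) <= eta) ->
    x = y.

End SkewProduct.

(* Measurable types are pointed; the point w0 serves no other purpose. *)
Definition pointed_at (T : Type) (w0 : T) : Type := T.

HB.instance Definition _ (T : topologicalType) (w0 : T) :=
  Topological.copy (pointed_at w0) T.
HB.instance Definition _ (T : topologicalType) (w0 : T) :=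
  isPointed.Build (pointed_at w0) w0.

Definition borel (T : topologicalType) (w0 : T) :=
  g_sigma_algebraType (open : set (set (pointed_at w0))).

HB.instance Definition _ (T : topologicalType) (w0 : T) :=
  Measurable.on (borel w0).

Section GundlachKifer.
Context {R : realType} {d : nat} {M : topologicalType}.
Variables (S : smooth_manifold R d M) (g : riemannian_metric S).
Context {Omega : metricType R}.
Variables (theta thetaV : Omega -> Omega) (F : Omega -> diff2 S).
Variables (w0 : Omega) (P : probability (borel w0) R).

Definition invariant_probability : Prop :=
  forall A : set (borel w0), measurable A -> P (theta @^-1` A) = P A.

(* The finite endpoints are a 1 < b 1 < ... < a k < b k; the outer endpoints
   [bO] and [aO] are the possibly infinite b_0 and a_{k+1}. *)
Definition GK_specification (eta : R) : Prop :=
  forall c : R, 0 < c ->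
  exists L : borel w0 -> nat,
  [/\ measurable_fun setT L, forall w, (1 <= L w)%N &
  {ae P, forall w : borel w0,
    forall (k : nat) (x : nat -> M) (a b : nat -> int) (bO aO : \bar int),
    (1 <= k)%N ->
    (forall i, (1 <= i <= k)%N -> a i < b i) ->
    (forall i, (1 <= i < k)%N -> b i < a i.+1) ->
    (bO < (a 1%N)%:E)%E -> ((b k)%:E < aO)%E ->
    (forall n : int, bO = n%:E ->
       n + (L (theta_iter theta thetaV n w))%:Z <= a 1%N) ->
    (forall i, (1 <= i < k)%N ->
       b i + (L (theta_iter theta thetaV (b i) w))%:Z <= a i.+1) ->
    (forall n : int, aO = n%:E ->
       b k + (L (theta_iter theta thetaV (b k) w))%:Z <= n) ->
    exists z : M,
      (forall i, (1 <= i <= k)%N -> forall j : int, a i <= j <= b i ->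
         rdist g (fiber_iter theta thetaV F j w (x i))
                 (fiber_iter theta thetaV F j w z) <= c * eta) /\
      (forall j : int, (aO <= j%:E)%E \/ (j%:E <= bO)%E ->
         rdist g (fiber_iter theta thetaV F j w (x 0%N))
                 (fiber_iter theta thetaV F j w z) <= c * eta)}].

End GundlachKifer.

(* Main.v *)
(* Anosov systems shadow pseudo-orbits.  In finitely many charts the points
   x_n + v_n shadowing a pseudo-orbit x solve a recursion
   g_n(v_n) = v_(n+1) + e_n, where g_n is a small Lipschitz perturbation of the
   derivative of F at x_n; solving the stable component forwards and the unstable
   one backwards is a contraction of bounded sequences, which gives existence and
   uniqueness of v, that is, shadowing and expansivity.  By compactness,
   topological mixing provides a time N after which any two points are joined,
   over every omega, by an orbit segment up to an arbitrarily small jump.  Orbit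
   pieces separated by more than N steps are therefore parts of one pseudo-orbit,
   and a shadowing orbit of the latter follows all of them.

   The Riemannian distance enters only through its uniformity: it is small near
   the diagonal by the length of chart segments, and a small distance forces two
   points into a prescribed neighbourhood of the diagonal because a bump function
   varies along a curve by at most a constant times the length. *)
Require Import Defs.
From HB Require Import structures.
From mathcomp Require Import all_boot all_order all_algebra.
From mathcomp Require Import all_classical all_reals all_analysis.
From mathcomp Require Import finmap.
From mathcomp Require Import ring lra zify.

Set Implicit Arguments.
Unset Strict Implicit.
Unset Printing Implicit Defensive.

Import Order.TTheory GRing.Theory Num.Theory numFieldNormedType.Exports.

Local Open Scope classical_set_scope.
Local Open Scope ring_scope.

(** The obstacle is that a pseudo-orbit is hyperbolic only up to an error: the derivative at x_n
    carries the splitting at x_n exactly to the one at F(x_n), whereas the recursion continues with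
    the splitting at x_(n+1). The inverse on the unstable direction is therefore built at F(x_n),
    where the algebra is exact, and the discrepancy with x_(n+1), at most a small k, is paid for in
    the norm estimates. A fixed point then solves the recursion by a transversality that again holds
    for small k.

    One step contracts the Riemannian norm by exp(-lambda0) with no constant in front, so no adapted
    norm is constructed. Constants are chosen in the order C (norms, projections, derivatives in
    charts), k, the radius rho of the displacements, the size eps of the jumps.

    The choice [chart_at] is irregular, so metric, bundles and derivatives are continuous only when
    read in a fixed chart; uniformity comes from compactness in its near-covering form. Closeness on
    M means a neighbourhood of the diagonal until the distance is substituted at the end. *)

Lemma near_all (T : topologicalType) (x : T) (P : T -> Prop) :
  (forall t, P t) -> \forall t \near x, P t.
Proof. exact: filterE. Qed.

Lemma near_fst (T U : topologicalType) (x : T) (y : U) (P : T -> Prop) :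
  (\forall t \near x, P t) -> \forall p \near (x, y), P p.1.
Proof.
move=> Px; exists (P, setT) => [|[a b] [/= Pa _]//].
by split=> //; exact: filterT.
Qed.

Lemma near_snd (T U : topologicalType) (x : T) (y : U) (P : U -> Prop) :
  (\forall t \near y, P t) -> \forall p \near (x, y), P p.2.
Proof.
move=> Py; exists (setT, P) => [|[a b] [_ /= Pb]//].
by split=> //; exact: filterT.
Qed.

Lemma cvg_at_dist (R : realType) (V : normedModType R) (T : topologicalType)
    (x : T) (f : T -> V) (l : V) :
  f t @[t --> x] --> l <-> forall e, 0 < e -> \forall t \near x, `|l - f t| < e.
Proof. by split=> [/cvgrPdist_lt|H]; [exact|apply/cvgrPdist_lt]. Qed.

Lemma cvg_near_ext (T U : topologicalType) (t0 : T) (f h : T -> U) (l l' : U) :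
  l = l' -> (\forall t \near t0, f t = h t) ->
  f t @[t --> t0] --> l -> h t @[t --> t0] --> l'.
Proof.
move=> <- fh fl; apply: cvg_trans fl; apply: near_eq_cvg.
by apply: filterS fh => t.
Qed.

(** * Matrix norms and limits of matrices *)

Section MatrixNorm.
Context {R : realType}.

Lemma le_mx_entry m n (A : 'M[R]_(m, n)) i j : `|A i j| <= `|A|.
Proof.
rewrite [leRHS]/Num.norm /= mx_normrE.
by apply: (le_trans _ (le_bigmax _ _ (i, j))).
Qed.

Lemma mx_norm_le m n (A : 'M[R]_(m, n)) (e : R) : 0 <= e ->
  (forall i j, `|A i j| <= e) -> `|A| <= e.
Proof.
move=> e0 Ae; rewrite [leLHS]/Num.norm /= mx_normrE.
by apply: bigmax_le => // -[i j] _ /=.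
Qed.

Lemma mulmx_norm_le m n p (A : 'M[R]_(m, n)) (B : 'M[R]_(n, p)) :
  `|A *m B| <= n%:R * (`|A| * `|B|).
Proof.
apply: mx_norm_le => [|i j]; first by rewrite !mulr_ge0.
rewrite mxE (le_trans (ler_norm_sum _ _ _)) //.
apply: (@le_trans _ _ (\sum_(k < n) `|A| * `|B|)).
  by apply: ler_sum => k _; rewrite normrM ler_pM // le_mx_entry.
by rewrite sumr_const card_ord mulr_natl.
Qed.

Lemma trmx_norm m n (A : 'M[R]_(m, n)) : `|A^T| = `|A|.
Proof.
have tr_le p q (B : 'M[R]_(p, q)) : `|B^T| <= `|B|.
  by apply: mx_norm_le => // i j; rewrite mxE le_mx_entry.
by apply/eqP; rewrite eq_le tr_le -{1}(trmxK A) tr_le.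
Qed.

Lemma cvg_mxP (T : Type) (F : set_system T) {FF : Filter F} m n
    (f : T -> 'M[R]_(m, n)) (A : 'M[R]_(m, n)) :
  (forall i j, f t i j @[t --> F] --> A i j) <-> f t @[t --> F] --> A.
Proof.
split=> [fA|fA i j]; last first.
  exact: (cvg_comp _ _ fA (@coord_continuous R m n i j A)).
apply/cvgrPdist_le => e e0.
have H : \forall t \near F, forall ij : 'I_m * 'I_n,
    `|A ij.1 ij.2 - f t ij.1 ij.2| <= e.
  apply: filter_forall => -[i j] /=.
  by have /cvgrPdist_le /(_ _ e0) := fA i j.
apply: filterS H => t H.
by apply: mx_norm_le (ltW e0) _ => i j; rewrite !mxE (H (i, j)).
Qed.

Lemma cvg_mx (T : topologicalType) (t0 : T) m n (f : T -> 'M[R]_(m, n))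
    (A : 'M[R]_(m, n)) :
  (forall i j, f t i j @[t --> t0] --> A i j) -> f t @[t --> t0] --> A.
Proof. exact: (proj1 (cvg_mxP _ _)). Qed.

Lemma cvg_entry (T : topologicalType) (t0 : T) m n (f : T -> 'M[R]_(m, n))
    (A : 'M[R]_(m, n)) i j :
  f t @[t --> t0] --> A -> f t i j @[t --> t0] --> A i j.
Proof. by move=> fA; apply: (proj2 (cvg_mxP _ _) fA). Qed.

Lemma cvg_mulmx (T : topologicalType) (t0 : T) m n p
    (f : T -> 'M[R]_(m, n)) (g : T -> 'M[R]_(n, p)) (A : 'M[R]_(m, n)) (B : 'M[R]_(n, p)) :
  f t @[t --> t0] --> A -> g t @[t --> t0] --> B ->
  f t *m g t @[t --> t0] --> A *m B.
Proof.
move=> fA gB; apply: cvg_mx => i j.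
rewrite mxE; under eq_fun do rewrite mxE.
by apply: cvg_big => [|k _]; [exact: add_continuous|
  exact: cvgM (cvg_entry fA) (cvg_entry gB)].
Qed.

Lemma mulmx_regroup m n (A : 'M[R]_(m, n)) (B C D E : 'M[R]_n) :
  A *m B *m (C *m D *m E) = A *m (B *m C) *m D *m E.
Proof. by rewrite !mulmxA. Qed.

Lemma rowP_mx m n (A B : 'M[R]_(m, n)) : (forall v : 'rV_m, v *m A = v *m B) -> A = B.
Proof. by move=> AB; apply/row_matrixP => i; rewrite !rowE AB. Qed.

Lemma entry_dist m n (A B : 'M[R]_(m, n)) i j (s t : R) :
  s = A i j -> t = B i j -> `|s - t| <= `|A - B|.
Proof.
move=> -> ->; apply: le_trans (le_mx_entry (A - B) i j).
by rewrite [X in _ <= `|X|]mxE [X in _ <= `|_ + X|]mxE.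
Qed.

End MatrixNorm.

(** * Bounded solutions of hyperbolic recursions *)

Section Contraction.
Context {R : realType}.

Lemma geometric_small (C mu : R) : 0 <= mu < 1 ->
  forall e, 0 < e -> \forall k \near \oo, C * mu ^+ k <= e.
Proof.
move=> /andP[mu0 mu1] e e0.
have /cvgrPdist_le/(_ _ e0) : (fun k => C * mu ^+ k) @ \oo --> (0 : R).
  by have := @cvg_geometric R C mu; rewrite ger0_norm //; exact.
by apply: filterS => k; rewrite sub0r normrN; apply: le_trans; exact: ler_norm.
Qed.

Lemma geometric_cvg d (u : nat -> 'rV[R]_d) (C mu : R) : 0 <= mu < 1 ->
  (forall k, `|u k.+1 - u k| <= C * mu ^+ k) ->
  exists l : 'rV[R]_d, forall k, `|l - u k| <= C / (1 - mu) * mu ^+ k.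
Proof.
move=> mu01 Hu; have /andP[mu0 mu1] := mu01.
have C0 : 0 <= C.
  by have := le_trans (normr_ge0 _) (Hu 0%N); rewrite expr0 mulr1.
have mu1' : 0 < 1 - mu by rewrite subr_gt0.
(* The factor [1 - mu ^+ j] keeps the exact partial geometric sum, which makes the induction on j
   close. *)
have H k j : `|u (k + j)%N - u k| <= C / (1 - mu) * (mu ^+ k * (1 - mu ^+ j)).
  elim: j => [|j IH]; first by rewrite addn0 subrr normr0 expr0 subrr !mulr0.
  have -> : u (k + j.+1)%N - u k =
      (u (k + j).+1 - u (k + j)%N) + (u (k + j)%N - u k).
    by rewrite addnS addrA subrK.
  apply: (le_trans (ler_normD _ _)).
  apply: (le_trans (lerD (Hu (k + j)%N) IH)).
  rewrite le_eqVlt; apply/orP; left; apply/eqP.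
  by rewrite exprD exprS; field; rewrite gt_eqF.
have HB k m : (k <= m)%N -> `|u m - u k| <= C / (1 - mu) * mu ^+ k.
  move=> km; rewrite -(subnKC km); apply: (le_trans (H _ _)).
  rewrite ler_wpM2l ?divr_ge0 ?(ltW mu1')// ler_piMr ?exprn_ge0//.
  by rewrite gerBl exprn_ge0.
have /cauchy_cvgP ucvg : cauchy (u @ \oo).
  apply/cauchy_ballP => e e0; have e2 : 0 < e / 4 by lra.
  have [K _ HK] := geometric_small (C / (1 - mu)) mu01 e2.
  rewrite near_map2; near=> a b.
  rewrite -ball_normE /=.
  have -> : u a - u b = (u a - u K) - (u b - u K) by rewrite opprB addrA subrK.
  apply: (le_lt_trans (ler_normB _ _)).
  have Ka : `|u a - u K| <= e / 4.
    by apply: le_trans (HK K _) => /=; [apply: HB; near: a; exact: nbhs_infty_ge|].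
  have Kb : `|u b - u K| <= e / 4.
    by apply: le_trans (HK K _) => /=; [apply: HB; near: b; exact: nbhs_infty_ge|].
  lra.
exists (lim (u @ \oo)) => k.
apply/ler_addgt0Pr => e e0.
have /cvgrPdist_le/(_ _ e0) ue := ucvg.
near \oo => m.
have km : (k <= m)%N by near: m; exact: nbhs_infty_ge.
rewrite -(subrK (u m) (lim _)) -addrA (le_trans (ler_normD _ _)) // [leRHS]addrC.
rewrite lerD //; last by rewrite HB.
by near: m.
Unshelve. all: by end_near. Qed.

Variables (I : Type) (d : nat) (q : I -> 'rV[R]_d -> R) (C mu : R).
Hypothesis C_ge0 : 0 <= C.
Hypothesis mu01 : 0 <= mu < 1.
Hypothesis q_lb : forall n v, `|v| <= C * q n v.
Hypothesis q_ub : forall n v, q n v <= C * `|v|.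

(** Any uniform bound on the differences improves by the factor mu, so iteration drives the bound to
    0. *)
Lemma seq_contraction_eq (v v' : I -> 'rV[R]_d) (s : R) :
  (forall n, q n (v n - v' n) <= s) ->
  (forall s, (forall n, q n (v n - v' n) <= s) ->
     forall n, q n (v n - v' n) <= mu * s) ->
  forall n, v n = v' n.
Proof.
move=> s0 H n; have Hk k : forall n, q n (v n - v' n) <= s * mu ^+ k.
  elim: k => [|k IH]; first by rewrite expr0 mulr1.
  by rewrite exprS mulrCA; exact: H.
have q0 : q n (v n - v' n) <= 0.
  apply/ler_addgt0Pr => e e0; have [K _ HK] := geometric_small s mu01 e0.
  rewrite add0r; exact: le_trans (Hk K n) (HK K (leqnn K)).
apply/eqP; rewrite -subr_eq0 -normr_le0.
by apply: (le_trans (q_lb n _)); rewrite -(mulr0 C) ler_wpM2l.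
Qed.

Hypothesis q_triangle : forall n u v, q n (u + v) <= q n u + q n v.

(** Banach's fixed point theorem for the supremum over n of [q n], each supremum being replaced by a
    uniform inequality so that no space of bounded sequences is built. The limit is taken separately
    for each n, at a rate independent of n. T only has to contract on the ball that it preserves. *)
Lemma seq_fixpoint (rho : R) (T : (I -> 'rV[R]_d) -> I -> 'rV[R]_d) :
  0 <= rho ->
  (forall v, (forall n, q n (v n) <= rho) -> forall n, q n (T v n) <= rho) ->
  (forall v v', (forall n, q n (v n) <= rho) -> (forall n, q n (v' n) <= rho) ->
     forall s, (forall n, q n (v n - v' n) <= s) ->
     forall n, q n (T v n - T v' n) <= mu * s) ->
  exists v, (forall n, q n (v n) <= rho) /\ forall n, T v n = v n.
Proof.
move=> rho0 Tself Tcontr; have /andP[mu0 mu1] := mu01.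
have mu1' : 0 < 1 - mu by rewrite subr_gt0.
pose u k := iter k T (fun _ => 0).
have uD k n : q n (u k n) <= rho.
  elim: k n => [|k IH] n /=; last exact: Tself.
  by apply: le_trans (q_ub n _) _; rewrite normr0 mulr0.
have [s0 us0] : exists s0, forall n, q n (u 1%N n - u 0%N n) <= s0.
  exists (C * (C * rho)) => n /=; rewrite subr0.
  apply: (le_trans (q_ub _ _)); rewrite ler_wpM2l //.
  apply: (le_trans (q_lb n _)); rewrite ler_wpM2l //; exact: (uD 1%N).
have uk k n : q n (u k.+1 n - u k n) <= s0 * mu ^+ k.
  elim: k n => [|k IH] n; first by rewrite expr0 mulr1.
  by rewrite exprS mulrCA; exact: (Tcontr (u k.+1) (u k)).
have /choice[v Hv] : forall n, exists l, forall k,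
    `|l - u k n| <= C * s0 / (1 - mu) * mu ^+ k.
  move=> n; apply: geometric_cvg => // k.
  by apply: (le_trans (q_lb n _)); rewrite -mulrA ler_wpM2l.
have vq n k : q n (v n - u k n) <= C * (C * s0 / (1 - mu)) * mu ^+ k.
  by apply: (le_trans (q_ub _ _)); rewrite -!mulrA ler_wpM2l // !mulrA.
have vD n : q n (v n) <= rho.
  apply/ler_addgt0Pr => e e0.
  have [K _ HK] := geometric_small (C * (C * s0 / (1 - mu))) mu01 e0.
  rewrite -(subrK (u K n) (v n)) (le_trans (q_triangle _ _ _)) // addrC.
  by rewrite lerD // (le_trans (vq _ _) (HK K (leqnn K))).
exists v; split=> // n; apply/eqP; rewrite -subr_eq0 -normr_le0.
apply/ler_addgt0Pr => e e0; rewrite add0r.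
pose D := C * s0 / (1 - mu).
have [K _ HK] := geometric_small (C * (mu * (C * D)) + D * mu) mu01 e0.
apply: le_trans (HK K (leqnn K)).
have -> : T v n - v n = (T v n - T (u K) n) - (v n - u K.+1 n).
  by change (u K.+1 n) with (T (u K) n); rewrite opprB addrA subrK.
have TK : q n (T v n - T (u K) n) <= mu * (C * D * mu ^+ K).
  by apply: (Tcontr v (u K)) => // m; exact: vq.
apply: (le_trans (ler_normB _ _)).
apply: (le_trans (lerD (q_lb n _) (Hv n _))).
apply: (@le_trans _ _ (C * (mu * (C * D * mu ^+ K)) + D * mu ^+ K.+1)).
  by rewrite lerD // ler_wpM2l.
by rewrite exprS le_eqVlt; apply/orP; left; apply/eqP; ring.
Qed.

End Contraction.

(* Bounded solutions v of [g n (v n) = v (n + 1) + e n], where g n is a small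
   Lipschitz perturbation of the hyperbolic matrix A n acting on row vectors and
   B n inverts A n on the unstable direction. *)
Section Hyperbolic.
Context {R : realType} {d : nat}.
Variables (N : int -> 'rV[R]_d -> R) (Ps Pu A B : int -> 'M[R]_d).
Variables (g : int -> 'rV[R]_d -> 'rV[R]_d) (C mu kap rho : R).
Hypothesis C_ge1 : 1 <= C.
Hypothesis mu_ge0 : 0 <= mu.
Hypothesis kap_ge0 : 0 <= kap.
Hypothesis rho_gt0 : 0 < rho.
Hypothesis N_lb : forall n v, `|v| <= C * N n v.
Hypothesis N_ub : forall n v, N n v <= C * `|v|.
Hypothesis N_triangle : forall n u v, N n (u + v) <= N n u + N n v.
Hypothesis PsDPu : forall n, Ps n + Pu n = 1%:M.
Hypothesis PsPs : forall n, Ps n *m Ps n = Ps n.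
Hypothesis PuPs : forall n, Pu n *m Ps n = 0.
Hypothesis Ps_bound : forall n (v : 'rV[R]_d), `|v *m Ps n| <= C * `|v|.
Hypothesis Pu_bound : forall n (v : 'rV[R]_d), `|v *m Pu n| <= C * `|v|.
Hypothesis B_bound : forall n (v : 'rV[R]_d), `|v *m B n| <= C * `|v|.
Hypothesis BPu : forall n, B n *m Pu n = B n.
Hypothesis AB : forall n, A n *m B n = Pu n.

(** A maximum rather than a sum, so that the stable and the unstable component can be estimated
    separately, each with the rate mu. K is the constant comparing q with the plain norm. *)
Let q n v := Num.max (N n (v *m Ps n)) (N n (v *m Pu n)).
Let K := 2 * C ^+ 2.

Hypothesis stable_contr : forall n v, N (n + 1) (v *m A n *m Ps (n + 1)) <= mu * q n v.
Hypothesis unstable_contr : forall n v, N n (v *m B n) <= mu * q (n + 1) v.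
Hypothesis transversal : forall n (v : 'rV[R]_d),
  v *m Ps (n + 1) = 0 -> v *m B n = 0 -> v = 0.
Hypothesis g0 : forall n, g n 0 = 0.
Hypothesis g_lip : forall n v v', `|v| <= rho -> `|v'| <= rho ->
  `|g n v - g n v' - (v - v') *m A n| <= kap * `|v - v'|.
Hypothesis mu'_lt1 : mu + C ^+ 2 * K * kap < 1.

Let C_ge0 : 0 <= C. Proof. exact: le_trans C_ge1. Qed.
Let K_ge1 : 1 <= K.
Proof. by have : 1 <= C ^+ 2 by [exact: exprn_ege1]; rewrite /K; lra. Qed.
Let K_ge0 : 0 <= K. Proof. exact: le_trans K_ge1. Qed.
Let N_ge0 n v : 0 <= N n v.
Proof.
have := le_trans (normr_ge0 _) (N_lb n v).
by rewrite pmulr_rge0 // (lt_le_trans _ C_ge1).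
Qed.
Let mu' := mu + C ^+ 2 * K * kap.
Let mu'01 : 0 <= mu' < 1.
Proof. by rewrite mu'_lt1 andbT addr_ge0 // !mulr_ge0 // exprn_ge0. Qed.
Let BPs n : B n *m Ps n = 0.
Proof. by rewrite -BPu -mulmxA PuPs mulmx0. Qed.

Let q_lb n v : `|v| <= K * q n v.
Proof.
have -> : v = v *m Ps n + v *m Pu n by rewrite -mulmxDr PsDPu mulmx1.
have -> : q n (v *m Ps n + v *m Pu n) = q n v by rewrite -mulmxDr PsDPu mulmx1.
have q0 : 0 <= q n v by rewrite le_max N_ge0.
apply: (le_trans (ler_normD _ _)); apply: (le_trans (lerD (N_lb n _) (N_lb n _))).
apply: (@le_trans _ _ (C * q n v + C * q n v)).
  by rewrite lerD // ler_wpM2l // le_max lexx ?orbT.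
have : C * q n v <= C ^+ 2 * q n v by rewrite ler_wpM2r // expr2 ler_peMl.
by rewrite /K; lra.
Qed.

Let CC_K (v : 'rV[R]_d) : C * (C * `|v|) <= K * `|v|.
Proof. by rewrite mulrA -expr2 /K ler_wpM2r // ler_peMl ?exprn_ge0 ?ler1n. Qed.

Let q_ub n v : q n v <= K * `|v|.
Proof.
have H (P : 'M[R]_d) : `|v *m P| <= C * `|v| -> N n (v *m P) <= K * `|v|.
  by move=> Pv; apply: le_trans (N_ub _ _) (le_trans _ (CC_K v)); rewrite ler_wpM2l.
by rewrite ge_max !H.
Qed.

Let q_triangle n u v : q n (u + v) <= q n u + q n v.
Proof.
rewrite /q ge_max !mulmxDl !(le_trans (N_triangle _ _ _)) // lerD //.
all: by rewrite le_max lexx ?orbT.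
Qed.

(* The solutions are the fixed points of T, which determines the stable
   component of v n from v (n - 1) and the unstable one from v (n + 1). *)
Let T (e : int -> 'rV[R]_d) (v : int -> 'rV[R]_d) (n : int) : 'rV[R]_d :=
  (g (n - 1) (v (n - 1)) - e (n - 1)) *m Ps n +
  (v (n + 1) + e n - (g n (v n) - v n *m A n)) *m B n.

Let T_Ps e v n : T e v n *m Ps n = (g (n - 1) (v (n - 1)) - e (n - 1)) *m Ps n.
Proof. by rewrite mulmxDl -!mulmxA PsPs BPs mulmx0 addr0. Qed.

Let PsPu n : Ps n *m Pu n = 0.
Proof.
have := congr1 (mulmx (Ps n)) (PsDPu n); rewrite mulmxDr PsPs mulmx1.
by move/eqP; rewrite addrC -subr_eq0 addrK => /eqP.
Qed.

Let T_Pu e v n :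
  T e v n *m Pu n = (v (n + 1) + e n - (g n (v n) - v n *m A n)) *m B n.
Proof. by rewrite mulmxDl -!mulmxA PsPu BPu mulmx0 add0r. Qed.

(** The linear part of T contracts by mu. The remainder [g n v - v *m A n] is Lipschitz with
    constant kap in the plain norm; returning to q costs K for the argument, C for the matrix and C
    for [N], whence the term [C ^+ 2 * K * kap] of mu'. *)
Let T_contr e v v' s : (forall n, `|v n| <= rho) -> (forall n, `|v' n| <= rho) ->
  (forall n, q n (v n - v' n) <= s) -> forall n, q n (T e v n - T e v' n) <= mu' * s.
Proof.
move=> vr vr' qs n.
have dv m : kap * `|v m - v' m| <= kap * (K * s).
  by rewrite ler_wpM2l // (le_trans (q_lb m _)) // ler_wpM2l.
have err m k P : (forall w : 'rV[R]_d, `|w *m P| <= C * `|w|) ->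
    N k ((g m (v m) - g m (v' m) - (v m - v' m) *m A m) *m P)
      <= C ^+ 2 * K * kap * s.
  move=> HP; apply: (le_trans (N_ub _ _)).
  apply: (@le_trans _ _ (C * (C * (kap * (K * s))))).
    rewrite ler_wpM2l // (le_trans (HP _)) // ler_wpM2l //.
    by apply: le_trans (dv m); exact: g_lip.
  by rewrite le_eqVlt; apply/orP; left; apply/eqP; ring.
rewrite /q ge_max !mulmxBl T_Ps T_Ps T_Pu T_Pu -!mulmxBl.
apply/andP; split.
  have [m ->] : exists m, n = m + 1 by exists (n - 1); rewrite subrK.
  rewrite addrK.
  have -> : g m (v m) - e m - (g m (v' m) - e m) =
     (v m - v' m) *m A m + (g m (v m) - g m (v' m) - (v m - v' m) *m A m).
    by rewrite opprB addrA subrK [RHS]addrC subrK.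
  rewrite mulmxDl (le_trans (N_triangle _ _ _)) // /mu' mulrDl lerD //.
    by rewrite (le_trans (stable_contr _ _)) // ler_wpM2l.
  exact: err.
have -> : v (n + 1) + e n - (g n (v n) - v n *m A n) -
     (v' (n + 1) + e n - (g n (v' n) - v' n *m A n)) =
   (v (n + 1) - v' (n + 1)) +
   (g n (v' n) - g n (v n) - (v' n - v n) *m A n).
  rewrite mulmxBl; move: (v n *m _) (v' n *m _) => a b.
  by apply/rowP => i; rewrite !mxE; ring.
rewrite mulmxDl (le_trans (N_triangle _ _ _)) // /mu' mulrDl lerD //.
  by rewrite (le_trans (unstable_contr _ _)) // ler_wpM2l.
have -> : g n (v' n) - g n (v n) - (v' n - v n) *m A n =
    - (g n (v n) - g n (v' n) - (v n - v' n) *m A n).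
  by rewrite !mulmxBl; apply/rowP => i; rewrite !mxE; ring.
rewrite mulNmx -mulmxN; apply: err => w.
by rewrite mulmxN normrN.
Qed.

(** Every solution is a fixed point of T: the stable part of [v n] is read off from the equation at
    n - 1, the unstable one from the equation at n, since [A n *m B n = Pu n]. The common bound rho
    makes the differences uniformly bounded, and the contraction then makes them vanish. *)
Lemma hyperbolic_unique (e v v' : int -> 'rV[R]_d) :
  (forall n, `|v n| <= rho) -> (forall n, `|v' n| <= rho) ->
  (forall n, g n (v n) = v (n + 1) + e n) ->
  (forall n, g n (v' n) = v' (n + 1) + e n) ->
  forall n, v n = v' n.
Proof.
move=> vr vr' gv gv'.
have Tfix u : (forall n, g n (u n) = u (n + 1) + e n) -> forall n, T e u n = u n.
  move=> gu n; rewrite /T !gu subrK addrK opprB [X in X *m B n]addrC subrK.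
  by rewrite -mulmxA AB -mulmxDr PsDPu mulmx1.
apply: (@seq_contraction_eq _ _ _ q K mu' K_ge0 mu'01 q_lb _ _ (K * (rho + rho))).
  move=> n; apply: (le_trans (q_ub _ _)); rewrite ler_wpM2l //.
  exact: le_trans (ler_normB _ _) (lerD (vr n) (vr' n)).
by move=> s qs n; rewrite -(Tfix _ gv) -(Tfix _ gv'); exact: T_contr.
Qed.

(** In the q-ball of radius rho / K all norms stay below rho, where [g_lip] applies. T preserves
    this ball as soon as the image of 0, of size [C ^+ 2 * eps], is at most (1 - mu') times its
    radius; this is the condition on eps. *)
Lemma hyperbolic_solution (e : int -> 'rV[R]_d) (eps : R) :
  (forall n, `|e n| <= eps) -> K * C ^+ 2 * eps <= (1 - mu') * rho ->
  exists v, (forall n, `|v n| <= rho) /\ forall n, g n (v n) = v (n + 1) + e n.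
Proof.
move=> ee Heps; have /andP[mu'0 mu'1] := mu'01.
have Kgt0 : 0 < K by exact: lt_le_trans K_ge1.
pose r0 := rho / K.
have r00 : 0 <= r0 by rewrite divr_ge0 // ltW.
have Dr (v : int -> 'rV[R]_d) : (forall n, q n (v n) <= r0) -> forall n, `|v n| <= rho.
  move=> qv n; apply: (le_trans (q_lb n _)).
  by rewrite (le_trans (ler_wpM2l K_ge0 (qv n))) // /r0 mulrC divfK // gt_eqF.
have q0 n : q n 0 <= r0 by rewrite (le_trans (q_ub _ _)) // normr0 mulr0.
have T0 n : q n (T e (fun _ => 0) n) <= C ^+ 2 * eps.
  rewrite /q ge_max T_Ps T_Pu !g0 mul0mx subrr subr0 !add0r.
  have H (w : 'rV[R]_d) (P : 'M[R]_d) : `|w| <= eps -> `|w *m P| <= C * `|w| ->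
      N n (w *m P) <= C ^+ 2 * eps.
    move=> we Hw; rewrite (le_trans (N_ub _ _)) // expr2 -mulrA ler_wpM2l //.
    by rewrite (le_trans Hw) // ler_wpM2l.
  by apply/andP; split; (apply: H; first rewrite ?normrN).
have [|v v' qv qv' s qs n|v [qv Tv]] := @seq_fixpoint _ _ _ q K mu' K_ge0 mu'01
    q_lb q_ub q_triangle r0 (T e) r00.
- move=> v qv n; rewrite -[T e v n](subrK (T e (fun _ => 0) n)).
  rewrite (le_trans (q_triangle _ _ _)) //.
  have -> : r0 = mu' * r0 + (1 - mu') * r0 by ring.
  rewrite lerD //.
    apply: (@T_contr e v (fun _ => 0)) => [||m].
    + exact: Dr.
    + by move=> m; rewrite normr0 ltW.
    + by rewrite subr0.
  by rewrite (le_trans (T0 _)) // /r0 mulrA ler_pdivlMr // mulrC mulrA.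
- exact: T_contr (Dr _ qv) (Dr _ qv') qs n.
exists v; split; first exact: Dr.
move=> n; apply/eqP; rewrite eq_sym -subr_eq0; apply/eqP.
(* The defect of the recursion at n is killed by [Ps (n + 1)], from the stable component of the
   fixed point at n + 1, and by [B n], from the unstable one at n. *)
apply: (@transversal n).
  have := T_Ps e v (n + 1); rewrite Tv addrK => H.
  by rewrite -addrA mulmxDl H -mulmxDl addrA subrK subrr mul0mx.
have := T_Pu e v n; rewrite Tv opprB addrA [X in X *m B n]addrAC.
rewrite mulmxDl -[v n *m A n *m B n]mulmxA AB => /eqP.
by rewrite -subr_eq subrr eq_sym => /eqP.
Qed.

End Hyperbolic.

(** * Jacobians in charts *)

Section Jacobian.
Context {R : realType}.

Lemma diff_near_eq (V W : normedModType R) (f f' : V -> W) (x : V) :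
  (\forall y \near x, f y = f' y) -> differentiable f x ->
  differentiable f' x /\ 'd f' x = 'd f x :> (V -> W).
Proof.
move=> ff' df; have fx : f x = f' x by exact: nbhs_singleton ff'.
have [dfc dfE] := (diff_locallyP x f).1 df.
have E : f' \o shift x = cst (f' x) + 'd f x +o_ 0 id.
  apply/eqaddoP => e e0.
  have /eqaddoP/(_ _ e0) := dfE.
  have : \forall y \near 0, f (y + x) = f' (y + x).
    have := ff'; rewrite (near_shift 0 x).
    by apply: filterS => y; rewrite /= subr0.
  move=> H; rewrite -fx; apply: filterS2 H => y yE.
  by rewrite !fctE /= yE.
have dE : 'd f' x = 'd f x :> (V -> W) by apply/diff_unique.
split; last exact: dE.
by apply/diff_locallyP; rewrite dE; split; [exact: dfc|exact: E].
Qed.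

Context {d : nat}.
Implicit Types f h : 'rV[R]_d -> 'rV[R]_d.

Lemma mul_jacobian f a v : v *m 'J f a = 'd f a v.
Proof. by rewrite mul_rV_lin1. Qed.

Lemma jacobian_near_eq f f' a : (\forall y \near a, f y = f' y) ->
  differentiable f a -> differentiable f' a /\ 'J f' a = 'J f a.
Proof.
move=> ff' /(diff_near_eq ff')[df' dE]; split; first exact: df'.
apply: rowP_mx => v.
exact: etrans (mul_jacobian f' a v) (etrans (congr1 (@^~ v) dE) (esym (mul_jacobian f a v))).
Qed.

(** Vectors are rows, so Jacobians multiply in the order in which the maps are applied. *)
Lemma jacobian_comp f h a : differentiable f a -> differentiable h (f a) ->
  'J (h \o f) a = 'J f a *m 'J h (f a).
Proof.
move=> df dh; apply: rowP_mx => v.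
have E1 := mul_jacobian f a v.
have E2 := mul_jacobian h (f a) (v *m 'J f a).
apply: etrans (mul_jacobian (h \o f) a v) _.
apply: etrans (congr1 (@^~ v) (diff_comp df dh)) _.
exact: esym (etrans (mulmxA _ _ _) (etrans E2 (congr1 ('d h (f a)) E1))).
Qed.

Lemma jacobian_id a : 'J (@id 'rV[R]_d) a = 1%:M.
Proof.
apply: rowP_mx => v; rewrite mulmx1 mul_jacobian.
by have -> : 'd (@id 'rV[R]_d) a = @id 'rV[R]_d :> (_ -> _) by exact: diff_val.
Qed.

Lemma C_on_differentiable k A f a : C_on k.+1 A f -> A a -> differentiable f a.
Proof. by move=> Cf Aa; have [_ /(_ isT)] := Cf [::] isT _ Aa. Qed.

Lemma C_on_continuous k (V W : normedModType R) A (f : V -> W) a :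
  C_on k A f -> A a -> {for a, continuous f}.
Proof. by move=> Cf Aa; have [] := Cf [::] isT _ Aa. Qed.

Lemma C_on_continuous_diff k A f a v : C_on k.+1 A f -> A a ->
  {for a, continuous (fun b => 'd f b v)}.
Proof. by move=> Cf Aa; have [] := Cf [:: v] isT _ Aa. Qed.

Lemma jacobianE f a i j : 'J f a i j = ('d f a (delta_mx 0 i)) 0 j.
Proof. by rewrite mxE. Qed.

Lemma C_on_continuous_jacobian k A f a : C_on k.+1 A f -> A a ->
  {for a, continuous (jacobian f)}.
Proof.
move=> Cf Aa; suff : jacobian f b @[b --> a] --> jacobian f a by [].
apply: (proj1 (@cvg_mxP _ _ (nbhs a) (nbhs_filter a) _ _ (jacobian f) ('J f a))) => i j.
have E b : 'J f b i j = ('d f b (delta_mx 0 i)) 0 j by exact: jacobianE.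
have -> : (fun b => 'J f b i j) = (fun b => ('d f b (delta_mx 0 i)) 0 j) by exact/funext.
rewrite (E a).
have H := C_on_continuous_diff (v := delta_mx 0 i) Cf Aa.
exact: (cvg_comp _ _ H (@coord_continuous _ _ _ 0 j _)).
Qed.

End Jacobian.

(** Locked so that conversion does not unfold it into differentials of local representatives. *)
HB.lock Definition chart_jacobian (R : realType) (d : nat) (M : topologicalType)
    (S : smooth_manifold R d M) (i j : chart_index S) (f : M -> M) (x : M) :
    'M[R]_d :=
  'J (local_rep i j f) (chart i x).
Canonical chart_jacobian_unlockable := Unlockable chart_jacobian.unlock.

Section Charts.
Context {R : realType} {d : nat} {M : topologicalType}.
Variable S : smooth_manifold R d M.
Implicit Types (i j k : chart_index S) (x : M).

Lemma dom_nbhs i x : dom i x -> nbhs x (dom i).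
Proof. by move=> ix; apply: open_nbhs_nbhs; split=> //; exact: dom_open. Qed.

Lemma chart_img_nbhs i x : dom i x -> nbhs (chart i x) (chart i @` dom i).
Proof.
move=> ix; apply: open_nbhs_nbhs; split; first exact: chart_img_open.
by exists x.
Qed.

Lemma ichart_dom i a : (chart i @` dom i) a -> dom i (ichart i a).
Proof. by move=> [x ix <-]; rewrite chartK. Qed.

Lemma ichartK i a : (chart i @` dom i) a -> chart i (ichart i a) = a.
Proof. by move=> [x ix <-]; rewrite chartK. Qed.

Lemma ichart_cvg i x : dom i x -> ichart i a @[a --> chart i x] --> x.
Proof.
move=> ix; rewrite -[X in _ --> X](chartK ix).
by apply: ichart_continuous; exists x.
Qed.

Lemma near_ichart i x (P : M -> Prop) : dom i x -> (\forall y \near x, P y) ->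
  \forall a \near chart i x, P (ichart i a).
Proof. by move=> ix; exact: ichart_cvg. Qed.

Lemma chart_jacobianE i j f x :
  chart_jacobian i j f x = 'J (local_rep i j f) (chart i x).
Proof. by rewrite unlock. Qed.

Definition chart_differentiable i j (f : M -> M) x : Prop :=
  differentiable (local_rep i j f) (chart i x).

(** The representatives compose only where f stays in the domain of the middle chart j. Continuity
    of f makes this a neighbourhood of x, and the Jacobian depends on the germ alone. *)
Lemma chart_jacobian_comp i j k (f h : M -> M) x :
  dom i x -> dom j (f x) -> {for x, continuous f} ->
  chart_differentiable i j f x -> chart_differentiable j k h (f x) ->
  chart_differentiable i k (h \o f) x /\
  chart_jacobian i k (h \o f) x =
    chart_jacobian i j f x *m chart_jacobian j k h (f x).
Proof.
move=> ix jfx fc df dh.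
have fE : local_rep i j f (chart i x) = chart j (f x).
  by rewrite /local_rep /= chartK.
have dh' : differentiable (local_rep j k h) (local_rep i j f (chart i x)).
  by rewrite fE.
have near_eq : \forall a \near chart i x,
    (local_rep j k h \o local_rep i j f) a = local_rep i k (h \o f) a.
  have : \forall y \near x, dom j (f y) by apply: fc; exact: dom_nbhs.
  move=> /(near_ichart ix); apply: filterS => a ja.
  by rewrite /local_rep /= chartK.
have [dhf JE] := jacobian_near_eq near_eq (differentiable_comp df dh').
split; first exact: dhf.
by rewrite !chart_jacobianE JE (jacobian_comp df dh') fE.
Qed.

Lemma chart_id_C_on n i j :
  C_on n (chart i @` (dom i `&` dom j)) (local_rep i j id).
Proof. exact: transition_smooth. Qed.

Lemma chart_differentiable_id i j x : dom i x -> dom j x ->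
  chart_differentiable i j id x.
Proof. by move=> ix jx; apply: (C_on_differentiable (@chart_id_C_on 1 i j)); exists x. Qed.

(** Tangent vectors at x are stored in the coordinates of [chart_at S x]; multiplication by this
    matrix, with [chart_at S x] for i, moves them into a fixed chart. *)
Definition transition i j x : 'M[R]_d := chart_jacobian i j id x.

Lemma transition_comp i j k x : dom i x -> dom j x -> dom k x ->
  transition i j x *m transition j k x = transition i k x.
Proof.
move=> ix jx kx.
have [|||_ E] := @chart_jacobian_comp i j k id id x ix jx.
- exact: cvg_id.
- exact: chart_differentiable_id.
- exact: chart_differentiable_id.
- exact: esym.
Qed.

Lemma transition_id i x : dom i x -> transition i i x = 1%:M.
Proof.
move=> ix; rewrite -(jacobian_id (chart i x)).
have near_eq : \forall a \near chart i x, id a = local_rep i i id a.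
  apply: filterS (chart_img_nbhs ix) => a ia.
  by rewrite /local_rep /= ichartK.
have [_ JE] := jacobian_near_eq near_eq (ex_diff (is_diff_def:=is_diff_id _)).
by rewrite /transition chart_jacobianE; exact: JE.
Qed.

Lemma transitionK i j x : dom i x -> dom j x ->
  transition i j x *m transition j i x = 1%:M.
Proof. by move=> ix jx; rewrite transition_comp // transition_id. Qed.

Lemma to_coordE i x (v : tangent x) :
  to_coord i v = (v : 'rV[R]_d) *m transition (chart_at S x) i x.
Proof. by rewrite /transition chart_jacobianE mul_jacobian. Qed.

Lemma of_coordE i x (u : 'rV[R]_d) :
  of_coord i x u = u *m transition i (chart_at S x) x :> 'rV[R]_d.
Proof. by rewrite /transition chart_jacobianE mul_jacobian. Qed.

Lemma tangent_mapE (f : M -> M) x (v : tangent x) :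
  tangent_map S f v = (v : 'rV[R]_d) *m
     chart_jacobian (chart_at S x) (chart_at S (f x)) f x :> 'rV[R]_d.
Proof. by rewrite /transition chart_jacobianE mul_jacobian. Qed.

Lemma transition_continuous i j x : dom i x -> dom j x ->
  {for x, continuous (transition i j)}.
Proof.
move=> ix jx.
have -> : transition i j = jacobian (local_rep i j id) \o chart i.
  by apply/funext => y; rewrite /transition chart_jacobianE.
apply: continuous_comp.
  exact: chart_continuous.
by apply: (C_on_continuous_jacobian (@chart_id_C_on 1 i j)); exists x.
Qed.

Lemma C2_map_differentiable (f : M -> M) i j x : C2_map S f ->
  dom i x -> dom j (f x) -> chart_differentiable i j f x.
Proof.
move=> [fc fC] ix jfx; apply: (C_on_differentiable (fC i j)).
by exists x.
Qed.

Lemma C2_map_chart_jacobian_continuous (f : M -> M) i j x : C2_map S f ->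
  dom i x -> dom j (f x) -> {for x, continuous (chart_jacobian i j f)}.
Proof.
move=> [fc fC] ix jfx.
have -> : chart_jacobian i j f = jacobian (local_rep i j f) \o chart i.
  by apply/funext => y; rewrite chart_jacobianE.
apply: continuous_comp.
  exact: chart_continuous.
by apply: (C_on_continuous_jacobian (fC i j)); exists x.
Qed.

Lemma chart_jacobian_change (f : M -> M) i i' j j' x : C2_map S f ->
  dom i x -> dom i' x -> dom j (f x) -> dom j' (f x) ->
  chart_jacobian i j f x =
    transition i i' x *m chart_jacobian i' j' f x *m transition j' j (f x).
Proof.
move=> fC ix i'x jfx j'fx; have fc : continuous f by case: fC.
have d1 := C2_map_differentiable fC i'x j'fx.
have [|||d2 E2] := @chart_jacobian_comp i i' j' id f x ix i'x.
- exact: cvg_id.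
- exact: chart_differentiable_id.
- exact: d1.
have [|||_ E] := @chart_jacobian_comp i j' j (id \o f) id x ix j'fx.
- exact: fc.
- exact: C2_map_differentiable.
- exact: chart_differentiable_id.
rewrite -[chart_jacobian i j f x]/(chart_jacobian i j (id \o (id \o f)) x) E.
by congr (_ *m _); exact: E2.
Qed.

End Charts.

(** * Quadratic forms and the metric in charts *)

Section QuadraticForm.
Context {R : realType} {d : nat}.

Definition quad (G : 'M[R]_d) (u v : 'rV[R]_d) : R := (u *m G *m v^T) 0 0.

Lemma quadDl G u u' v : quad G (u + u') v = quad G u v + quad G u' v.
Proof. by rewrite /quad !mulmxDl mxE. Qed.

Lemma quadDr G u v v' : quad G u (v + v') = quad G u v + quad G u v'.
Proof. by rewrite /quad linearD /= mulmxDr mxE. Qed.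

Lemma quadZl G a u v : quad G (a *: u) v = a * quad G u v.
Proof. by rewrite /quad -!scalemxAl mxE. Qed.

Lemma quadZr G a u v : quad G u (a *: v) = a * quad G u v.
Proof. by rewrite /quad linearZ /= -scalemxAr mxE. Qed.

Lemma quad_bound G u : `|quad G u u| <= d%:R ^+ 2 * `|G| * `|u| ^+ 2.
Proof.
apply: (le_trans (le_mx_entry _ _ _)); apply: (le_trans (mulmx_norm_le _ _)).
rewrite trmx_norm; apply: (@le_trans _ _ (d%:R * (d%:R * (`|u| * `|G|) * `|u|))).
  by rewrite ler_wpM2l // ler_wpM2r // mulmx_norm_le.
by rewrite le_eqVlt; apply/orP; left; apply/eqP; ring.
Qed.

Lemma quadB G G' u v : quad (G - G') u v = quad G u v - quad G' u v.
Proof. by rewrite /quad mulmxBr mulmxBl !mxE. Qed.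

Definition qnorm G u : R := Num.sqrt (quad G u u).

Lemma qnorm_ge0 G u : 0 <= qnorm G u.
Proof. exact: sqrtr_ge0. Qed.

Lemma qnormZ G a u : qnorm G (a *: u) = `|a| * qnorm G u.
Proof.
by rewrite /qnorm quadZl quadZr mulrA -expr2 sqrtrM ?sqr_ge0 // sqrtr_sqr.
Qed.

Lemma qnorm_bound G u : qnorm G u <= Num.sqrt (d%:R ^+ 2 * `|G|) * `|u|.
Proof.
rewrite -[X in _ * X]normr_id -sqrtr_sqr -sqrtrM ?mulr_ge0 ?exprn_ge0 //.
by apply: ler_wsqrtr; apply: le_trans (quad_bound _ _); exact: ler_norm.
Qed.

Section SPD.
Variable G : 'M[R]_d.
Hypothesis G_sym : G^T = G.
Hypothesis G_pos : forall u : 'rV[R]_d, u != 0 -> 0 < quad G u u.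

Lemma quadC u v : quad G u v = quad G v u.
Proof.
rewrite /quad -[in LHS](trmxK (u *m G *m v^T)) mxE.
by rewrite !trmx_mul trmxK G_sym mulmxA.
Qed.

Lemma quad_ge0 u : 0 <= quad G u u.
Proof.
have [->|/G_pos/ltW //] := eqVneq u 0.
by rewrite /quad !mul0mx mxE.
Qed.

Lemma quad_CauchySchwarz u v : quad G u v ^+ 2 <= quad G u u * quad G v v.
Proof.
have [->|v0] := eqVneq v 0.
  by rewrite /quad trmx0 !mulmx0 !mxE expr0n /= mulr0.
have vv := G_pos v0; have vv0 : quad G v v != 0 by rewrite gt_eqF.
set t := - quad G u v / quad G v v.
have := quad_ge0 (u + t *: v).
rewrite !quadDl !quadDr !quadZl !quadZr (quadC v u).
have -> : quad G u u + t * quad G u v + (t * quad G u v + t * (t * quad G v v))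
  = quad G u u - quad G u v ^+ 2 / quad G v v by rewrite /t; field.
by rewrite subr_ge0 ler_pdivrMr.
Qed.

Lemma qnorm_triangle u v : qnorm G (u + v) <= qnorm G u + qnorm G v.
Proof.
rewrite -(ler_pXn2r (n := 2)) ?nnegrE ?addr_ge0 ?qnorm_ge0 //.
rewrite sqrrD /qnorm !sqr_sqrtr ?quad_ge0 // quadDl !quadDr (quadC v u).
have : quad G u v <= Num.sqrt (quad G u u) * Num.sqrt (quad G v v).
  rewrite -sqrtrM ?quad_ge0 // (le_trans (ler_norm _)) // -sqrtr_sqr.
  by rewrite ler_wsqrtr // quad_CauchySchwarz.
by rewrite mulr2n; lra.
Qed.

End SPD.

(** The squares of the two norms differ by at most k times [quad G u u], and the square root of 1 +
    k is at most 1 + k. *)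
Lemma qnorm_near G G' C k u : (forall v, 0 <= quad G v v) ->
  `|u| <= C * qnorm G u -> 0 <= C -> 0 <= k ->
  d%:R ^+ 2 * C ^+ 2 * `|G' - G| <= k ->
  qnorm G' u <= (1 + k) * qnorm G u.
Proof.
move=> Gp uC C0 k0 Hk.
have k1 : 0 <= 1 + k by rewrite addr_ge0.
have kq : 0 <= (1 + k) * qnorm G u by rewrite mulr_ge0 ?qnorm_ge0.
rewrite -(ger0_norm kq) -sqrtr_sqr; apply: ler_wsqrtr.
rewrite exprMn /qnorm sqr_sqrtr //.
have -> : quad G' u u = quad G u u + quad (G' - G) u u by rewrite quadB; ring.
have h1 : quad (G' - G) u u <= k * quad G u u.
  apply: (le_trans (ler_norm _)); apply: (le_trans (quad_bound _ _)).
  apply: (@le_trans _ _ (d%:R ^+ 2 * `|G' - G| * (C * qnorm G u) ^+ 2)).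
    rewrite ler_wpM2l ?mulr_ge0 ?exprn_ge0 //.
    by rewrite ler_pXn2r ?nnegrE // mulr_ge0 // qnorm_ge0.
  by rewrite exprMn /qnorm sqr_sqrtr // mulrA ler_wpM2r // mulrAC.
apply: (le_trans (lerD (lexx _) h1)).
rewrite -[X in X + _ <= _]mul1r -mulrDl ler_wpM2r //.
by rewrite expr2 ler_peMl // lerDl.
Qed.

End QuadraticForm.

Section ChartMetric.
Context {R : realType} {d : nat} {M : topologicalType}.
Variables (S : smooth_manifold R d M) (g : riemannian_metric S).
Implicit Types (i j k : chart_index S) (x : M).

Definition chart_gram k x : 'M[R]_d :=
  transition k (chart_at S x) x *m g x *m (transition k (chart_at S x) x)^T.

Lemma inner_of_coord k x u v :
  inner g (of_coord k x u) (of_coord k x v) = quad (chart_gram k x) u v.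
Proof.
by rewrite /inner !of_coordE /quad /chart_gram trmx_mul !mulmxA.
Qed.

Lemma chart_gram_sym k x : (chart_gram k x)^T = chart_gram k x.
Proof. by rewrite /chart_gram !trmx_mul trmxK gram_sym mulmxA. Qed.

Lemma chart_gram_pos k x (u : 'rV[R]_d) : dom k x -> u != 0 ->
  0 < quad (chart_gram k x) u u.
Proof.
move=> kx u0; rewrite -inner_of_coord; apply: gram_pos.
rewrite of_coordE; apply: contraNneq u0 => uT.
have := transitionK kx (dom_chart_at S x) => /(congr1 (mulmx u)).
by rewrite mulmxA uT mul0mx mulmx1 => <-.
Qed.

Lemma tnormE k x (v : tangent x) : dom k x ->
  tnorm g v = qnorm (chart_gram k x) (v *m transition (chart_at S x) k x).
Proof.
move=> kx; rewrite /tnorm /qnorm -inner_of_coord !of_coordE -!mulmxA.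
by rewrite transitionK ?mulmx1 //; exact: dom_chart_at.
Qed.

(** The matrix [g x] may jump with [chart_at S x]. Read in the fixed chart k, its entries are the
    functions of [gram_smooth], used here at order 0. *)
Lemma chart_gram_continuous k x : dom k x -> {for x, continuous (chart_gram k)}.
Proof.
move=> kx; suff : chart_gram k y @[y --> x] --> chart_gram k x by [].
apply: (proj1 (@cvg_mxP _ _ (nbhs x) (nbhs_filter x) _ _ (chart_gram k) (chart_gram k x))) => a b.
have E y : chart_gram k y a b = quad (chart_gram k y) (delta_mx 0 a) (delta_mx 0 b).
  by rewrite /quad -rowE trmx_delta -colE !mxE.
pose h (y : 'rV[R]_d) : R := quad (chart_gram k (ichart k y)) (delta_mx 0 a) (delta_mx 0 b).
have hc : {for chart k x, continuous h}.
  apply: (@C_on_continuous R 0 _ _ (chart k @` dom k)); last by exists x.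
  rewrite /h; under eq_fun do rewrite -inner_of_coord.
  exact: gram_smooth.
have H : h (chart k y) @[y --> x] --> h (chart k x).
  exact: (cvg_comp _ _ (chart_continuous kx) hc).
have hE y : dom k y -> h (chart k y) = chart_gram k y a b.
  by move=> ky; rewrite /h chartK //; exact: esym (E y).
apply: (cvg_near_ext (hE _ kx) _ H).
by apply: filterS (dom_nbhs kx) => y /hE.
Qed.

End ChartMetric.

(** * Continuity of the skew product and of the invariant splitting *)

Section SkewContinuity.
Context {R : realType} {d : nat} {M : topologicalType}.
Variables (S : smooth_manifold R d M) (M_compact : compact [set: M]).
Implicit Types (i j k l : chart_index S) (x : M).

Lemma C2_nbhd_nbhs (f : diff2 S) i j K (eps : R) :
  compact K -> K `<=` dom i -> (f : M -> M) @` K `<=` dom j -> 0 < eps ->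
  nbhs f (C2_nbhd f i j K eps).
Proof.
move=> cK Ki fK e0; apply: open_nbhs_nbhs; split; last first.
  by split=> // s _ x Kx /=; rewrite subrr normr0.
exists [set C2_nbhd f i j K eps]; last by rewrite bigcup_set1.
move=> _ ->; exists [fset C2_nbhd f i j K eps]%fset.
  move=> A; rewrite inE => /eqP ->; apply: mem_set.
  by exists f, i, j, K, eps.
by rewrite set_fset1 bigcap_set1.
Qed.

Lemma compact_nbhd x (A : set M) : nbhs x A ->
  exists K, [/\ nbhs x K, compact K & K `<=` A].
Proof.
move=> xA.
have [B xB BA] := compact_regular (manifold_hausdorff S) M_compact (filterT (F := nbhs x)) xA.
exists (closure B); split=> //.
  by apply: filterS xB; exact: subset_closure.
by apply: (subclosed_compact (@closed_closure _ B) M_compact).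
Qed.

Context {Omega : topologicalType}.
Variables (F : Omega -> diff2 S) (F_cont : continuous F).

(** A subbasic C^2 neighbourhood compares [F w] with [F w0] at the same point, uniformly over a
    compact neighbourhood K of x0. Joint continuity then follows by the triangle inequality from the
    continuity of [F w0] and of its Jacobian. *)
Lemma near_C2 w0 x0 k l (eps : R) : dom k x0 -> dom l (F w0 x0) -> 0 < eps ->
  \forall p \near (w0, x0), [/\ dom k p.2, dom l (F w0 p.2), dom l (F p.1 p.2),
    `|chart l (F p.1 p.2) - chart l (F w0 p.2)| < eps &
    forall a : 'I_d, `|'d (local_rep k l (F p.1)) (chart k p.2) (delta_mx 0 a) -
       'd (local_rep k l (F w0)) (chart k p.2) (delta_mx 0 a)| < eps].
Proof.
move=> kx lx e0.
have Fc : continuous (F w0) by have [] := diff2_C2 (F w0).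
have nA : nbhs x0 (dom k `&` F w0 @^-1` dom l).
  by apply: filterI; [exact: dom_nbhs|apply: Fc; exact: dom_nbhs].
have [K [xK cK KA]] := compact_nbhd nA.
have nN : nbhs (F w0) (C2_nbhd (F w0) k l K eps).
  apply: C2_nbhd_nbhs => // [x /KA[]//|y [x Kx <-]].
  by have [_] := KA _ Kx.
have n1 : \forall p \near (w0, x0), C2_nbhd (F w0) k l K eps (F p.1).
  exact: near_fst (F_cont nN).
have n2 : \forall p \near (w0, x0), K p.2.
  exact: near_snd xK.
apply: filterS2 n1 n2 => -[w x] /= [Fw HF] Kx; have [kx' lx'] := KA _ Kx.
split=> //.
- by apply: Fw; exists x.
- by have := HF [::] isT x Kx; rewrite /= /local_rep /= chartK.
- by move=> a; have := HF [:: a] isT x Kx.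
Qed.

Lemma skew_chart_cvg w0 x0 l : dom l (F w0 x0) ->
  chart l (F p.1 p.2) @[p --> (w0, x0)] --> chart l (F w0 x0).
Proof.
move=> lx; apply/cvg_at_dist => e e0; have e2 : 0 < e / 2 by rewrite divr_gt0.
have Fc : continuous (F w0) by have [] := diff2_C2 (F w0).
have H : chart l (F w0 x) @[x --> x0] --> chart l (F w0 x0).
  exact: (cvg_comp _ _ (Fc x0) (chart_continuous lx)).
have n1 := near_snd w0 ((proj1 (cvg_at_dist _ _ _) H) _ e2).
apply: filterS2 n1 (near_C2 (dom_chart_at S x0) lx e2) => -[w x] /= h1 [_ _ _ h2 _].
rewrite -(subrK (chart l (F w0 x)) (chart l (F w0 x0))) -addrA.
apply: (le_lt_trans (ler_normD _ _)); rewrite [X in _ + X]distrC.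
by rewrite (splitr e) ltrD.
Qed.

Lemma skew_continuous : continuous (fun p : Omega * M => F p.1 p.2).
Proof.
move=> [w0 x0] /=; set l := chart_at S (F w0 x0).
have lx : dom l (F w0 x0) by exact: dom_chart_at.
have H := cvg_comp _ _ (skew_chart_cvg lx) (ichart_cvg lx).
apply: (cvg_near_ext erefl _ H).
have := near_C2 (dom_chart_at S x0) lx (ltr01).
by apply: filterS => -[w x] /= [_ _ h _ _]; rewrite /= chartK.
Qed.

Lemma chart_jacobian_continuous w0 x0 k l : dom k x0 -> dom l (F w0 x0) ->
  chart_jacobian k l (F p.1) p.2 @[p --> (w0, x0)] -->
  chart_jacobian k l (F w0) x0.
Proof.
move=> kx lx; apply/cvg_at_dist => e e0; have e2 : 0 < e / 2 by rewrite divr_gt0.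
have H := C2_map_chart_jacobian_continuous (diff2_C2 (F w0)) kx lx.
have n1 := near_snd w0 ((proj1 (cvg_at_dist _ _ _) H) _ e2).
have e4 : 0 < e / 4 by rewrite divr_gt0.
apply: filterS2 n1 (near_C2 kx lx e4) => -[w x] /= h1 [_ _ _ _ h2].
rewrite -(subrK (chart_jacobian k l (F w0) x) (chart_jacobian k l (F w0) x0)) -addrA.
apply: (le_lt_trans (ler_normD _ _)); rewrite [X in _ + X]distrC.
rewrite (splitr e); apply: ltr_leD; first exact: h1.
have e42 : e / 4 <= e / 2 by lra.
apply: le_trans e42; apply: mx_norm_le => [|a b]; first exact: ltW.
apply: le_trans (ltW (h2 a)); rewrite mxE [X in _ + X]mxE.
by apply: entry_dist; rewrite chart_jacobianE; exact: jacobianE.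
Qed.

End SkewContinuity.

Section MatrixEquation.
Context {R : realType} {d : nat}.

(** From P = Z + (1 - Y) P with 1 - Y small, the term in P is first absorbed, which bounds P, and
    then seen to tend to 0. This avoids inverting Y near t0. *)
Lemma cvg_mx_solve (T : topologicalType) (t0 : T) (Y P Z : T -> 'M[R]_d) :
  Y t @[t --> t0] --> (1%:M : 'M[R]_d) -> Z t @[t --> t0] --> Z t0 ->
  (\forall t \near t0, Y t *m P t = Z t) -> P t @[t --> t0] --> Z t0.
Proof.
move=> /cvg_at_dist Y1 /cvg_at_dist Z0 YP; apply/cvg_at_dist => e e0.
pose D : R := d%:R + 1.
have D0 : 0 < D by rewrite ltr_wpDl.
pose B := 2 * (`|Z t0| + 1).
have B0 : 0 < B by rewrite mulr_gt0 // ltr_wpDl.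
(* The first term of the minimum absorbs half of the norm of P, which gives the bound B; the second
   makes the error at most e / 2. D exceeds the constant d of the matrix product and is positive
   even for d = 0. *)
pose s := Num.min (1 / (2 * D)) (e / (2 * D * B)).
have s0 : 0 < s by rewrite lt_min !divr_gt0 ?mulr_gt0.
have e2 : 0 < e / 2 by rewrite divr_gt0.
near=> t.
have YPt : Y t *m P t = Z t by near: t; exact: YP.
have Ys : `|1%:M - Y t| < s by near: t; exact: Y1.
have Ze : `|Z t0 - Z t| < e / 2 by near: t; exact: Z0.
have Z1 : `|Z t0 - Z t| < 1 by near: t; exact: Z0.
have PE : P t = Z t + (1%:M - Y t) *m P t.
  by rewrite mulmxBl mul1mx YPt addrC subrK.
have dD : d%:R <= D by rewrite /D lerDl.
have err : `|(1%:M - Y t) *m P t| <= D * (s * `|P t|).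
  apply: (le_trans (mulmx_norm_le _ _)).
  apply: (@le_trans _ _ (D * (`|1%:M - Y t| * `|P t|))).
    by rewrite ler_wpM2r // mulr_ge0.
  by rewrite ler_wpM2l ?(ltW D0) // ler_wpM2r // ltW.
have Zt : `|Z t| <= `|Z t0| + 1.
  rewrite -[Z t](subrK (Z t0)) addrC (le_trans (ler_normD _ _)) // lerD2l.
  by rewrite distrC ltW.
have sD : D * s <= 1 / 2.
  have : s <= 1 / (2 * D) by rewrite ge_min lexx.
  rewrite -(ler_pM2l D0); have -> // : D * (1 / (2 * D)) = 1 / 2.
  by field; rewrite gt_eqF.
have PB : `|P t| <= B.
  have : `|P t| <= `|Z t| + D * s * `|P t|.
    by rewrite {1}PE (le_trans (ler_normD _ _)) // lerD2l -mulrA.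
  have : D * s * `|P t| <= 1 / 2 * `|P t| by rewrite ler_wpM2r.
  by rewrite /B; lra.
have -> : Z t0 - P t = (Z t0 - Z t) - (1%:M - Y t) *m P t.
  by rewrite {1}PE opprD addrA.
apply: (le_lt_trans (ler_normB _ _)); rewrite (splitr e) ltr_leD //.
apply: (le_trans err); rewrite mulrA.
apply: (@le_trans _ _ (D * s * B)).
  by rewrite ler_wpM2l // mulr_ge0 // ltW.
have : s <= e / (2 * D * B) by rewrite ge_min lexx orbT.
rewrite -(ler_pM2l (mulr_gt0 D0 B0)).
have -> : D * B * (e / (2 * D * B)) = e / 2 by field; rewrite !gt_eqF.
by rewrite mulrAC.
Unshelve. all: by end_near. Qed.

Lemma span_sub_mx m (X : seq 'rV[R]_d) (A : 'M[R]_(m, d)) (v : 'rV[R]_d) :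
  (forall x, x \in X -> (x <= A)%MS) -> v \in <<X>>%VS -> (v <= A)%MS.
Proof.
elim: X v => [|x X IH] v XA.
  by rewrite span_nil memv0 => /eqP ->; exact: sub0mx.
rewrite span_cons => /memv_addP[u /vlineP[c ->] [u' uX ->]].
apply: addmx_sub; first by apply/scalemx_sub/XA/mem_head.
by apply: IH => // y yX; apply: XA; rewrite in_cons yX orbT.
Qed.

End MatrixEquation.

(* The projection onto E along E', in the coordinates of the chart k. *)
HB.lock Definition chart_proj (R : realType) (d : nat) (M : topologicalType)
    (S : smooth_manifold R d M) (Omega : Type)
    (E E' : Omega -> M -> {vspace 'rV[R]_d}) (k : chart_index S) (w : Omega)
    (x : M) : 'M[R]_d :=
  transition k (chart_at S x) x *m lin1_mx (daddv_pi (E w x) (E' w x)) *m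
  transition (chart_at S x) k x.
Canonical chart_proj_unlockable := Unlockable chart_proj.unlock.

Section Projections.
Context {R : realType} {d : nat} {M : topologicalType}.
Variable S : smooth_manifold R d M.
Context {Omega : metricType R}.
Implicit Types (i j k l : chart_index S) (x : M) (w : Omega).
Implicit Types E : Omega -> M -> {vspace 'rV[R]_d}.

Variables E E' : Omega -> M -> {vspace 'rV[R]_d}.
Hypothesis EE'1 : forall w x, (E w x + E' w x)%VS = fullv.
Hypothesis EE'0 : forall w x, (E w x :&: E' w x)%VS = 0%VS.

Lemma chart_proj_mem k w x (u : 'rV[R]_d) : dom k x -> exists2 v : 'rV[R]_d,
  v \in E w x & u *m chart_proj E E' k w x = v *m transition (chart_at S x) k x.
Proof.
move=> kx; exists (u *m transition k (chart_at S x) x *m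
    lin1_mx (daddv_pi (E w x) (E' w x))); last by rewrite unlock !mulmxA.
by rewrite mul_rV_lin1; exact: memv_pi.
Qed.

Lemma chart_proj_coord k w x (v : 'rV[R]_d) : dom k x ->
  v *m transition (chart_at S x) k x *m chart_proj E E' k w x =
  daddv_pi (E w x) (E' w x) v *m transition (chart_at S x) k x.
Proof.
move=> kx; rewrite unlock.
rewrite mulmx_regroup transitionK //; last exact: dom_chart_at.
by rewrite mulmx1 mul_rV_lin1.
Qed.

Lemma chart_proj_id k w x (v : 'rV[R]_d) : dom k x -> v \in E w x ->
  v *m transition (chart_at S x) k x *m chart_proj E E' k w x =
  v *m transition (chart_at S x) k x.
Proof.
move=> kx vE; rewrite chart_proj_coord //.
by rewrite daddv_pi_id.
Qed.

Lemma chart_proj_kill k w x (v : 'rV[R]_d) : dom k x -> v \in E' w x ->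
  v *m transition (chart_at S x) k x *m chart_proj E E' k w x = 0.
Proof.
move=> kx vE; rewrite chart_proj_coord //.
have -> : daddv_pi (E w x) (E' w x) v = 0; last by rewrite mul0mx.
have := @daddv_pi_add _ _ (E w x) (E' w x) v (EE'0 w x).
rewrite EE'1 memvf => /(_ isT).
rewrite [X in _ + X]daddv_pi_id //; last by rewrite capvC EE'0.
by move/(canRL (addrK _)); rewrite subrr.
Qed.

Lemma frame_chart_cvg k w0 x0 (e : forall p : Omega * M, tangent (R := R) (d := d) p.2) :
  dom k x0 ->
  {for (w0, x0), continuous (fun q : Omega * M => to_coord (chart_at S x0) (e q))} ->
  ((e q : 'rV[R]_d) *m transition (chart_at S q.2) k q.2) @[q --> (w0, x0)] -->
  ((e (w0, x0) : 'rV[R]_d) *m transition (chart_at S x0) k x0).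
Proof.
move=> kx ec; set c := chart_at S x0; have cx : dom c x0 by exact: dom_chart_at.
have tc : transition c k q.2 @[q --> (w0, x0)] --> transition c k x0.
  apply: (cvg_comp _ _ (@cvg_snd _ _ (nbhs w0) (nbhs x0) _)).
  exact: transition_continuous.
have H := cvg_mulmx ec tc.
apply: (cvg_near_ext _ _ H).
  by rewrite to_coordE transition_id // mulmx1.
have n1 := near_snd w0 (dom_nbhs cx); have n2 := near_snd w0 (dom_nbhs kx).
apply: filterS2 n1 n2 => -[w x] /= cx' kx'.
by rewrite to_coordE -mulmxA transition_comp //; exact: dom_chart_at.
Qed.

Hypothesis E_cont : continuous_subbundle S E.
Hypothesis E'_cont : continuous_subbundle S E'.

Lemma chart_proj_continuous k w0 x0 : dom k x0 ->
  chart_proj E E' k p.1 p.2 @[p --> (w0, x0)] --> chart_proj E E' k w0 x0.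
Proof.
move=> kx; have [a [e He]] := E_cont (w0, x0); have [b [f Hf]] := E'_cont (w0, x0).
have [e_basis e_cont] := nbhs_singleton He.
have [f_basis f_cont] := nbhs_singleton Hf.
pose Qe (q : Omega * M) := \matrix_(i < a)
   ((e i q : 'rV[R]_d) *m transition (chart_at S q.2) k q.2).
pose Qf (q : Omega * M) := \matrix_(i < b)
   ((f i q : 'rV[R]_d) *m transition (chart_at S q.2) k q.2).
have Qec : Qe q @[q --> (w0, x0)] --> Qe (w0, x0).
  apply: cvg_mx => i j.
  have H := frame_chart_cvg kx (e_cont i).
  apply: (cvg_near_ext _ _ (cvg_entry (i := 0) (j := j) H)).
    by rewrite [RHS]mxE.
  by apply: near_all => q; rewrite [RHS]mxE.
have Qfc : Qf q @[q --> (w0, x0)] --> Qf (w0, x0).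
  apply: cvg_mx => i j.
  have H := frame_chart_cvg kx (f_cont i).
  apply: (cvg_near_ext _ _ (cvg_entry (i := 0) (j := j) H)).
    by rewrite [RHS]mxE.
  by apply: near_all => q; rewrite [RHS]mxE.
(* The frames of E and E' together span at the base point, so some combination of their rows is the
   identity there. With X1 and X2 frozen, the same combination stays close to the identity
   nearby. *)
have [X1 [X2 X12]] : exists X1 X2, X1 *m Qe (w0, x0) + X2 *m Qf (w0, x0) = 1%:M.
  have : row_full (col_mx (Qe (w0, x0)) (Qf (w0, x0))).
    rewrite -sub1mx; apply/row_subP => i; rewrite row1.
    have tx := transitionK kx (dom_chart_at S x0).
    have tx' := transitionK (dom_chart_at S x0) kx.
    rewrite -[delta_mx _ _]mulmx1 -tx mulmxA.
    have : delta_mx 0 i *m transition k (chart_at S x0) x0 \in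
      (E w0 x0 + E' w0 x0)%VS by rewrite EE'1 memvf.
    move=> /memv_addP[u uE [u' uE' ->]]; rewrite mulmxDl addmx_sub //.
      have : (u <= Qe (w0, x0) *m transition k (chart_at S x0) x0)%MS.
        move: uE; rewrite -(span_basis e_basis); apply: span_sub_mx.
        move=> _ /mapP[j _ ->].
        have -> : (e j (w0, x0) : 'rV[R]_d) =
            row j (Qe (w0, x0) *m transition k (chart_at S x0) x0).
          by rewrite row_mul rowK -mulmxA tx' mulmx1.
        exact: row_sub.
      move=> /(submxMr (transition (chart_at S x0) k x0)).
      rewrite -mulmxA tx mulmx1 => /submx_trans; apply.
      by rewrite -addsmxE; exact: addsmxSl.
    have : (u' <= Qf (w0, x0) *m transition k (chart_at S x0) x0)%MS.
      move: uE'; rewrite -(span_basis f_basis); apply: span_sub_mx.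
      move=> _ /mapP[j _ ->].
      have -> : (f j (w0, x0) : 'rV[R]_d) = row j (Qf (w0, x0) *m transition k (chart_at S x0) x0).
        by rewrite row_mul rowK -mulmxA tx' mulmx1.
      exact: row_sub.
    move=> /(submxMr (transition (chart_at S x0) k x0)).
    rewrite -mulmxA tx mulmx1 => /submx_trans; apply.
    by rewrite -addsmxE; exact: addsmxSr.
  case/row_fullP => X XE; exists (lsubmx X), (rsubmx X).
  by rewrite -mul_row_col hsubmxK.
(* The projection P fixes the rows of Qe and kills those of Qf, hence it is the
   solution of Y P = Z, where Y is invertible near (w0, x0). *)
pose Y q := X1 *m Qe q + X2 *m Qf q.
pose Z q := X1 *m Qe q.
have Zc : Z q @[q --> (w0, x0)] --> Z (w0, x0) by exact: cvg_mulmx (cvg_cst _) Qec.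
have Yc : Y q @[q --> (w0, x0)] --> (1%:M : 'M[R]_d).
  by rewrite -X12; apply: cvgD; [exact: Zc|exact: cvg_mulmx (cvg_cst _) Qfc].
have YP : \forall q \near (w0, x0), Y q *m chart_proj E E' k q.1 q.2 = Z q.
  have kn := near_snd w0 (dom_nbhs kx).
  apply: filterS3 He Hf kn => -[w x] /= [eb _] [fb _] kx'.
  rewrite mulmxDl -!mulmxA.
  have -> : Qe (w, x) *m chart_proj E E' k w x = Qe (w, x).
    apply/row_matrixP => i; rewrite row_mul rowK /= chart_proj_id //.
    by apply: (basis_mem eb); apply: map_f; rewrite mem_enum.
  have -> : Qf (w, x) *m chart_proj E E' k w x = 0.
    apply/row_matrixP => i; rewrite row_mul rowK /= chart_proj_kill ?row0 //.
    by apply: (basis_mem fb); apply: map_f; rewrite mem_enum.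
  by rewrite mulmx0 addr0.
have := cvg_mx_solve (P := fun q => chart_proj E E' k q.1 q.2) Yc Zc YP.
apply: cvg_near_ext; last exact: near_all.
by have := nbhs_singleton YP; rewrite /= /Y X12 mul1mx => ->.
Qed.

End Projections.

Section TangentMapChart.
Context {R : realType} {d : nat} {M : topologicalType}.
Variable S : smooth_manifold R d M.
Context {Omega : metricType R}.
Variable F : Omega -> diff2 S.

Lemma tangent_map_chart (k l : chart_index S) (w : Omega) (x : M) (v : 'rV[R]_d) :
  dom k x -> dom l (F w x) ->
  v *m transition (chart_at S x) k x *m chart_jacobian k l (F w) x =
  (tangent_map S (F w) (v : tangent x) : 'rV[R]_d) *m transition (chart_at S (F w x)) l (F w x).
Proof.
move=> kx lx; have cx := dom_chart_at S x; have cFx := dom_chart_at S (F w x).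
rewrite (chart_jacobian_change (diff2_C2 (F w)) kx cx lx cFx) tangent_mapE.
rewrite mulmx_regroup.
rewrite (transitionK cx kx).
by rewrite mulmx1.
Qed.

End TangentMapChart.

Section ProjectionAlgebra.
Context {R : realType} {d : nat} {M : topologicalType}.
Variable S : smooth_manifold R d M.
Context {Omega : metricType R}.
Implicit Types (i j k l : chart_index S) (x : M) (w : Omega).
Variables E E' : Omega -> M -> {vspace 'rV[R]_d}.
Hypothesis EE'1 : forall w x, (E w x + E' w x)%VS = fullv.
Hypothesis EE'0 : forall w x, (E w x :&: E' w x)%VS = 0%VS.

Let E'E1 w x : (E' w x + E w x)%VS = fullv. Proof. by rewrite addvC EE'1. Qed.
Let E'E0 w x : (E' w x :&: E w x)%VS = 0%VS. Proof. by rewrite capvC EE'0. Qed.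

Lemma coordP k x (u : 'rV[R]_d) : dom k x ->
  exists v : 'rV[R]_d, u = v *m transition (chart_at S x) k x.
Proof.
move=> kx; exists (u *m transition k (chart_at S x) x).
by rewrite -mulmxA transitionK ?mulmx1 //; exact: dom_chart_at.
Qed.

Lemma chart_proj_sum k w x : dom k x ->
  chart_proj E E' k w x + chart_proj E' E k w x = 1%:M.
Proof.
move=> kx; apply: rowP_mx => u; have [v ->] := coordP u kx.
rewrite mulmxDr !chart_proj_coord // -mulmxDl daddv_pi_add ?mulmx1 //.
by rewrite EE'1 memvf.
Qed.

Lemma chart_proj_idem k w x : dom k x ->
  chart_proj E E' k w x *m chart_proj E E' k w x = chart_proj E E' k w x.
Proof.
move=> kx; apply: rowP_mx => u; rewrite mulmxA.
have [v vE ->] := @chart_proj_mem _ _ _ S _ E E' k w x u kx.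
by rewrite chart_proj_id.
Qed.

Lemma chart_proj_mul0 k w x : dom k x ->
  chart_proj E E' k w x *m chart_proj E' E k w x = 0.
Proof.
move=> kx; apply: rowP_mx => u; rewrite mulmxA mulmx0.
have [v vE ->] := @chart_proj_mem _ _ _ S _ E E' k w x u kx.
by rewrite chart_proj_kill.
Qed.

Variables (theta : Omega -> Omega) (F : Omega -> diff2 S).

Hypothesis E_inv : forall w x,
  tangent_map S (F w) (x := x) @` [set` E w x] = [set` E (theta w) (F w x)].
Hypothesis E'_inv : forall w x,
  tangent_map S (F w) (x := x) @` [set` E' w x] = [set` E' (theta w) (F w x)].

(** The image of the E-part is fixed by the projection at the image point and that of the E'-part is
    killed, so the derivative intertwines the projections. *)
Lemma chart_proj_jacobian k l w x : dom k x -> dom l (F w x) ->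
  chart_proj E E' k w x *m chart_jacobian k l (F w) x =
  chart_jacobian k l (F w) x *m chart_proj E E' l (theta w) (F w x).
Proof.
move=> kx lx; apply: rowP_mx => u; set J := chart_jacobian _ _ _ _.
set P' := chart_proj E E' l (theta w) (F w x).
have h1 : u *m chart_proj E E' k w x *m J *m P' = u *m chart_proj E E' k w x *m J.
  have [v vE ->] := @chart_proj_mem _ _ _ S _ E E' k w x u kx.
  rewrite tangent_map_chart // chart_proj_id //.
  suff : [set` E (theta w) (F w x)] (tangent_map S (F w) (v : tangent x)) by [].
  by rewrite -E_inv; exists v.
have h2 : u *m chart_proj E' E k w x *m J *m P' = 0.
  have [v vE ->] := @chart_proj_mem _ _ _ S _ E' E k w x u kx.
  rewrite tangent_map_chart // chart_proj_kill //.
  suff : [set` E' (theta w) (F w x)] (tangent_map S (F w) (v : tangent x)) by [].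
  by rewrite -E'_inv; exists v.
rewrite !mulmxA -[in RHS](mulmx1 u) -(chart_proj_sum w kx) mulmxDr !mulmxDl.
by rewrite h1 h2 addr0.
Qed.

(** [E_inv] and [E'_inv] are equalities of sets: the tangent map is onto each bundle, hence onto
    their sum, and a surjective square matrix is invertible. *)
Lemma chart_jacobian_unit k l w x : dom k x -> dom l (F w x) ->
  chart_jacobian k l (F w) x \in unitmx.
Proof.
move=> kx lx.
have surj (u : 'rV[R]_d) : exists v, v *m chart_jacobian k l (F w) x = u.
  have [a ->] := coordP u lx.
  have : a \in (E (theta w) (F w x) + E' (theta w) (F w x))%VS by rewrite EE'1 memvf.
  move=> /memv_addP[a1 a1E [a2 a2E ->]].
  have : [set` E (theta w) (F w x)] a1 by [].
  rewrite -E_inv => -[v1 _ v1E].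
  have : [set` E' (theta w) (F w x)] a2 by [].
  rewrite -E'_inv => -[v2 _ v2E].
  exists (v1 *m transition (chart_at S x) k x + v2 *m transition (chart_at S x) k x).
  by rewrite mulmxDl !tangent_map_chart // v1E v2E mulmxDl.
have /choice[B BE] := surj.
suff : (\matrix_i B (delta_mx 0 i)) *m chart_jacobian k l (F w) x = 1%:M.
  by move/mulmx1_unit => [].
by apply/row_matrixP => i; rewrite row_mul rowK BE row1.
Qed.

End ProjectionAlgebra.

Section NormGrowth.
Context {R : realType} {d : nat} {M : topologicalType}.
Variables (S : smooth_manifold R d M) (g : riemannian_metric S).
Context {Omega : metricType R}.
Variables (E E' : Omega -> M -> {vspace 'rV[R]_d}) (F : Omega -> diff2 S).

Lemma chart_expansion (a : R) k l (w : Omega) (x : M) :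
  (forall v : tangent x, v \in E w x ->
     a * tnorm g v <= tnorm g (tangent_map S (F w) v)) ->
  dom k x -> dom l (F w x) -> forall u : 'rV[R]_d,
  let u' := u *m chart_proj E E' k w x in
  a * qnorm (chart_gram g k x) u' <=
  qnorm (chart_gram g l (F w x)) (u' *m chart_jacobian k l (F w) x).
Proof.
move=> aE kx lx u; have [v vE ->] := @chart_proj_mem _ _ _ S _ E E' k w x u kx.
rewrite /= tangent_map_chart //.
by have := aE v vE; rewrite (tnormE g _ kx) (tnormE g _ lx).
Qed.

Lemma chart_contraction (a : R) k l (w : Omega) (x : M) :
  (forall v : tangent x, v \in E w x ->
     tnorm g (tangent_map S (F w) v) <= a * tnorm g v) ->
  dom k x -> dom l (F w x) -> forall u : 'rV[R]_d,
  let u' := u *m chart_proj E E' k w x in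
  qnorm (chart_gram g l (F w x)) (u' *m chart_jacobian k l (F w) x) <=
  a * qnorm (chart_gram g k x) u'.
Proof.
move=> aE kx lx u; have [v vE ->] := @chart_proj_mem _ _ _ S _ E E' k w x u kx.
rewrite /= tangent_map_chart //.
by have := aE v vE; rewrite (tnormE g _ kx) (tnormE g _ lx).
Qed.

End NormGrowth.

(** * Uniform estimates over a finite atlas *)

Section Atlas.
Context {R : realType} {d : nat} {M : topologicalType}.
Variables (S : smooth_manifold R d M) (M_compact : compact [set: M]).

(** The near-covering form of compactness, applied to the filter generated by the lists containing a
    given finite list, extracts a finite subcover. *)
Lemma seq_cover (r : M -> set M) : (forall x, nbhs x (r x)) ->
  exists s : seq M, forall x, exists2 p, p \in s & r p x.
Proof.
move=> rx; pose G : set_system (seq M) :=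
  filter_from [set: seq M] (fun s0 => [set s : seq M | {subset s0 <= s}]).
have FG : Filter G.
  apply: filter_from_filter; first by exists [::].
  move=> s t _ _; exists (s ++ t) => // u /= stu; split=> y ys; apply: stu.
    by rewrite mem_cat ys.
  by rewrite mem_cat ys orbT.
have := (compact_near_coveringP [set: M]).1 M_compact _ G
  (fun s x => exists2 p, p \in s & r p x) FG.
case=> [x _|s _ Hs]; last by exists s => x; apply: Hs => // y.
exists (r x, [set s : seq M | {subset [:: x] <= s}]).
  by split; [exact: rx|exists [:: x]].
by move=> [y s] [/= rxy xs]; exists x => //; apply: xs; rewrite mem_head.
Qed.

(** Three radii fit into the chart image: r for the covered points, 2 r for nearby images of such
    points, and a further r for displacing either by a vector of norm at most r. *)
Lemma finite_atlas : exists (s : seq M) (r : M -> R),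
  [/\ forall p, 0 < r p,
      forall p a, `|a - chart (chart_at S p) p| <= 3 * r p ->
        (chart (chart_at S p) @` dom (chart_at S p)) a &
      forall x, exists2 p, p \in s &
        dom (chart_at S p) x /\
        `|chart (chart_at S p) x - chart (chart_at S p) p| <= r p].
Proof.
have /choice[r Hr] : forall p, exists r : R, 0 < r /\ forall a,
    `|a - chart (chart_at S p) p| <= 3 * r ->
    (chart (chart_at S p) @` dom (chart_at S p)) a.
  move=> p; have := chart_img_nbhs (dom_chart_at S p).
  move=> /nbhs_ballP[e /= e0 He]; exists (e / 4); split; first by rewrite divr_gt0.
  move=> a ae; apply: He; rewrite -ball_normE /= distrC (le_lt_trans ae) //.
  by lra.
have [|s Hs] := @seq_cover (fun p => [set x | dom (chart_at S p) x /\
    `|chart (chart_at S p) x - chart (chart_at S p) p| <= r p]).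
  move=> p; apply: filterI; first exact/dom_nbhs/dom_chart_at.
  have /cvg_at_dist := chart_continuous (dom_chart_at S p).
  move=> /(_ _ (Hr p).1); apply: filterS => x /ltW.
  by rewrite distrC.
by exists s, r; split=> // p; have [] := Hr p.
Qed.

End Atlas.

Lemma filter_all_seq (T : Type) (F : set_system T) {FF : Filter F} (I : eqType)
    (s : seq I) (P : I -> T -> Prop) :
  (forall i, i \in s -> \forall t \near F, P i t) ->
  \forall t \near F, forall i, i \in s -> P i t.
Proof.
elim: s => [|i s IH] H; first exact: nearW.
have h1 := H i (mem_head _ _).
have h2 : \forall t \near F, forall j, j \in s -> P j t.
  by apply: IH => j js; apply: H; rewrite in_cons js orbT.
apply: filterS2 h1 h2 => t Pi Ps j; rewrite in_cons => /predU1P[->//|].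
exact: Ps.
Qed.

(** A bound that holds near each point for all large C holds on Q for all large C. The conclusion
    [\near +oo_R] lets finitely many bounds share one C. *)
Lemma compact_bound (R : realType) (T : topologicalType) (V : normedModType R)
    (Q : set T) (f : T -> V) : compact Q ->
  (forall q, Q q -> f t @[t --> q] --> f q) ->
  \forall C \near +oo_R, forall q, Q q -> `|f q| <= C.
Proof.
move=> cQ fc; apply: ((compact_near_coveringP Q).1 cQ _ +oo_R (fun C q => `|f q| <= C)).
move=> q Qq; have /cvg_at_dist/(_ _ ltr01) n1 := fc q Qq.
exists ([set t | `|f q - f t| < 1], [set C | `|f q| + 1 <= C]).
  by split=> //; exact: nbhs_pinfty_ge.
move=> [t C] [/= ft fC]; apply: le_trans fC.
rewrite -[f t](subrK (f q)) addrC (le_trans (ler_normD _ _)) // lerD2l.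
by rewrite distrC ltW.
Qed.

Section Shift.
Context {R : realType} {d : nat} {M : topologicalType}.
Variables (S : smooth_manifold R d M) (M_compact : compact [set: M]).

Implicit Types k : chart_index S.

(** A chart substitute for the exponential map at x. *)
Definition shift_in k (x : M) (v : 'rV[R]_d) : M := ichart k (chart k x + v).

Lemma shift_in_cvg k x0 : dom k x0 ->
  shift_in k q.1 q.2 @[q --> (x0, 0 : 'rV[R]_d)] --> x0.
Proof.
move=> kx; have H : chart k q.1 + q.2 @[q --> (x0, 0 : 'rV[R]_d)] --> chart k x0.
  rewrite -[X in _ --> X]addr0; apply: cvgD.
    exact: (cvg_comp _ _ (@cvg_fst _ _ (nbhs x0) (nbhs (0 : 'rV[R]_d)) _)
      (chart_continuous kx)).
  exact: cvg_snd.
exact: (cvg_comp _ _ H (ichart_cvg kx)).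
Qed.

(** Uniform continuity without a metric on M: P is known near each diagonal point of Q, and
    near-covering over the filter at [0^'+] yields one radius for all of Q. The base point in Omega
    is not moved. *)
Lemma uniform_shift (Omega : topologicalType) k (Q : set (Omega * M))
    (P : Omega * M -> Omega * M -> Prop) :
  compact Q -> (forall q, Q q -> dom k q.2) ->
  (forall q, Q q -> \forall z \near (q, q), P z.1 z.2) ->
  \forall rho \near (0 : R)^'+, forall q, Q q -> forall v : 'rV[R]_d,
    `|v| <= rho -> P q (q.1, shift_in k q.2 v).
Proof.
move=> cQ Qk HP.
apply: ((compact_near_coveringP Q).1 cQ _ ((0 : R)^'+) (fun rho q =>
  forall v : 'rV[R]_d, `|v| <= rho -> P q (q.1, shift_in k q.2 v))).
move=> [w0 x0] Qq; have kx := Qk _ Qq; have /= HPq := HP _ Qq.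
have [[A B] /= [nA nB] ABP] := HPq.
have [[B1 B2] /= [nB1 nB2] B12] := nB.
have := shift_in_cvg kx nB2 => -[[D1 D2] /= [nD1 nD2] D12].
have [e /= e0 He] := (proj1 (nbhs_ballP (0 : 'rV[R]_d) _)) nD2.
exists (A `&` [set q | B1 q.1 /\ D1 q.2], [set rho : R | rho < e]).
  split; last exact: nbhs_right_lt.
  apply: filterI => //=; apply: filterI; first exact: near_fst nB1.
  exact: near_snd nD1.
move=> [[w x] rho] [/= [Awx [B1w D1x]] re] v vr.
apply: (ABP ((w, x), (w, shift_in k x v))); split=> //=.
apply: B12; split=> //=; apply: (D12 (x, v)); split=> //=.
by apply: He; rewrite -ball_normE /= sub0r normrN (le_lt_trans vr).
Qed.

End Shift.

(** * Derivatives along curves and a mean value estimate *)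

Section CurveDerivative.
Context {R : realType}.

Lemma derive1_comp_diff (V W : normedModType R) (c : R -> V) (f : V -> W) (t : R) :
  derivable c t 1 -> differentiable f (c t) ->
  derivable (f \o c) t 1 /\ derive1 (f \o c) t = 'd f (c t) (derive1 c t).
Proof.
move=> /derivable1_diffP dc df; have dfc := differentiable_comp dc df.
split; first exact/derivable1_diffP.
rewrite (derive1E' dfc) (derive1E' dc).
exact: (congr1 (@^~ 1) (diff_comp dc df)).
Qed.

Lemma affine_derive (V : normedModType R) (a u : V) (t : R) :
  derivable (fun s : R => a + s *: u) t 1 /\ derive1 (fun s : R => a + s *: u) t = u.
Proof.
have d1 : differentiable (fun s : R => s *: u) t.
  by apply: differentiableZl; exact: ex_diff.
have d2 : differentiable (cst a : R -> V) t by exact: differentiable_cst.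
have d3 : differentiable (cst a + (fun s : R => s *: u)) t by exact: differentiableD.
split; first exact/derivable1_diffP.
have -> : (fun s : R => a + s *: u) = cst a + (fun s : R => s *: u) by [].
rewrite (derive1E' d3); apply: etrans (congr1 (@^~ 1) (diffD d2 d1)) _.
rewrite /=.
have -> : 'd (cst a : R -> V) t 1 = 0 by exact: (congr1 (@^~ 1) (diff_cst a t)).
have did : differentiable (@id R) t by exact: ex_diff.
rewrite add0r; apply: etrans (congr1 (@^~ 1) (diffZl u did)) _.
have -> : 'd (@id R) t 1 = 1; last by rewrite scale1r.
by have -> : 'd (@id R) t = @id R :> (R -> R) by exact: diff_val.
Qed.

Lemma derivable_entry m n (c : R -> 'M[R]_(m, n)) t i j : derivable c t 1 ->
  is_derive t 1 (fun s => c s i j) (derive1 c t i j).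
Proof.
move=> dc; have dij := (derivable_mxP c t 1).1 dc i j.
by rewrite derive1E (derive_mx dc) mxE; exact: derivableP.
Qed.

Context {d : nat}.

(** Each entry of f minus its linear model J0 is a real function on the segment from v' to v. The
    intermediate point depends on the entry, the bound k does not; the factor d comes from the norm
    of a row times a matrix. *)
Lemma mean_value_jacobian (f : 'rV[R]_d -> 'rV[R]_d) (a v v' : 'rV[R]_d)
    (J0 : 'M[R]_d) (rho k : R) :
  (forall u, `|u| <= rho -> differentiable f (a + u)) ->
  (forall u, `|u| <= rho -> `|'J f (a + u) - J0| <= k) ->
  `|v| <= rho -> `|v'| <= rho ->
  `|f (a + v) - f (a + v') - (v - v') *m J0| <= d%:R * k * `|v - v'|.
Proof.
move=> df dJ vr v'r; set u := v - v'.
have k0 : 0 <= k by apply: le_trans (dJ _ vr).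
have seg t : 0 <= t <= 1 -> `|v' + t *: u| <= rho.
  move=> /andP[t0 t1].
  have -> : v' + t *: u = (1 - t) *: v' + t *: v.
    by apply/rowP => i; rewrite !mxE; ring.
  apply: (le_trans (ler_normD _ _)); rewrite !normrZ (ger0_norm t0) ger0_norm ?subr_ge0 //.
  have -> : rho = (1 - t) * rho + t * rho by ring.
  by rewrite lerD // ler_wpM2l // subr_ge0.
pose aff s := a + v' + s *: u.
have affE s : aff s = a + (v' + s *: u) by rewrite /aff addrA.
apply: mx_norm_le => [|i j]; first by rewrite !mulr_ge0.
have [daff affu] : (forall t, derivable aff t 1) /\ (forall t, derive1 aff t = u).
  by split=> t; have [] := affine_derive (a + v') u t.
have dfa (t : R) : 0 <= t <= 1 -> derivable (f \o aff) t 1 /\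
    derive1 (f \o aff) t = u *m 'J f (aff t).
  move=> t01; have [|h1 h2] := derive1_comp_diff (daff t) (f := f).
    by rewrite affE; exact/df/seg.
  split; first exact: h1.
  by rewrite h2 affu; exact: esym (mul_jacobian _ _ _).
have [dlin linu] : (forall t, derivable (fun s : R => (0 : 'rV[R]_d) + s *: (u *m J0)) t 1) /\
    (forall t, derive1 (fun s : R => (0 : 'rV[R]_d) + s *: (u *m J0)) t = u *m J0).
  by split=> t; have [] := affine_derive (0 : 'rV[R]_d) (u *m J0) t.
pose h s := f (aff s) i j - (0 + s *: (u *m J0)) i j.
have dh (t : R) : 0 <= t <= 1 -> is_derive t 1 h ((u *m ('J f (aff t) - J0)) i j).
  move=> t01; have [h1 h2] := dfa t t01.
  have e1 := derivable_entry i j h1.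
  have e2 := derivable_entry i j (dlin t).
  have := is_deriveB e1 e2.
  by rewrite h2 linu mulmxBr => H; apply: is_derive_eq; rewrite !mxE.
have [|||t /[!in_itv] /= t01] := @MVT_segment R h
    (fun t => (u *m ('J f (aff t) - J0)) i j) 0 1.
- exact: ler01.
- by move=> t /[!in_itv] /= /andP[t0 t1]; apply: dh; rewrite !ltW.
- apply: derivable_within_continuous => t /[!in_itv] /= t01.
  by have [] := dh t t01.
have -> : h 1 - h 0 = (f (a + v) - f (a + v') - (v - v') *m J0) i j.
  rewrite /h !affE scale1r scale0r addr0 !add0r /u.
  rewrite -[v' + (v - v')]addrCA subrr addr0 scale1r scale0r !mxE.
  by ring.
rewrite subr0 mulr1 => ->.
apply: (le_trans (le_mx_entry _ _ _)); apply: (le_trans (mulmx_norm_le _ _)).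
rewrite -mulrA ler_wpM2l // mulrC ler_wpM2r //.
by rewrite affE; apply/dJ/seg.
Qed.

End CurveDerivative.

Section UniformConstants.
Context {R : realType} {d : nat} {M : topologicalType}.
Variables (S : smooth_manifold R d M) (M_compact : compact [set: M]).
Variable r : M -> R.
Hypothesis r_gt0 : forall p, 0 < r p.
Hypothesis r_img : forall p a,
  `|a - chart (chart_at S p) p| <= 3 * r p ->
  (chart (chart_at S p) @` dom (chart_at S p)) a.

Local Notation ch p := (chart_at S p).

(* A chart ball around p; [r_img] keeps it inside the image of the chart as
   long as t <= 3. *)
Definition core (p : M) (t : R) : set M :=
  [set x | dom (ch p) x /\ `|chart (ch p) x - chart (ch p) p| <= t * r p].

Lemma core_le p t t' : t <= t' -> core p t `<=` core p t'.
Proof.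
by move=> tt' x [px xt]; split=> //; rewrite (le_trans xt) // ler_wpM2r // ltW.
Qed.

Lemma core_compact p t : 0 < t <= 3 -> compact (core p t).
Proof.
move=> /andP[t0 t3]; have tr : 0 < t * r p by rewrite mulr_gt0.
have img a : `|a - chart (ch p) p| <= t * r p -> (chart (ch p) @` dom (ch p)) a.
  by move=> ar; apply: r_img; rewrite (le_trans ar) // ler_wpM2r // ltW.
have -> : core p t = ichart (ch p) @` closed_ball (chart (ch p) p) (t * r p).
  rewrite closed_ballE //; apply/seteqP; split=> [x [px xt]|_ [a /= at_ <-]].
    exists (chart (ch p) x); last by rewrite chartK.
    by rewrite /closed_ball_ /= distrC.
  have ai := img a; rewrite /closed_ball_ /= distrC in at_; split; first exact/ichart_dom/ai.
  by rewrite ichartK; [|exact: ai].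
apply: continuous_compact; last first.
  apply: bounded_closed_compact; last exact: closed_ball_closed.
  rewrite /bounded_set /bounded_near; near=> B => x.
  rewrite closed_ballE // /closed_ball_ /= => xt.
  apply: (@le_trans _ _ (`|chart (ch p) p| + t * r p)).
    rewrite -[x](subrK (chart (ch p) p)) addrC (le_trans (ler_normD _ _)) //.
    by rewrite lerD2l distrC.
  by near: B; apply: nbhs_pinfty_ge; exact: num_real.
apply: continuous_in_subspaceT => a /set_mem.
rewrite closed_ballE // /closed_ball_ /= => at_; apply: ichart_continuous.
by apply: img; rewrite distrC.
Unshelve. all: by end_near. Qed.

Lemma core_closed p t : 0 < t <= 3 -> closed (core p t).
Proof.
move=> t03; apply: compact_closed; first exact: (manifold_hausdorff S).
exact: core_compact.
Qed.

Lemma core_shift p t x v : t <= 2 -> core p t x -> `|v| <= r p ->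
  [/\ dom (ch p) (shift_in (ch p) x v),
      chart (ch p) (shift_in (ch p) x v) = chart (ch p) x + v &
      core p (t + 1) (shift_in (ch p) x v)].
Proof.
move=> t2 [px xt] vr.
have B : `|chart (ch p) x + v - chart (ch p) p| <= (t + 1) * r p.
  rewrite addrAC (le_trans (ler_normD _ _)) // mulrDl mul1r lerD //.
have I : (chart (ch p) @` dom (ch p)) (chart (ch p) x + v).
  apply: r_img; apply: (le_trans B); apply: ler_wpM2r; [exact: ltW|lra].
have h1 : dom (ch p) (shift_in (ch p) x v) by exact: ichart_dom.
have h2 : chart (ch p) (shift_in (ch p) x v) = chart (ch p) x + v by exact: ichartK.
by split=> //; split=> //; rewrite h2.
Qed.

Lemma shift_in_sub k x y : dom k y -> shift_in (S := S) k x (chart k y - chart k x) = y.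
Proof. by move=> ky; rewrite /shift_in addrC subrK chartK. Qed.

End UniformConstants.

Section UniformEstimates.
Context {R : realType} {d : nat} {M : topologicalType}.
Variables (S : smooth_manifold R d M) (g : riemannian_metric S).
Hypothesis M_compact : compact [set: M].
Variables (r : M -> R) (s : seq M).
Hypothesis r_gt0 : forall p, 0 < r p.
Hypothesis r_img : forall p a,
  `|a - chart (chart_at S p) p| <= 3 * r p ->
  (chart (chart_at S p) @` dom (chart_at S p)) a.
Context {Omega : metricType R}.
Hypothesis Omega_compact : compact [set: Omega].
Variables (theta : Omega -> Omega) (F : Omega -> diff2 S).
Hypothesis F_cont : continuous F.

Local Notation ch p := (chart_at S p).
Local Notation core := (core S r).

Let core_dom p t x : core p t x -> dom (ch p) x. Proof. by case. Qed.

Lemma step_compact p q :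
  compact [set z : Omega * M | core p 1 z.2 /\ core q 2 (F z.1 z.2)].
Proof.
apply: (@subclosed_compact _ _ [set: Omega * M]) => //; last first.
  by rewrite -setXTT; exact: compact_setX.
have -> : [set z : Omega * M | core p 1 z.2 /\ core q 2 (F z.1 z.2)] =
  snd @^-1` core p 1 `&` (fun z : Omega * M => F z.1 z.2) @^-1` core q 2 by [].
apply: closedI; apply: closed_comp.
- by move=> z _; exact: cvg_snd.
- by apply: core_closed => //; lra.
- by move=> z _; exact: skew_continuous.
- by apply: core_closed => //; lra.
Qed.

Lemma fiber_compact p t : 0 < t <= 3 -> compact ([set: Omega] `*` core p t).
Proof. by move=> t03; apply: compact_setX => //; exact: core_compact. Qed.

Lemma near_jacobian p q k : 0 < k ->
  \forall rho \near (0 : R)^'+, forall w x, core p 1 x -> core q 2 (F w x) ->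
  forall v : 'rV[R]_d, `|v| <= rho ->
    dom (ch q) (F w (shift_in (ch p) x v)) /\
    `|chart_jacobian (ch p) (ch q) (F w) (shift_in (ch p) x v) -
      chart_jacobian (ch p) (ch q) (F w) x| <= k.
Proof.
move=> k0; have k2 : 0 < k / 2 by rewrite divr_gt0.
have := @uniform_shift _ _ _ S Omega (ch p) _ (fun z z' =>
  dom (ch q) (F z'.1 z'.2) /\
  `|chart_jacobian (ch p) (ch q) (F z'.1) z'.2 -
      chart_jacobian (ch p) (ch q) (F z.1) z.2| <= k) (@step_compact p q).
case=> [z [/core_dom//]|[w0 x0] /= [px qx]|rho rho0 H].
  have n1 := (proj1 (cvg_at_dist _ _ _) (chart_jacobian_continuous M_compact F_cont
    (core_dom px) (core_dom qx))) _ k2.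
  have n2 : \forall z \near (w0, x0), dom (ch q) (F z.1 z.2).
    have sc : F z.1 z.2 @[z --> (w0, x0)] --> F w0 x0.
      exact: (@skew_continuous _ _ _ S M_compact _ F F_cont (w0, x0)).
    by apply: sc; exact: dom_nbhs (core_dom qx).
  have m1 := near_fst (w0, x0) n1; have m2 := near_snd (w0, x0) n1.
  have m3 := near_snd (w0, x0) n2.
  apply: filterS3 m1 m2 m3 => -[z z'] /= h1 h2 h3; split=> //.
  rewrite -(subrK (chart_jacobian (ch p) (ch q) (F w0) x0)
    (chart_jacobian (ch p) (ch q) (F z'.1) z'.2)) -addrA.
  rewrite (le_trans (ler_normD _ _)) // (splitr k) lerD //.
    by rewrite distrC ltW.
  exact: ltW.
exists rho => // t th t0 w x px qx v vt.
by have := H t th t0 (w, x) (conj px qx) v vt.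
Qed.

Lemma near_matrix p (f : Omega * M -> 'M[R]_d) k : 0 < k ->
  (forall w x, dom (ch p) x -> f z @[z --> (w, x)] --> f (w, x)) ->
  \forall rho \near (0 : R)^'+, forall w x, core p 1 x ->
  forall v : 'rV[R]_d, `|v| <= rho ->
    `|f (w, shift_in (ch p) x v) - f (w, x)| <= k.
Proof.
move=> k0 fc; have k2 : 0 < k / 2 by rewrite divr_gt0.
have c1 : 0 < (1 : R) <= 3 by lra.
have := @uniform_shift _ _ _ S Omega (ch p) _ (fun z z' => `|f z' - f z| <= k)
  (@fiber_compact p 1 c1).
case=> [z [_ /core_dom//]|[w0 x0] /= [_ px]|rho rho0 H].
  have n1 := (proj1 (cvg_at_dist _ _ _) (fc w0 x0 (core_dom px))) _ k2.
  have m1 := near_fst (w0, x0) n1; have m2 := near_snd (w0, x0) n1.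
  apply: filterS2 m1 m2 => -[z z'] /= h1 h2.
  rewrite -(subrK (f (w0, x0)) (f z')) -addrA.
  rewrite (le_trans (ler_normD _ _)) // (splitr k) lerD //.
    by rewrite distrC ltW.
  exact: ltW.
exists rho => // t th t0 w x px v vt.
by have := H t th t0 (w, x) (conj I px) v vt.
Qed.

Lemma bound_matrix p (f : Omega * M -> 'M[R]_d) :
  (forall w x, dom (ch p) x -> f z @[z --> (w, x)] --> f (w, x)) ->
  \forall C \near +oo_R, forall w x, core p 2 x -> `|f (w, x)| <= C.
Proof.
move=> fc; have c2 : 0 < (2 : R) <= 3 by lra.
have := @compact_bound R _ _ _ f (@fiber_compact p 2 c2).
case=> [[w x] [_ /core_dom px]|C [Cr H]]; first exact: fc.
by exists C; split=> // t Ct w x px; apply: (H t Ct (w, x)).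
Qed.

Lemma bound_jacobian p q : \forall C \near +oo_R, forall w x, core p 1 x ->
  core q 2 (F w x) -> `|chart_jacobian (ch p) (ch q) (F w) x| <= C.
Proof.
have := @compact_bound R _ _ _ (fun z => chart_jacobian (ch p) (ch q) (F z.1) z.2)
  (@step_compact p q).
case=> [[w x] [/core_dom px /core_dom qx]|C [Cr H]].
  exact: chart_jacobian_continuous.
by exists C; split=> // t Ct w x px qx; apply: (H t Ct (w, x)).
Qed.

Lemma unit_sphere_compact : compact [set u : 'rV[R]_d | `|u| = 1].
Proof.
apply: bounded_closed_compact.
  rewrite /bounded_set /bounded_near; near=> B => u /= ->.
  by near: B; apply: nbhs_pinfty_ge; exact: num_real.
have -> : [set u : 'rV[R]_d | `|u| = 1] = (fun u : 'rV[R]_d => `|u|) @^-1` [set 1] by [].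
apply: closed_comp; last exact: closed_eq.
by move=> u _; exact: norm_continuous.
Unshelve. all: by end_near. Qed.

(** Positivity of the form on the compact product of the core and the unit sphere gives the bound
    there; homogeneity extends it to all u. *)
Lemma qnorm_lower p : \forall C \near +oo_R, forall x, core p 2 x ->
  forall u : 'rV[R]_d, `|u| <= C * qnorm (chart_gram g (ch p) x) u.
Proof.
have c2 : 0 < (2 : R) <= 3 by lra.
have cK : compact (core p 2 `*` [set u : 'rV[R]_d | `|u| = 1]).
  by apply: compact_setX; [exact: core_compact|exact: unit_sphere_compact].
have := (compact_near_coveringP _).1 cK _ +oo_R
  (fun C z => 1 <= C * qnorm (chart_gram g (ch p) z.1) z.2) _.
case=> [[x0 u0] /= [px u01]|C [Cr HC]].
  have px' := core_dom px.
  have u00 : u0 != 0 by rewrite -normr_eq0 u01 oner_eq0.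
  have q0 := chart_gram_pos g px' u00; set c := quad _ u0 u0 in q0.
  have qc : quad (chart_gram g (ch p) z.1) z.2 z.2 @[z --> (x0, u0)] --> c.
    have h1 : chart_gram g (ch p) z.1 @[z --> (x0, u0)] --> chart_gram g (ch p) x0.
      exact: (cvg_comp _ _ (@cvg_fst _ _ (nbhs x0) (nbhs u0) _)
        (chart_gram_continuous px')).
    have h2 : z.2 @[z --> (x0, u0)] --> u0 by exact: cvg_snd.
    have h3 : (z.2)^T @[z --> (x0, u0)] --> u0^T.
      apply: cvg_mx => i j; rewrite mxE.
      have := cvg_entry (i := j) (j := i) h2.
      by apply: cvg_near_ext => //; apply: near_all => z; rewrite mxE.
    exact: cvg_entry (cvg_mulmx (cvg_mulmx h2 h1) h3).
  have c0 : 0 < c / 2 by rewrite divr_gt0.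
  have /cvg_at_dist/(_ _ c0) n1 := qc.
  have sc : 0 < Num.sqrt (c / 2) by rewrite sqrtr_gt0.
  exists ([set z | `|c - quad (chart_gram g (ch p) z.1) z.2 z.2| < c / 2],
     [set C | (Num.sqrt (c / 2))^-1 <= C]).
    split; first exact: n1.
    by apply: nbhs_pinfty_ge; exact: num_real.
  move=> [z C] [/= hz hC].
  have hq : c / 2 <= quad (chart_gram g (ch p) z.1) z.2 z.2.
    by move: hz; rewrite ltr_distlC => /andP[h _]; lra.
  have hs : Num.sqrt (c / 2) <= qnorm (chart_gram g (ch p) z.1) z.2.
    exact: ler_wsqrtr.
  have sc0 : Num.sqrt (c / 2) != 0 by rewrite gt_eqF.
  rewrite -(mulVf sc0); by apply: ler_pM; rewrite // ?invr_ge0 ?sqrtr_ge0.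
exists C; split=> // t Ct x px u.
have [->|u0] := eqVneq u 0.
  by rewrite normr0 /qnorm /quad !mul0mx mxE sqrtr0 mulr0.
have n0 : 0 < `|u| by rewrite normr_gt0.
have uE : u = `|u| *: (`|u|^-1 *: u) by rewrite scalerA divff ?scale1r // gt_eqF.
rewrite {2}uE qnormZ normr_id mulrCA -[X in X <= _]mulr1 ler_wpM2l //.
apply: (HC t Ct (x, _)); split=> //=.
by rewrite normrZ normfV normr_id mulVf // gt_eqF.
Qed.

End UniformEstimates.

(** * One hyperbolic step in coordinates *)

Lemma mulmx_norm_bound (R : realType) m n p (A : 'M[R]_(m, n)) (B : 'M[R]_(n, p)) C :
  n%:R * `|B| <= C -> `|A *m B| <= C * `|A|.
Proof.
move=> BC; apply: (le_trans (mulmx_norm_le _ _)).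
by rewrite mulrCA mulrC ler_wpM2r.
Qed.

(* One step of a pseudo-orbit, from x to a point z close to the image y of x:
   Gx, Gy, Gz are the Gram matrices of the metric at x, y, z; Ps and Pu are the
   projections at x, primed at y and doubly primed at z; J is the Jacobian. *)
Section HyperbolicStep.
Context {R : realType} {d : nat}.
Variables (Gx Gy Gz Ps Pu Ps' Pu' Ps'' Pu'' J : 'M[R]_d) (C k m0 : R).
Hypothesis C_ge1 : 1 <= C.
Hypothesis k_ge0 : 0 <= k.
Hypothesis m0_gt0 : 0 < m0.
Hypothesis m0_le1 : m0 <= 1.
Hypothesis Gy_sym : Gy^T = Gy.
Hypothesis Gy_pos : forall u : 'rV[R]_d, u != 0 -> 0 < quad Gy u u.
Hypothesis Gz_sym : Gz^T = Gz.
Hypothesis Gz_pos : forall u : 'rV[R]_d, u != 0 -> 0 < quad Gz u u.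
Hypothesis Gx_lb : forall u, `|u| <= C * qnorm Gx u.
Hypothesis Gy_lb : forall u, `|u| <= C * qnorm Gy u.
Hypothesis Gz_lb : forall u, `|u| <= C * qnorm Gz u.
Hypothesis Gy_ub : forall u, qnorm Gy u <= C * `|u|.
Hypothesis Gz_ub : forall u, qnorm Gz u <= C * `|u|.
Hypothesis G_near : `|Gy - Gz| <= k.
Hypothesis Ps_near : `|Ps' - Ps''| <= k.
Hypothesis Pu_near : `|Pu' - Pu''| <= k.
Hypothesis Psum : Ps + Pu = 1%:M.
Hypothesis Psum'' : Ps'' + Pu'' = 1%:M.
Hypothesis PuPu : Pu *m Pu = Pu.
Hypothesis PuPu' : Pu' *m Pu' = Pu'.
Hypothesis PuJ : Pu *m J = J *m Pu'.
Hypothesis PsJ : Ps *m J = J *m Ps'.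
Hypothesis J_unit : J \in unitmx.
Hypothesis J_bound : d%:R * `|J| <= C.
Hypothesis Pu'_bound : d%:R * `|Pu'| <= C.
Hypothesis expand : forall u : 'rV[R]_d,
  qnorm Gx (u *m Pu) <= m0 * qnorm Gy (u *m Pu *m J).
Hypothesis contract : forall u : 'rV[R]_d,
  qnorm Gy (u *m Ps *m J) <= m0 * qnorm Gx (u *m Ps).

(** Built with the projection at y, to which J carries Pu exactly, so that [B *m J = Pu'] and
    [J *m B = Pu] hold without error. K1 is the price of exchanging the metrics at y and z, D that
    of exchanging the projections. *)
Let B := Pu' *m invmx J.
Let K1 := 1 + d%:R ^+ 2 * C ^+ 2 * k.
Let D := 2 * d%:R * C ^+ 3.
Let C_gt0 : 0 < C. Proof. exact: lt_le_trans C_ge1. Qed.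
Let C_ge0 : 0 <= C. Proof. exact: ltW. Qed.
Let K1_ge1 : 1 <= K1.
Proof. by rewrite lerDl !mulr_ge0 // exprn_ge0. Qed.
Let K1_ge0 : 0 <= K1. Proof. exact: le_trans K1_ge1. Qed.

Let z_le_y u : qnorm Gz u <= K1 * qnorm Gy u.
Proof.
apply: (@qnorm_near _ _ Gy Gz C) => //; first exact: quad_ge0.
  by rewrite !mulr_ge0 // exprn_ge0.
by rewrite ler_wpM2l ?mulr_ge0 ?exprn_ge0 // distrC.
Qed.

Let y_le_z u : qnorm Gy u <= K1 * qnorm Gz u.
Proof.
apply: (@qnorm_near _ _ Gz Gy C) => //; first exact: quad_ge0.
  by rewrite !mulr_ge0 // exprn_ge0.
by rewrite ler_wpM2l ?mulr_ge0 ?exprn_ge0.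
Qed.

Let split_bound (G P Q : 'M[R]_d) (v : 'rV[R]_d) : P + Q = 1%:M ->
  (forall u, `|u| <= C * qnorm G u) ->
  `|v| <= 2 * C * Num.max (qnorm G (v *m P)) (qnorm G (v *m Q)).
Proof.
move=> PQ Glb; set q := Num.max _ _.
have -> : v = v *m P + v *m Q by rewrite -mulmxDr PQ mulmx1.
apply: (le_trans (ler_normD _ _)); apply: (le_trans (lerD (Glb _) (Glb _))).
have h1 : C * qnorm G (v *m P) <= C * q by rewrite ler_wpM2l // le_max lexx.
have h2 : C * qnorm G (v *m Q) <= C * q by rewrite ler_wpM2l // le_max lexx orbT.
by lra.
Qed.

Let perturbation (A A' : 'M[R]_d) (v : 'rV[R]_d) : `|A - A'| <= k ->
  `|v *m (A - A')| <= d%:R * k * `|v|.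
Proof. by move=> AA'; apply: mulmx_norm_bound; rewrite ler_wpM2l. Qed.

(** [v *m J *m Ps''] is the image of the stable part of v, contracted by m0 at y and measured at z
    at the cost K1, plus [v *m J *m (Ps'' - Ps')], which is of order k. *)
Lemma step_stable (v : 'rV[R]_d) : qnorm Gz (v *m J *m Ps'') <=
  K1 * (m0 + D * k) * Num.max (qnorm Gx (v *m Ps)) (qnorm Gx (v *m Pu)).
Proof.
set q := Num.max _ _; have q0 : 0 <= q by rewrite le_max qnorm_ge0.
have -> : v *m J *m Ps'' = v *m Ps *m J + v *m J *m (Ps'' - Ps').
  by rewrite -[v *m Ps *m J]mulmxA PsJ mulmxA mulmxBr addrCA subrr addr0.
apply: (le_trans (qnorm_triangle Gz_sym Gz_pos _ _)).
have h1 : qnorm Gz (v *m Ps *m J) <= K1 * (m0 * q).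
  apply: (le_trans (z_le_y _)); rewrite ler_wpM2l // (le_trans (contract _)) //.
  by rewrite ler_wpM2l ?(ltW m0_gt0) // le_max lexx.
have h2 : qnorm Gz (v *m J *m (Ps'' - Ps')) <= D * k * q.
  apply: (le_trans (Gz_ub _)).
  apply: (@le_trans _ _ (C * (d%:R * k * (C * (2 * C * q))))).
    rewrite ler_wpM2l //; apply: (le_trans (perturbation _ _)).
      by rewrite distrC.
    rewrite ler_wpM2l ?mulr_ge0 // (le_trans (mulmx_norm_bound _ J_bound)) //.
    by rewrite ler_wpM2l // split_bound.
  by rewrite le_eqVlt /D; apply/orP; left; apply/eqP; ring.
apply: (le_trans (lerD h1 h2)); rewrite mulrDr mulrDl mulrA lerD2l.
by rewrite -[X in _ <= X]mulrA ler_peMl // /D !mulr_ge0 // exprn_ge0.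
Qed.

Let BJ : B *m J = Pu'.
Proof. by rewrite /B -mulmxA mulVmx // mulmx1. Qed.

Lemma step_BPu : B *m Pu = B.
Proof.
have : B *m Pu *m J = B *m J by rewrite -mulmxA PuJ mulmxA BJ PuPu'.
by move/(congr1 (mulmx^~ (invmx J))); rewrite -!mulmxA mulmxV // !mulmx1.
Qed.

Lemma step_JB : J *m B = Pu.
Proof. by rewrite /B mulmxA -PuJ -mulmxA mulmxV // mulmx1. Qed.

Let B_le v : qnorm Gx (v *m B) <= m0 * qnorm Gy (v *m Pu').
Proof.
have E : v *m B *m Pu = v *m B by rewrite -mulmxA step_BPu.
by have := expand (v *m B); rewrite E -[v *m B *m J]mulmxA BJ.
Qed.

(** B contracts [v *m Pu'] as measured at y; passing to Pu'' and to the metric at z costs terms of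
    order k. The last factor C only serves to reach the constant D of the stable estimate. *)
Lemma step_unstable (v : 'rV[R]_d) : qnorm Gx (v *m B) <=
  K1 * (m0 + D * k) * Num.max (qnorm Gz (v *m Ps'')) (qnorm Gz (v *m Pu'')).
Proof.
set q := Num.max _ _; have q0 : 0 <= q by rewrite le_max qnorm_ge0.
have D0 : 0 <= D by rewrite /D !mulr_ge0 // exprn_ge0.
have h : qnorm Gz (v *m Pu') <= q + 2 * d%:R * C ^+ 2 * k * q.
  have -> : v *m Pu' = v *m Pu'' + v *m (Pu' - Pu'').
    by rewrite mulmxBr addrCA subrr addr0.
  apply: (le_trans (qnorm_triangle Gz_sym Gz_pos _ _)).
  rewrite lerD ?le_max ?lexx ?orbT //.
  apply: (le_trans (Gz_ub _)).
  apply: (@le_trans _ _ (C * (d%:R * k * (2 * C * q)))).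
    rewrite ler_wpM2l //; apply: (le_trans (perturbation _ Pu_near)).
    by rewrite ler_wpM2l ?mulr_ge0 // split_bound.
  by rewrite le_eqVlt; apply/orP; left; apply/eqP; ring.
apply: (le_trans (B_le v)).
apply: (@le_trans _ _ (m0 * (K1 * (q + 2 * d%:R * C ^+ 2 * k * q)))).
  rewrite ler_wpM2l ?(ltW m0_gt0) // (le_trans (y_le_z _)) // ler_wpM2l //.
have -> : m0 * (K1 * (q + 2 * d%:R * C ^+ 2 * k * q)) =
  K1 * (m0 + m0 * (2 * d%:R * C ^+ 2 * k)) * q by ring.
rewrite ler_wpM2r // ler_wpM2l // lerD2l.
have X0 : 0 <= 2 * d%:R * C ^+ 2 * k by rewrite !mulr_ge0 // exprn_ge0.
apply: (@le_trans _ _ (2 * d%:R * C ^+ 2 * k)); first by rewrite ler_piMl.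
have -> : D * k = C * (2 * d%:R * C ^+ 2 * k) by rewrite /D; ring.
by rewrite ler_peMl.
Qed.

Lemma step_B_bound (v : 'rV[R]_d) : `|v *m B| <= C ^+ 3 * `|v|.
Proof.
apply: (le_trans (Gx_lb _)); rewrite exprS -mulrA ler_wpM2l //.
apply: (le_trans (B_le v)).
apply: (@le_trans _ _ (qnorm Gy (v *m Pu'))); first by rewrite ler_piMl ?qnorm_ge0.
apply: (le_trans (Gy_ub _)); rewrite expr2 -mulrA ler_wpM2l //.
exact: mulmx_norm_bound.
Qed.

(** The two conditions say that v is unstable at z and has no unstable part at y, so v = v (Pu'' -
    Pu'), whose norm is at most d k times that of v. *)
Lemma step_transversal (v : 'rV[R]_d) : d%:R * k < 1 ->
  v *m Ps'' = 0 -> v *m B = 0 -> v = 0.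
Proof.
move=> dk vs vb.
have vu' : v *m Pu' = 0 by rewrite -BJ mulmxA vb mul0mx.
have vE : v = v *m (Pu'' - Pu').
  by rewrite mulmxBr vu' subr0 -[RHS]add0r -vs -mulmxDr Psum'' mulmx1.
have : `|v| <= d%:R * k * `|v|.
  by rewrite {1}vE; apply: perturbation; rewrite distrC.
move=> H; apply/eqP; rewrite -normr_le0.
have H' : (1 - d%:R * k) * `|v| <= 0 by rewrite mulrBl mul1r subr_le0.
by move: H'; rewrite pmulr_rle0 // subr_gt0.
Qed.

End HyperbolicStep.

(** At k = 0 the rate is m < 1. E collects the coefficients of all perturbation terms, which
    together take up at most half of the margin 1 - m; k <= 1 absorbs the quadratic term. *)
Lemma small_rate (R : realFieldType) (m a b c e : R) : 0 <= m < 1 ->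
  0 <= a -> 0 <= b -> 0 <= c -> 0 <= e ->
  exists k, [/\ 0 < k, (1 + a * k) * (m + b * k) + c * k < 1 & e * k < 1].
Proof.
move=> /andP[m0 m1] a0 b0 c0 e0; pose E := a + b + a * b + c + e + 1.
have ab0 : 0 <= a * b by rewrite mulr_ge0.
have E0 : 0 < E by rewrite /E; lra.
have m1' : 0 < 1 - m by rewrite subr_gt0.
pose k := Num.min 1 ((1 - m) / (2 * E)).
have k0 : 0 < k by rewrite lt_min ltr01 divr_gt0 // mulr_gt0.
have k1 : k <= 1 by rewrite ge_min lexx.
have kE : E * k <= (1 - m) / 2.
  have : k <= (1 - m) / (2 * E) by rewrite ge_min lexx orbT.
  rewrite -(ler_pM2l E0); have -> // : E * ((1 - m) / (2 * E)) = (1 - m) / 2.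
  by field; rewrite gt_eqF.
have kE' : a * k + b * k + a * b * k + c * k + e * k + k <= (1 - m) / 2.
  by move: kE; rewrite /E !mulrDl mul1r.
have [ak bk abk ck ek] : [/\ 0 <= a * k, 0 <= b * k, 0 <= a * b * k, 0 <= c * k & 0 <= e * k].
  by split; rewrite mulr_ge0 // ltW.
exists k; split=> //; last by lra.
have amk : a * k * m <= a * k by rewrite ler_piMr // ltW.
have abkk : a * b * k * k <= a * b * k by rewrite ler_piMr.
have -> : (1 + a * k) * (m + b * k) = m + b * k + a * k * m + a * b * k * k by ring.
by lra.
Qed.

(** * Shadowing in charts *)

Section Shadowing.
Context {R : realType} {d : nat} {M : topologicalType}.
Variables (S : smooth_manifold R d M) (g : riemannian_metric S).
Hypothesis M_compact : compact [set: M].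
Variables (r : M -> R) (s : seq M).
Hypothesis r_gt0 : forall p, 0 < r p.
Hypothesis r_img : forall p a,
  `|a - chart (chart_at S p) p| <= 3 * r p ->
  (chart (chart_at S p) @` dom (chart_at S p)) a.
Context {Omega : metricType R}.
Hypothesis Omega_compact : compact [set: Omega].
Variables (theta : Omega -> Omega) (F : Omega -> diff2 S).
Hypothesis F_cont : continuous F.
Variables (Es Eu : Omega -> M -> {vspace 'rV[R]_d}) (lam : R).
Hypothesis lam_gt0 : 0 < lam.
Hypothesis Es_cont : continuous_subbundle S Es.
Hypothesis Eu_cont : continuous_subbundle S Eu.
Hypothesis EsDEu : forall w x, (Es w x + Eu w x)%VS = fullv.
Hypothesis EsIEu : forall w x, (Es w x :&: Eu w x)%VS = 0%VS.
Hypothesis Es_inv : forall w x,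
  tangent_map S (F w) (x := x) @` [set` Es w x] = [set` Es (theta w) (F w x)].
Hypothesis Eu_inv : forall w x,
  tangent_map S (F w) (x := x) @` [set` Eu w x] = [set` Eu (theta w) (F w x)].
Hypothesis Eu_exp : forall w x (v : tangent x), v \in Eu w x ->
  expR lam * tnorm g v <= tnorm g (tangent_map S (F w) v).
Hypothesis Es_con : forall w x (v : tangent x), v \in Es w x ->
  tnorm g (tangent_map S (F w) v) <= expR (- lam) * tnorm g v.

Local Notation ch p := (chart_at S p).
Local Notation core := (core S r).
Local Notation Ps p w x := (chart_proj Es Eu (ch p) w x).
Local Notation Pu p w x := (chart_proj Eu Es (ch p) w x).
Local Notation G p x := (chart_gram g (ch p) x).
Local Notation J p q w x := (chart_jacobian (ch p) (ch q) (F w) x).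

Let EuDEs w x : (Eu w x + Es w x)%VS = fullv. Proof. by rewrite addvC EsDEu. Qed.
Let EuIEs w x : (Eu w x :&: Es w x)%VS = 0%VS. Proof. by rewrite capvC EsIEu. Qed.

Let Ps_cvg p w x : dom (ch p) x ->
  Ps p z.1 z.2 @[z --> (w, x)] --> Ps p w x.
Proof. exact: chart_proj_continuous. Qed.

Let Pu_cvg p w x : dom (ch p) x ->
  Pu p z.1 z.2 @[z --> (w, x)] --> Pu p w x.
Proof. exact: chart_proj_continuous. Qed.

Let G_cvg p (w : Omega) x : dom (ch p) x -> G p z.2 @[z --> (w, x)] --> G p x.
Proof.
move=> px; exact: (cvg_comp _ _ (@cvg_snd _ _ (nbhs w) (nbhs x) _)
  (chart_gram_continuous px)).
Qed.

Lemma uniform_constants : exists C : R, [/\ 1 <= C,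
  forall p, p \in s -> forall w x, core p 2 x ->
    [/\ d%:R * `|Ps p w x| <= C, d%:R * `|Pu p w x| <= C,
        forall u, qnorm (G p x) u <= C * `|u| &
        forall u : 'rV[R]_d, `|u| <= C * qnorm (G p x) u] &
  forall p q, p \in s -> q \in s -> forall w x, core p 1 x ->
    core q 2 (F w x) -> d%:R * `|J p q w x| <= C].
Proof.
near +oo_R => C0.
have C00 : 0 <= C0 by near: C0; apply: nbhs_pinfty_ge; exact: num_real.
have h1 : forall p, p \in s -> forall w x, core p 2 x -> `|Ps p w x| <= C0.
  near: C0; apply: filter_all_seq => p _.
  exact: (@bound_matrix _ _ _ S r r_gt0 r_img _ Omega_compact p
    (fun z => Ps p z.1 z.2) (@Ps_cvg p)).
have h2 : forall p, p \in s -> forall w x, core p 2 x -> `|Pu p w x| <= C0.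
  near: C0; apply: filter_all_seq => p _.
  exact: (@bound_matrix _ _ _ S r r_gt0 r_img _ Omega_compact p
    (fun z => Pu p z.1 z.2) (@Pu_cvg p)).
have h3 : forall p, p \in s -> forall (w : Omega) x, core p 2 x -> `|G p x| <= C0.
  near: C0; apply: filter_all_seq => p _.
  exact: (@bound_matrix _ _ _ S r r_gt0 r_img _ Omega_compact p
    (fun z => G p z.2) (@G_cvg p)).
have h4 : forall p, p \in s -> forall x, core p 2 x ->
    forall u : 'rV[R]_d, `|u| <= C0 * qnorm (G p x) u.
  near: C0; apply: filter_all_seq => p _; exact: qnorm_lower.
have h5 : forall p, p \in s -> forall q, q \in s -> forall w x, core p 1 x ->
    core q 2 (F w x) -> `|J p q w x| <= C0.
  near: C0; apply: filter_all_seq => p _; apply: filter_all_seq => q _.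
  exact: bound_jacobian.
have q0 : 0 <= Num.sqrt (d%:R ^+ 2 * C0) by exact: sqrtr_ge0.
have dC : 0 <= d%:R * C0 by rewrite mulr_ge0.
exists (1 + C0 + d%:R * C0 + Num.sqrt (d%:R ^+ 2 * C0)); split.
- by lra.
- move=> p ps w x px; split.
  + have := h1 p ps w x px => /(ler_wpM2l (ler0n R d)); lra.
  + have := h2 p ps w x px => /(ler_wpM2l (ler0n R d)); lra.
  + move=> u; apply: (le_trans (qnorm_bound _ _)); rewrite ler_wpM2r //.
    have : Num.sqrt (d%:R ^+ 2 * `|G p x|) <= Num.sqrt (d%:R ^+ 2 * C0).
      by rewrite ler_wsqrtr // ler_wpM2l ?exprn_ge0 // (h3 p ps w).
    by move: C00 dC q0; lra.
  + move=> u; apply: (le_trans (h4 p ps x px u)); rewrite ler_wpM2r ?qnorm_ge0 //.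
    by lra.
- move=> p q ps qs w x px qx.
  by have := h5 p ps q qs w x px qx => /(ler_wpM2l (ler0n R d)); lra.
Unshelve. all: by end_near. Qed.

(** The image [F w x] is the shift of x' by the jump read in the chart, so the uniform estimates for
    shifts at x' compare projections and metric at the two points. *)
Lemma uniform_moduli k : 0 < k -> \forall rho \near (0 : R)^'+,
  (forall p, p \in s -> rho <= r p) /\
  forall p, p \in s -> forall q, q \in s -> forall w x x',
    core p 1 x -> core q 1 x' -> dom (ch q) (F w x) ->
    `|chart (ch q) (F w x) - chart (ch q) x'| <= rho ->
    [/\ core q 2 (F w x),
        forall v : 'rV[R]_d, `|v| <= rho ->
          dom (ch q) (F w (shift_in (ch p) x v)) /\
          `|J p q w (shift_in (ch p) x v) - J p q w x| <= k,
        `|Ps q (theta w) (F w x) - Ps q (theta w) x'| <= k,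
        `|Pu q (theta w) (F w x) - Pu q (theta w) x'| <= k &
        `|G q (F w x) - G q x'| <= k].
Proof.
move=> k0.
have n0 : \forall rho \near (0 : R)^'+, forall p, p \in s -> rho <= r p.
  by apply: filter_all_seq => p _; apply: nbhs_right_le.
have nJ : \forall rho \near (0 : R)^'+, forall p, p \in s -> forall q, q \in s ->
    forall w x, core p 1 x -> core q 2 (F w x) -> forall v : 'rV[R]_d, `|v| <= rho ->
      dom (ch q) (F w (shift_in (ch p) x v)) /\
      `|J p q w (shift_in (ch p) x v) - J p q w x| <= k.
  apply: filter_all_seq => p _; apply: filter_all_seq => q _.
  exact: near_jacobian.
have nPs : \forall rho \near (0 : R)^'+, forall p, p \in s -> forall w x, core p 1 x ->
    forall v : 'rV[R]_d, `|v| <= rho -> `|Ps p w (shift_in (ch p) x v) - Ps p w x| <= k.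
  apply: filter_all_seq => p _.
  exact: (@near_matrix _ _ _ S r r_gt0 r_img _ Omega_compact p
    (fun z => Ps p z.1 z.2) k k0 (@Ps_cvg p)).
have nPu : \forall rho \near (0 : R)^'+, forall p, p \in s -> forall w x, core p 1 x ->
    forall v : 'rV[R]_d, `|v| <= rho -> `|Pu p w (shift_in (ch p) x v) - Pu p w x| <= k.
  apply: filter_all_seq => p _.
  exact: (@near_matrix _ _ _ S r r_gt0 r_img _ Omega_compact p
    (fun z => Pu p z.1 z.2) k k0 (@Pu_cvg p)).
have nG : \forall rho \near (0 : R)^'+, forall p, p \in s -> forall (w : Omega) x, core p 1 x ->
    forall v : 'rV[R]_d, `|v| <= rho -> `|G p (shift_in (ch p) x v) - G p x| <= k.
  apply: filter_all_seq => p _.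
  exact: (@near_matrix _ _ _ S r r_gt0 r_img _ Omega_compact p
    (fun z => G p z.2) k k0 (@G_cvg p)).
near=> rho.
have H0 : forall p, p \in s -> rho <= r p by near: rho.
split=> // p ps q qs w x x' px qx' qFx dist.
have qy : core q 2 (F w x).
  split=> //; rewrite -[chart (ch q) (F w x)](subrK (chart (ch q) x')) -addrA.
  rewrite (le_trans (ler_normD _ _)) // mulr2n mulrDl mul1r lerD //.
    exact: le_trans dist (H0 _ qs).
  by case: qx'; rewrite mul1r.
have E := shift_in_sub x' qFx.
split=> //.
- by have := (near nJ rho _) p ps q qs w x px qy; exact.
- by have := (near nPs rho _) q qs (theta w) x' qx' _ dist; rewrite E; exact.
- by have := (near nPu rho _) q qs (theta w) x' qx' _ dist; rewrite E; exact.
- by have := (near nG rho _) q qs w x' qx' _ dist; rewrite E; exact.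
Unshelve. all: by end_near. Qed.

Definition chart_orbit (w : int -> Omega) (x p : int -> M) (v : int -> 'rV[R]_d) :=
  forall n, F (w n) (shift_in (ch (p n)) (x n) (v n)) =
    shift_in (ch (p (n + 1))) (x (n + 1)) (v (n + 1)).

(** The charts [p n] are arbitrary members of the atlas whose cores contain [x n]. Existence and
    uniqueness are obtained for the same rho, so that uniqueness can serve for expansivity with an
    exact orbit as pseudo-orbit. *)
Lemma chart_shadowing : exists2 rho0 : R, 0 < rho0 & forall rho, 0 < rho <= rho0 ->
  exists2 eps : R, 0 < eps & forall (w : int -> Omega) (x p : int -> M),
    (forall n, w (n + 1) = theta (w n)) -> (forall n, p n \in s) ->
    (forall n, core (p n) 1 (x n)) ->
    (forall n, dom (ch (p (n + 1))) (F (w n) (x n))) ->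
    (forall n, `|chart (ch (p (n + 1))) (F (w n) (x n)) -
       chart (ch (p (n + 1))) (x (n + 1))| <= eps) ->
    (exists v, (forall n, `|v n| <= rho) /\ chart_orbit w x p v) /\
    (forall v v', (forall n, `|v n| <= rho) -> (forall n, `|v' n| <= rho) ->
       chart_orbit w x p v -> chart_orbit w x p v' -> forall n, v n = v' n).
Proof.
have [C [C1 HC HJ]] := uniform_constants.
have C0 : 0 <= C by exact: le_trans C1.
(* The recursion uses a single constant for all bounds; the weakest of them is that of
   [step_B_bound], with the cube of C. *)
pose m0 := expR (- lam); pose C3 := C ^+ 3.
have m00 : 0 < m0 by exact: expR_gt0.
have m01 : m0 < 1 by rewrite /m0 expR_lt1 oppr_lt0.
have C31 : 1 <= C3 by exact: exprn_ege1.
have C30 : 0 <= C3 by exact: le_trans C31.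
have CC3 : C <= C3 by rewrite /C3 exprS ler_peMr // exprn_ege1.
(* The product is the rate of [step_stable] and [step_unstable]; the last term is the cost of a
   nonlinear part with Lipschitz constant d k; [d%:R * k < 1] is the condition of transversality. *)
have [k [k0 kmu kd]] : exists k, [/\ 0 < k,
    (1 + d%:R ^+ 2 * C ^+ 2 * k) * (m0 + 2 * d%:R * C ^+ 3 * k) +
      C3 ^+ 2 * (2 * C3 ^+ 2) * d%:R * k < 1 & d%:R * k < 1].
  apply: small_rate; first by rewrite m01 ltW.
  - by rewrite mulr_ge0 // exprn_ge0.
  - by rewrite !mulr_ge0 // exprn_ge0.
  - by rewrite !mulr_ge0 // exprn_ge0.
  - by [].
pose mu := (1 + d%:R ^+ 2 * C ^+ 2 * k) * (m0 + 2 * d%:R * C ^+ 3 * k).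
have mu0 : 0 <= mu.
  by rewrite /mu mulr_ge0 ?addr_ge0 ?mulr_ge0 ?exprn_ge0 // ltW.
have mu'1 : mu + C3 ^+ 2 * (2 * C3 ^+ 2) * (d%:R * k) < 1.
  by rewrite [C3 ^+ 2 * (2 * C3 ^+ 2) * (d%:R * k)]mulrA.
have [rho0 /= rho00 Hrho] := uniform_moduli k0.
exists (rho0 / 2) => [|rho /andP[rho_gt0 rho_le]]; first by rewrite divr_gt0.
have [|rho_r Hmod] := Hrho rho _ rho_gt0.
  by rewrite /= sub0r normrN gtr0_norm // (le_lt_trans rho_le) // ltr_pdivrMr // ltr_pMr // ltr1n.
pose K := 2 * C3 ^+ 2 * C3 ^+ 2.
have K0 : 0 < K by rewrite /K -mulrA -exprD mulr_gt0 // exprn_gt0 // (lt_le_trans _ C31).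
set mu' := mu + _ in mu'1.
have mu'1' : 0 < 1 - mu' by rewrite subr_gt0.
(* Jumps below rho make [uniform_moduli] applicable; the second bound is the condition on eps in
   [hyperbolic_solution]. *)
exists (Num.min rho ((1 - mu') * rho / K)).
  by rewrite lt_min rho_gt0 divr_gt0 // mulr_gt0.
move=> w x p wn ps px pF dist.
have dist_rho n : `|chart (ch (p (n + 1))) (F (w n) (x n)) -
       chart (ch (p (n + 1))) (x (n + 1))| <= rho.
  by apply: (le_trans (dist n)); rewrite ge_min lexx.
have Hm n := Hmod _ (ps n) _ (ps (n + 1)) (w n) (x n) (x (n + 1)) (px n) (px (n + 1))
  (pF n) (dist_rho n).
have dx n : dom (ch (p n)) (x n) by case: (px n).
have px2 n : core (p n) 2 (x n).
  by apply: (core_le r_gt0 _ (px n)); lra.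
have pF2 n : core (p (n + 1)) 2 (F (w n) (x n)) by case: (Hm n).
pose N n u := qnorm (G (p n) (x n)) u.
pose PS n := Ps (p n) (w n) (x n).
pose PU n := Pu (p n) (w n) (x n).
pose A n := J (p n) (p (n + 1)) (w n) (x n).
pose PU' n := Pu (p (n + 1)) (theta (w n)) (F (w n) (x n)).
pose PS' n := Ps (p (n + 1)) (theta (w n)) (F (w n) (x n)).
pose B n := PU' n *m invmx (A n).
(* gg is F read in the charts and recentred along the pseudo-orbit x, whose
   jumps are e: v is a chart orbit iff gg n (v n) = v (n + 1) + e n. *)
pose gg n v := chart (ch (p (n + 1))) (F (w n) (shift_in (ch (p n)) (x n) v)) -
   chart (ch (p (n + 1))) (F (w n) (x n)).
pose e n := chart (ch (p (n + 1))) (x (n + 1)) - chart (ch (p (n + 1))) (F (w n) (x n)).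
have shiftP n (v : 'rV[R]_d) : `|v| <= rho ->
    dom (ch (p n)) (shift_in (ch (p n)) (x n) v) /\
    chart (ch (p n)) (shift_in (ch (p n)) (x n) v) = chart (ch (p n)) (x n) + v.
  move=> vr; have [||h1 h2 _] := core_shift r_gt0 r_img (p := p n) (x := x n) (v := v) _ (px n).
  - by lra.
  - exact: le_trans vr (rho_r _ (ps n)).
  - by [].
have orbitP v : (forall n, `|v n| <= rho) ->
    (chart_orbit w x p v <-> forall n, gg n (v n) = v (n + 1) + e n).
  move=> vr; split=> H n.
    rewrite /gg (H n); have [_ ->] := shiftP (n + 1) (v (n + 1)) (vr _).
    by rewrite /e addrCA addrA.
  have [_ hv _ _ _] := Hm n; have [dF _] := hv _ (vr n).
  have := H n; rewrite /gg /e addrA => /addIr E.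
  by rewrite -(chartK dF) E addrC.
have N_lb n v : `|v| <= C3 * N n v.
  have [_ _ _ h] := HC _ (ps n) (w n) _ (px2 n).
  by apply: (le_trans (h v)); rewrite ler_wpM2r ?qnorm_ge0.
have N_ub n v : N n v <= C3 * `|v|.
  have [_ _ h _] := HC _ (ps n) (w n) _ (px2 n).
  by apply: (le_trans (h v)); rewrite ler_wpM2r.
have G_sym q z : (G q z)^T = G q z by exact: chart_gram_sym.
have G_pos q z : dom (ch q) z -> forall u : 'rV[R]_d, u != 0 -> 0 < quad (G q z) u u.
  by move=> qz u; exact: chart_gram_pos.
have N_tri n u v : N n (u + v) <= N n u + N n v.
  by apply: qnorm_triangle; [exact: G_sym|exact: G_pos].
have PSU n : PS n + PU n = 1%:M by exact: chart_proj_sum.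
have PSS n : PS n *m PS n = PS n by exact: chart_proj_idem.
have PUU n : PU n *m PU n = PU n by exact: (chart_proj_idem EuIEs).
have PUS n : PU n *m PS n = 0 by exact: (chart_proj_mul0 EuDEs EuIEs).
have PS_bound n (v : 'rV[R]_d) : `|v *m PS n| <= C3 * `|v|.
  have [h _ _ _] := HC _ (ps n) (w n) _ (px2 n).
  by apply: mulmx_norm_bound; exact: le_trans h CC3.
have PU_bound n (v : 'rV[R]_d) : `|v *m PU n| <= C3 * `|v|.
  have [_ h _ _] := HC _ (ps n) (w n) _ (px2 n).
  by apply: mulmx_norm_bound; exact: le_trans h CC3.
have dF n : dom (ch (p (n + 1))) (F (w n) (x n)) by exact: pF.
have PUU' n : PU' n *m PU' n = PU' n by exact: (chart_proj_idem EuIEs).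
have PUA n : PU n *m A n = A n *m PU' n
  by exact: (chart_proj_jacobian EuDEs EuIEs Eu_inv Es_inv).
have PSA n : PS n *m A n = A n *m PS' n by exact: chart_proj_jacobian.
have A_unit n : A n \in unitmx by exact: (chart_jacobian_unit EsDEu Es_inv Eu_inv).
have Gx_lb n (u : 'rV[R]_d) : `|u| <= C * qnorm (G (p n) (x n)) u.
  by have [_ _ _ h] := HC _ (ps n) (w n) _ (px2 n).
have Gx_ub n (u : 'rV[R]_d) : qnorm (G (p n) (x n)) u <= C * `|u|.
  by have [_ _ h _] := HC _ (ps n) (w n) _ (px2 n).
have Gy_lb n (u : 'rV[R]_d) : `|u| <= C * qnorm (G (p (n + 1)) (F (w n) (x n))) u.
  by have [_ _ _ h] := HC _ (ps (n + 1)) (theta (w n)) _ (pF2 n).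
have Gy_ub n (u : 'rV[R]_d) : qnorm (G (p (n + 1)) (F (w n) (x n))) u <= C * `|u|.
  by have [_ _ h _] := HC _ (ps (n + 1)) (theta (w n)) _ (pF2 n).
have PU'_bound n : d%:R * `|PU' n| <= C.
  by have [_ h _ _] := HC _ (ps (n + 1)) (theta (w n)) _ (pF2 n).
have A_bound n : d%:R * `|A n| <= C by exact: HJ.
have expand n (u : 'rV[R]_d) : qnorm (G (p n) (x n)) (u *m PU n) <=
    m0 * qnorm (G (p (n + 1)) (F (w n) (x n))) (u *m PU n *m A n).
  have := @chart_expansion _ _ _ _ g _ Eu Es F _ _ _ _ _ (@Eu_exp (w n) (x n)) (dx n) (dF n) u.
  move=> /(ler_wpM2l (ltW m00)); rewrite mulrA /m0 -expRD addNr expR0 mul1r.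
  exact.
have contract n (u : 'rV[R]_d) :
    qnorm (G (p (n + 1)) (F (w n) (x n))) (u *m PS n *m A n) <=
    m0 * qnorm (G (p n) (x n)) (u *m PS n).
  exact: (@chart_contraction _ _ _ _ g _ Es Eu F _ _ _ _ _ (@Es_con (w n) (x n)) (dx n) (dF n) u).
have PS_near n : `|PS' n - PS (n + 1)| <= k.
  by have [_ _ h _ _] := Hm n; rewrite /PS wn.
have PU_near n : `|PU' n - PU (n + 1)| <= k.
  by have [_ _ _ h _] := Hm n; rewrite /PU wn.
have G_near n : `|G (p (n + 1)) (F (w n) (x n)) - G (p (n + 1)) (x (n + 1))| <= k.
  by have [_ _ _ _ h] := Hm n.
have B_bound n (v : 'rV[R]_d) : `|v *m B n| <= C3 * `|v|.
  by apply: (step_B_bound (Gx := G (p n) (x n)) (Gy := G (p (n + 1)) (F (w n) (x n)))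
     (Pu := PU n) (m0 := m0)) => //; exact: ltW.
have BPU n : B n *m PU n = B n by exact: step_BPu.
have AB n : A n *m B n = PU n by exact: step_JB.
have stable n (v : 'rV[R]_d) : N (n + 1) (v *m A n *m PS (n + 1)) <=
    mu * Num.max (N n (v *m PS n)) (N n (v *m PU n)).
  apply: (step_stable (Gy := G (p (n + 1)) (F (w n) (x n))) (Ps' := PS' n)) => //.
  + exact: ltW.
  + exact: G_pos.
  + exact: G_pos.
have unstable n (v : 'rV[R]_d) : N n (v *m B n) <=
    mu * Num.max (N (n + 1) (v *m PS (n + 1))) (N (n + 1) (v *m PU (n + 1))).
  apply: (step_unstable (Gy := G (p (n + 1)) (F (w n) (x n))) (Pu := PU n)) => //.
  + exact: ltW.
  + exact: ltW.
  + exact: G_pos.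
have transv n (v : 'rV[R]_d) : v *m PS (n + 1) = 0 -> v *m B n = 0 -> v = 0.
  by apply: (step_transversal (PU_near n)).
have gg0 n : gg n 0 = 0.
  by rewrite /gg /shift_in addr0 chartK ?subrr.
have lip n (v v' : 'rV[R]_d) : `|v| <= rho -> `|v'| <= rho ->
    `|gg n v - gg n v' - (v - v') *m A n| <= d%:R * k * `|v - v'|.
  move=> vr v'r.
  have -> : gg n v - gg n v' =
      local_rep (ch (p n)) (ch (p (n + 1))) (F (w n)) (chart (ch (p n)) (x n) + v) -
      local_rep (ch (p n)) (ch (p (n + 1))) (F (w n)) (chart (ch (p n)) (x n) + v').
    by rewrite /gg opprB addrA subrK.
  have [_ hv _ _ _] := Hm n.
  apply: mean_value_jacobian vr v'r => u ur.
    have [du uE] := shiftP n u ur; have [du' _] := hv u ur.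
    rewrite -uE; exact: (C2_map_differentiable (diff2_C2 _) du du').
  have [du uE] := shiftP n u ur; have [_ h] := hv u ur.
  by move: h; rewrite /A !chart_jacobianE uE.
have kap0 : 0 <= d%:R * k by rewrite mulr_ge0 // ltW.
have ee n : `|e n| <= Num.min rho ((1 - mu') * rho / K).
  by rewrite /e distrC.
split.
  have [|v [vr gv]] := @hyperbolic_solution R d N PS PU A B gg C3 mu (d%:R * k) rho
    C31 mu0 kap0 rho_gt0 N_lb N_ub N_tri PSU PSS PUS PS_bound PU_bound B_bound
    BPU AB stable unstable transv gg0 lip mu'1 e _ ee.
    have : Num.min rho ((1 - mu') * rho / K) <= (1 - mu') * rho / K by rewrite ge_min lexx orbT.
    by rewrite ler_pdivlMr // mulrC.
  by exists v; split=> //; apply/orbitP.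
move=> v v' vr v'r /(orbitP v vr) ov /(orbitP v' v'r) ov'.
exact: (@hyperbolic_unique R d N PS PU A B gg C3 mu (d%:R * k) rho
    C31 mu0 kap0 N_lb N_ub N_tri PSU PSS PUS PS_bound PU_bound B_bound
    BPU AB stable unstable lip mu'1 e v v' vr v'r ov ov').
Qed.

End Shadowing.

(** * Curves and their lengths *)

Section AffineReparametrisation.
Context {R : realType}.

Lemma affine_differentiable (V : normedModType R) (a u : V) (t : R) :
  differentiable (fun s : R => a + s *: u) t.
Proof. by apply/derivable1_diffP; have [] := affine_derive a u t. Qed.

Lemma affine_diff (V : normedModType R) (a u : V) (t v : R) :
  'd (fun s : R => a + s *: u) t v = v *: u.
Proof.
have [da ua] := affine_derive a u t; have dd := affine_differentiable a u t.
have E1 : 'd (fun s : R => a + s *: u) t 1 = u.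
  by rewrite -[RHS]ua; exact: esym (derive1E' dd).
have E : v = v *: (1 : R) by exact: esym (mulr1 v).
apply: etrans (congr1 ('d (fun s : R => a + s *: u) t) E) _.
by rewrite linearZ; exact: (congr1 ( *:%R v) E1).
Qed.

Lemma affine_continuous (V : normedModType R) (a u : V) :
  continuous (fun s : R => a + s *: u).
Proof. by move=> t; apply: differentiable_continuous; exact: affine_differentiable. Qed.

Lemma C_on_affine (V W : normedModType R) (A : set V) (f : V -> W) (a u : V) :
  (forall x, A x -> nbhs x A) -> C_on 1 A f ->
  C_on 1 ((fun s : R => a + s *: u) @^-1` A) (f \o (fun s : R => a + s *: u)).
Proof.
move=> oA Cf; set aff := fun s : R => a + s *: u.
have df t : A (aff t) -> differentiable f (aff t).
  by move=> At; have [_ /(_ isT)] := Cf [::] isT _ At.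
have daff t : differentiable aff t by exact: affine_differentiable.
have dcomp t : A (aff t) -> differentiable (f \o aff) t.
  by move=> At; apply: differentiable_comp; [exact: daff|exact: df].
have diffE t v : A (aff t) -> 'd (f \o aff) t v = 'd f (aff t) (v *: u).
  move=> At; apply: etrans (congr1 (@^~ v) (diff_comp (daff t) (df _ At))) _.
  by rewrite /= affine_diff.
move=> [_ t At|v [|//] _ t At]; last first.
  split=> //=.
  have [c _] := Cf [:: v *: u] isT _ At.
  have H : 'd f (aff s) (v *: u) @[s --> t] --> 'd f (aff t) (v *: u).
    exact: (cvg_comp _ _ (@affine_continuous V a u t) c).
  apply: (cvg_near_ext _ _ H); first exact: esym (diffE _ _ At).
  have nA : \forall s \near t, A (aff s) by apply: (@affine_continuous V a u t); exact: oA.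
  by apply: filterS nA => s As; exact: esym (diffE _ _ As).
split=> [|_] /=; last exact: dcomp.
apply: continuous_comp; first exact: affine_continuous.
exact: C_on_continuous Cf At.
Qed.

End AffineReparametrisation.

Section Curves.
Context {R : realType} {d : nat} {M : topologicalType}.
Variables (S : smooth_manifold R d M) (g : riemannian_metric S).
Implicit Types (i j k : chart_index S) (x : M) (c : R -> M) (U : set R).

Lemma C1_curve_near U c t i : open U -> C1_curve_on S U c -> U t -> dom i (c t) ->
  \forall s \near t, U s /\ dom i (c s).
Proof.
move=> oU [cc _] Ut it; apply: filterI; first exact: open_nbhs_nbhs.
by apply: (cc t Ut); exact: dom_nbhs.
Qed.

Lemma C1_curve_derivable U c t i : C1_curve_on S U c -> U t -> dom i (c t) ->
  derivable (chart i \o c) t 1.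
Proof.
move=> [_ Cc] Ut it; apply/derivable1_diffP.
by have [_ /(_ isT)] := Cc i [::] isT t (conj Ut it).
Qed.

Lemma C1_curve_derive_continuous U c t i : open U -> C1_curve_on S U c -> U t ->
  dom i (c t) -> {for t, continuous (derive1 (chart i \o c))}.
Proof.
move=> oU Cc Ut it; have [_ Ci] := Cc.
have [H _] := Ci i [:: 1] isT t (conj Ut it).
have E s : U s -> dom i (c s) -> 'd (chart i \o c) s 1 = derive1 (chart i \o c) s.
  move=> Us is_; apply: esym; apply: derive1E'.
  by have [_ /(_ isT)] := Ci i [::] isT s (conj Us is_).
apply: (cvg_near_ext (E t Ut it) _ H).
by apply: filterS (C1_curve_near oU Cc Ut it) => s [Us is_]; exact: E.
Qed.

(** [velocity] is recorded in a chart that may jump with t. In a fixed chart the speed becomes an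
    expression whose continuity in t can be checked. *)
Lemma tnorm_velocity c t k : {for t, continuous c} -> dom k (c t) ->
  derivable (chart k \o c) t 1 ->
  tnorm g (velocity S c t) = qnorm (chart_gram g k (c t)) (derive1 (chart k \o c) t).
Proof.
move=> cc kt dk; have jt := dom_chart_at S (c t); set j := chart_at S (c t) in jt.
rewrite (tnormE g _ kt); congr qnorm.
have dT : differentiable (local_rep k j id) ((chart k \o c) t).
  exact: chart_differentiable_id.
have [d1 e1] := derive1_comp_diff dk dT.
have near_eq : \forall s \near t, (local_rep k j id \o (chart k \o c)) s = (chart j \o c) s.
  have : \forall s \near t, dom k (c s) by apply: cc; exact: dom_nbhs.
  by apply: filterS => s ks; rewrite /local_rep /= chartK.
have -> : velocity S c t = derive1 (chart k \o c) t *m transition k j (c t) :> 'rV[R]_d.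
  rewrite /velocity -/j derive1E -(near_eq_derive _ near_eq) -derive1E e1.
  by rewrite /transition chart_jacobianE; exact: esym (mul_jacobian _ _ _).
by rewrite -mulmxA transitionK // mulmx1.
Qed.

Lemma qnorm_continuous (T : topologicalType) (t : T) (G : T -> 'M[R]_d) (u : T -> 'rV[R]_d) :
  {for t, continuous G} -> {for t, continuous u} ->
  {for t, continuous (fun s => qnorm (G s) (u s))}.
Proof.
move=> Gc uc; have trc : (u s)^T @[s --> t] --> (u t)^T.
  apply: cvg_mx => i j; rewrite mxE.
  have := cvg_entry (i := j) (j := i) uc.
  by apply: cvg_near_ext => //; apply: near_all => z; rewrite mxE.
have qc : quad (G s) (u s) (u s) @[s --> t] --> quad (G t) (u t) (u t).
  exact: cvg_entry (cvg_mulmx (cvg_mulmx uc Gc) trc).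
exact: (cvg_comp _ _ qc (@sqrt_continuous R _)).
Qed.

Lemma speed_continuous U c t : open U -> C1_curve_on S U c -> U t ->
  {for t, continuous (fun s => tnorm g (velocity S c s))}.
Proof.
move=> oU Cc Ut; have kt := dom_chart_at S (c t); set k := chart_at S (c t) in kt.
have Gc : {for t, continuous (fun s => chart_gram g k (c s))}.
  apply: continuous_comp; first exact: Cc.1.
  exact: chart_gram_continuous.
have H := qnorm_continuous Gc (C1_curve_derive_continuous oU Cc Ut kt).
have E s : U s -> dom k (c s) -> qnorm (chart_gram g k (c s)) (derive1 (chart k \o c) s)
    = tnorm g (velocity S c s).
  move=> Us ks; apply: esym; apply: tnorm_velocity => //; first exact: Cc.1.
  exact: C1_curve_derivable Cc Us ks.
apply: (cvg_near_ext (E t Ut kt) _ H).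
by apply: filterS (C1_curve_near oU Cc Ut kt) => s [Us ks]; exact: E.
Qed.

Lemma velocity_near_eq c c' t : (\forall s \near t, c s = c' s) ->
  tnorm g (velocity S c t) = tnorm g (velocity S c' t).
Proof.
move=> cc'; have ct := nbhs_singleton cc'.
rewrite /velocity ct; congr tnorm; rewrite !derive1E.
by apply: near_eq_derive; apply: filterS cc' => s /= ->.
Qed.

Definition segment_curve k (a u : 'rV[R]_d) : R -> M := fun t => ichart k (a + t *: u).

Lemma segment_curve_C1 k a u :
  let U := (fun t : R => a + t *: u) @^-1` (chart k @` dom k) in
  open U /\ C1_curve_on S U (segment_curve k a u).
Proof.
move=> U; split.
  by apply: open_comp => [t _|]; [exact: affine_continuous|exact: chart_img_open].
split=> [t Ut|i].
  apply: continuous_comp; first exact: affine_continuous.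
  exact: ichart_continuous.
have oA : forall b, (chart k @` (dom k `&` dom i)) b -> nbhs b (chart k @` (dom k `&` dom i)).
  move=> _ [y [ky iy] <-].
  have n1 := chart_img_nbhs ky; have n2 := near_ichart ky (dom_nbhs iy).
  apply: filterS2 n1 n2 => b kb ib; exists (ichart k b); last exact: ichartK.
  by split=> //; exact: ichart_dom.
have H := @C_on_affine _ _ _ _ _ a u oA (@chart_id_C_on _ _ _ S 1 k i).
move=> vs szvs t [Ut it]; apply: (H vs szvs t).
exists (segment_curve k a u t); last exact: ichartK.
by split=> //; exact: ichart_dom.
Qed.

Lemma segment_curve_speed k a u t : (chart k @` dom k) (a + t *: u) ->
  tnorm g (velocity S (segment_curve k a u) t) =
  qnorm (chart_gram g k (segment_curve k a u t)) u.
Proof.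
move=> Ut; have [oU CU] := segment_curve_C1 k a u.
have kt : dom k (segment_curve k a u t) by exact: ichart_dom.
rewrite (tnorm_velocity (k := k)) //; last exact: (C1_curve_derivable CU Ut kt).
  congr qnorm; have [da ua] := affine_derive a u t.
  rewrite derive1E -[RHS]ua derive1E; apply: near_eq_derive.
  have := open_nbhs_nbhs (conj oU Ut); apply: filterS => s Us.
  by rewrite /segment_curve /= ichartK.
exact: CU.1.
Qed.

Definition curve_piece c (a b : R) : Prop := exists U c',
  [/\ open U, [set` `[a, b]] `<=` U, C1_curve_on S U c' & {in `[a, b], c =1 c'}].

(** In the form of a [path], subdivisions concatenate by [cat_path] and estimates go by induction on
    the list. *)
Lemma piecewise_C1P c : piecewise_C1 S c <-> exists s, itv_partition 0 1 s /\
  path (fun a b => `[< curve_piece c a b >]) 0 s.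
Proof.
split=> -[s [s01 H]]; exists s; split=> //.
  by apply/(pathP 0) => k ks; apply/asboolP; exact: H k ks.
move=> k ks; move/(pathP 0): H => /(_ k ks) /asboolP; exact.
Qed.

Lemma curve_piece_affine c c1 a b m q : 0 < m -> curve_piece c1 (q + a * m) (q + b * m) ->
  {in `[a, b], forall t, c t = c1 (q + t * m)} -> curve_piece c a b.
Proof.
move=> m0 [U [c' [oU sU [cc' Cc'] cE]]] H.
exists ((fun t : R => q + t *: (m : R)) @^-1` U), (c' \o (fun t : R => q + t *: (m : R))).
have itv t : t \in `[a, b] -> (q + t * m) \in `[q + a * m, q + b * m].
  by rewrite !in_itv /= !lerD2l !(ler_pM2r m0).
split.
- by apply: open_comp => // t _; exact: affine_continuous.
- by move=> t /= tab; apply: sU; exact: itv.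
- split=> [t Ut|i].
    by apply: continuous_comp; [exact: affine_continuous|exact: cc'].
  have oA : forall b, (U `&` c' @^-1` dom i) b -> nbhs b (U `&` c' @^-1` dom i).
    move=> y [Uy iy]; apply: filterI; first exact: open_nbhs_nbhs.
    by apply: (cc' y Uy); exact: dom_nbhs.
  exact: (@C_on_affine _ _ _ _ _ q (m : R) oA (Cc' i)).
- by move=> t tab; rewrite H //= cE //; exact: itv.
Qed.

Definition joined x y := exists c, [/\ piecewise_C1 S c, c 0 = x & c 1 = y].

Lemma path_lt_bounds (a : R) (s : seq R) : path <%R a s ->
  forall b, b \in a :: s -> a <= b <= last a s.
Proof.
elim: s a => [|x s IH] a /=; first by move=> _ b /[!inE] /eqP ->; rewrite lexx.
move=> /andP[ax /IH H] b; rewrite inE => /predU1P[->|/H /andP[xb bl]].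
  rewrite lexx /=; have /andP[_ xl] := H x (mem_head _ _).
  exact: le_trans (ltW ax) xl.
by rewrite bl andbT (le_trans (ltW ax)).
Qed.

(** Both curves are run at double speed; f1 and f2 carry their subdivisions to the two halves of the
    unit interval. *)
Lemma joined_trans x y z : joined x y -> joined y z -> joined x z.
Proof.
move=> [c1 [/piecewise_C1P[s1 [[p1 l1] q1]] c10 c11]].
move=> [c2 [/piecewise_C1P[s2 [[p2 l2] q2]] c20 c21]].
have half : (2^-1 : R) * 2 = 1 by rewrite mulVf // pnatr_eq0.
have half_ge0 : 0 <= (2^-1 : R) by rewrite invr_ge0 ler0n.
pose c t := if t <= 2^-1 then c1 (0 + t * 2) else c2 (-1 + t * 2).
pose f1 (t : R) := t / 2; pose f2 (t : R) := (t + 1) / 2.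
have f10 : f1 0 = 0 by rewrite /f1 mul0r.
have f11 : f1 1 = 2^-1 by rewrite /f1 mul1r.
have f20 : f2 0 = 2^-1 by rewrite /f2 add0r mul1r.
have f21 : f2 1 = 1 by rewrite /f2; field.
have e1 : last 0 (map f1 s1) = f2 0.
  by rewrite -[in X in last X _]f10 last_map (eqP l1) f11 f20.
exists c; split.
- apply/piecewise_C1P; exists (map f1 s1 ++ map f2 s2); split.
    split; last by rewrite last_cat e1 last_map (eqP l2) f21.
    rewrite cat_path e1 -{1}f10 !path_map; apply/andP; split.
      by apply: sub_path p1 => a b /= ab; rewrite ltr_pM2r.
    by apply: sub_path p2 => a b /= ab; rewrite ltr_pM2r // ltrD2r.
  rewrite cat_path e1 -{1}f10 !path_map; apply/andP; split.
    have B : all [pred t : R | t <= 1] (0 :: s1).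
      by apply/allP => b /(path_lt_bounds p1); rewrite (eqP l1) => /andP[].
    apply: (sub_in_path _ B q1) => a b /= _ b1 /asboolP ab; apply/asboolP.
    apply: (@curve_piece_affine c c1 _ _ 2 0) => // [|t].
      by rewrite !add0r /f1 -!mulrA !half !mulr1.
    rewrite in_itv /= => /andP[_ tb].
    by rewrite /c ifT // (le_trans tb) // /f1 ler_piMl.
  have B : all [pred t : R | 0 <= t] (0 :: s2).
    by apply/allP => b /(path_lt_bounds p2) /andP[].
  apply: (sub_in_path _ B q2) => a b /= a0 _ /asboolP ab; apply/asboolP.
  apply: (@curve_piece_affine c c2 _ _ 2 (-1)) => // [|t].
    by rewrite /f2 -!mulrA !half !mulr1 ![_ + 1]addrC !addKr.
  rewrite in_itv /= => /andP[ta _].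
  have t2 : 2^-1 <= t.
    by apply: le_trans ta; rewrite /f2 ler_peMl // lerDr.
  (* The midpoint is the only point of the second half where c is given by c1; there both curves
     pass through y. *)
  rewrite /c; case: ifP => // t2'.
  have -> : t = 2^-1 by apply/eqP; rewrite eq_le t2 t2'.
  by rewrite half add0r addNr c11 c20.
- by rewrite /c half_ge0 mul0r addr0.
- rewrite /c ifF; last by apply/negbTE; rewrite -ltNge invf_lt1 // ltr1n.
  by rewrite mul1r; have -> : -1 + 2 = 1 :> R by ring.
Qed.

End Curves.

(** * Increments and integrals over a subdivided interval *)

Section PieceEstimates.
Context {R : realType}.
Local Notation mu := (@lebesgue_measure R).

Lemma continuous_on_measurable (U D : set R) (f : R -> R) : open U -> D `<=` U ->
  (forall t, U t -> {for t, continuous f}) -> measurable_fun D f.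
Proof.
move=> oU DU fc; apply: (measurable_funS (E := U)) => //.
  exact: measurable_realfun.open_measurable.
apply: measurable_realfun.open_continuous_measurable_fun => //.
by move=> t /set_mem; exact: fc.
Qed.

(** The fundamental theorem of calculus on the closed interval. The integral of f is taken over the
    open one because the speed of a piecewise curve is that of its C^1 extension only inside a
    piece. *)
Lemma piece_estimate (U : set R) (a b K : R) (f w : R -> R) : open U -> a < b ->
  [set` `[a, b]] `<=` U -> 0 <= K -> (forall t, 0 <= f t) ->
  (forall t, U t -> {for t, continuous f}) ->
  (forall t, U t -> derivable w t 1) ->
  (forall t, U t -> {for t, continuous (derive1 w)}) ->
  (forall t, U t -> `|derive1 w t| <= K * f t) ->
  (`|w b - w a|%:E <= K%:E * \int[mu]_(t in `]a, b[) (f t)%:E)%E.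
Proof.
move=> oU ab abU K0 f0 fc dw cw wf.
have mf : measurable_fun `[a, b] f by exact: continuous_on_measurable fc.
have mw : measurable_fun `[a, b] (derive1 w) by exact: continuous_on_measurable cw.
have wcont t : U t -> {for t, continuous w}.
  by move=> Ut; apply: differentiable_continuous; apply/derivable1_diffP; exact: dw.
have itvU t : t \in `[a, b] -> U t by move=> tab; exact: abU.
have Ua : U a by apply: itvU; rewrite in_itv /= lexx ltW.
have Ub : U b by apply: itvU; rewrite in_itv /= lexx ltW.
have FTC : (\int[mu]_(t in `[a, b]) (derive1 w t)%:E)%E = ((w b)%:E - (w a)%:E)%E.
  apply: continuous_FTC2 => //.
    by apply: continuous_in_subspaceT => t /set_mem /itvU; exact: cw.
  split=> [t tab||].
  - by apply/dw/itvU; exact: subset_itv_oo_cc tab.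
  - by apply: cvg_at_right_filter; exact: wcont.
  - by apply: cvg_at_left_filter; exact: wcont.
have -> : (`|w b - w a|%:E = `| \int[mu]_(t in `[a, b]) (derive1 w t)%:E |)%E.
  by rewrite FTC.
have mitv : measurable [set` `[a, b]] by exact: measurable_itv.
have mwE := (measurable_realfun.measurable_EFinP _ _).2 mw.
apply: (le_trans (le_abse_integral mu mitv mwE)).
have m1 : measurable_fun `]a, b[ f.
  by apply: (measurable_funS mitv) mf; exact: subset_itv_oo_cc.
have m1E := (measurable_realfun.measurable_EFinP _ _).2 m1.
have mfE := (measurable_realfun.measurable_EFinP _ _).2 mf.
rewrite -(integral_itv_bndoo true false m1E) -ge0_integralZl_EFin //; last first.
  by move=> t _; rewrite lee_fin.
apply: ge0_le_integral => //.
- have H : measurable_fun `[a, b] (fun t => `|derive1 w t|).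
    apply: (continuous_on_measurable oU abU) => t Ut.
    exact: (cvg_comp _ _ (cw t Ut) (@norm_continuous _ R _)).
  exact: (measurable_realfun.measurable_EFinP _ _).2 H.
- have H : measurable_fun `[a, b] (fun t => K * f t).
    apply: (continuous_on_measurable oU abU) => t Ut.
    by apply: cvgM; [exact: cvg_cst|exact: fc].
  exact: (measurable_realfun.measurable_EFinP _ _).2 H.
- by move=> t tab; rewrite /= -EFinM lee_fin; apply: wf; exact: itvU.
Qed.

Definition dominated_piece (K : R) (f w : R -> R) (a b : R) : Prop :=
  exists (U : set R) (g v : R -> R), [/\ open U, [set` `[a, b]] `<=` U,
    [/\ forall t, 0 <= g t, forall t : R, U t -> {for t, continuous g},
        forall t : R, U t -> derivable v t 1,
        forall t : R, U t -> {for t, continuous (derive1 v)} &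
        forall t : R, U t -> `|derive1 v t| <= K * g t],
    {in `]a, b[, f =1 g} & {in `[a, b], w =1 v}].

(* The bound B makes the integral of f finite, so that taking its [fine] part
   (as in [curve_length]) does not produce a junk value. *)
Lemma partition_estimate (K : R) (f w : R -> R) (a : R) (s : seq R) :
  0 <= K -> (forall t, 0 <= f t) -> path <%R a s ->
  path (fun a b => `[< dominated_piece K f w a b >]) a s ->
  [/\ measurable_fun `]a, (last a s)[ f,
     (`|w (last a s) - w a|%:E <= K%:E * \int[mu]_(t in `]a, (last a s)[) (f t)%:E)%E &
     exists B, forall t, t \in `[a, last a s] -> f t <= B].
Proof.
move=> K0 f0; elim: s a => [|b s IH] a /=.
  move=> _ _; rewrite set_itvoo0; split.
  - exact: measurable_fun_set0.
  - by rewrite subrr normr0 mule_ge0 ?lee_fin // integral_set0.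
  - by exists (f a) => t; rewrite in_itv /= => /le_anti ->.
move=> /andP[ab bs] /andP[/asboolP[U [g [v [oU abU [g0 gc dv cv vg] fg wv]]]] H].
have [mbs ebs [B HB]] := IH b bs H.
have bl : b <= last b s by have /andP[] := path_lt_bounds bs (mem_last b s).
have mab : measurable_fun `]a, b[ f.
  apply: (@eq_measurable_fun _ _ _ _ _ g) => [t /set_mem tab|].
    by rewrite fg.
  by apply: continuous_on_measurable gc => // t tab; apply: abU; exact: subset_itv_oo_cc tab.
have eab := piece_estimate oU ab abU K0 g0 gc dv cv vg.
have Bg : exists B, forall t, t \in `[a, b] -> g t <= B.
  have cg : {within `[a, b], continuous g}.
    by apply: continuous_in_subspaceT => t /set_mem tab; exact: gc (abU _ tab).
  have [t0 _ Ht0] := EVT_max (ltW ab) cg.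
  by exists (g t0).
have [B' HB'] := Bg.
have ab' : a \in `[a, b] by rewrite in_itv /= lexx ltW.
have bb' : b \in `[a, b] by rewrite in_itv /= lexx ltW.
(* The node b must be included for measurability on the whole interval; in the comparison of
   integrals it is simply dropped. *)
have setE : [set` `]a, (last b s)[] `<=` ([set` `]a, b[] `|` [set b]) `|` [set` `]b, (last b s)[].
  move=> t; rewrite /= !in_itv /= => /andP[at_ tl].
  have [tb|bt|->] := ltgtP t b.
  - by left; left; rewrite at_.
  - by right; rewrite tl.
  - by left; right.
have mU : measurable_fun (([set` `]a, b[] `|` [set b]) `|` [set` `]b, (last b s)[]) f.
  apply/measurable_funU; [by apply: measurableU; [exact: measurable_itv|exact: measurable_set1]
    |exact: measurable_itv|].
  split=> //; apply/measurable_funU => //.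
  by split=> //; exact: measurable_fun_set1.
have mtot : measurable_fun `]a, (last b s)[ f.
  apply: (measurable_funS _ setE mU).
  by apply: measurableU => //; apply: measurableU.
split=> //.
- have mab' : measurable [set` `]a, b[] by exact: measurable_itv.
  have mbl' : measurable [set` `]b, (last b s)[] by exact: measurable_itv.
  have mal' : measurable [set` `]a, (last b s)[] by exact: measurable_itv.
  have fE0 t : (0 <= (f t)%:E)%E by rewrite lee_fin.
  have sub : [set` `]a, b[] `|` [set` `]b, (last b s)[] `<=` [set` `]a, (last b s)[].
    move=> t [] /=; rewrite !in_itv /= => /andP[t1 t2].
      by rewrite t1 (lt_le_trans t2).
    by rewrite t2 (lt_trans ab).
  have mtotE := (measurable_realfun.measurable_EFinP _ _).2 mtot.
  have le1 := ge0_subset_integral mu (measurableU _ _ mab' mbl') mal' mtotE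
    (fun t _ => fE0 t) sub.
  apply: (le_trans _ (lee_wpmul2l _ le1)); last by rewrite lee_fin.
  rewrite ge0_integral_setU //; first last.
  - apply/disj_set2P; apply/seteqP; split=> // t [] /=.
    by rewrite !in_itv /= => /andP[_ t1] /andP[t2 _]; have := lt_trans t1 t2; rewrite ltxx.
  - by move=> t _; exact: fE0.
  - by apply: measurable_funS mtotE.
  rewrite ge0_muleDr; [|by apply: integral_ge0 => t _; exact: fE0..].
  have eab' : (`|w b - w a|%:E <= K%:E * \int[mu]_(t in `]a, b[) (f t)%:E)%E.
    rewrite !wv //; apply: (le_trans eab); rewrite le_eqVlt; apply/orP; left.
    apply/eqP; congr (_ * _)%E; apply: eq_integral => t /set_mem tab.
    by rewrite fg.
  apply: (le_trans _ (leeD eab' ebs)); rewrite -EFinD lee_fin.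
  have -> : w (last b s) - w a = (w b - w a) + (w (last b s) - w b) by ring.
  exact: ler_normD.
(* At the nodes f is unrelated to the extension g, so its values there enter the bound
   separately. *)
- exists (Num.max (Num.max (f a) (f b)) (Num.max B' B)) => t.
  rewrite in_itv /= => /andP[at_ tl].
  have [tb|bt] := leP t b; last first.
    by rewrite !le_max HB ?orbT // in_itv /= tl ltW.
  have [->|ta] := eqVneq t a; first by rewrite !le_max lexx.
  have [->|tb'] := eqVneq t b; first by rewrite !le_max lexx orbT.
  have tab : t \in `]a, b[ by rewrite in_itv /= !lt_neqAle eq_sym ta at_ tb' tb.
  by rewrite !le_max fg // HB' ?orbT //; exact: subset_itv_oo_cc tab.
Qed.

Lemma is_derive_quadratic (f : R -> R) (x D : R) :
  (forall h, `|f (x + h) - f x - h * D| <= h ^+ 2) -> is_derive x 1 f D.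
Proof.
move=> H.
have cv : (fun h => h^-1 *: (f (h *: 1 + x) - f x)) h @[h --> 0^'] --> D.
  apply/cvgrPdist_le => e e0; near=> h.
  have h0 : h != 0 by near: h; exact: nbhs_dnbhs_neq.
  have hx : h *: (1 : R) + x = x + h.
    by rewrite addrC; congr (_ + _); exact: mulr1.
  rewrite hx distrC.
  have -> : h^-1 *: (f (x + h) - f x) - D = h^-1 * (f (x + h) - f x - h * D).
    by rewrite mulrBr mulrA mulVf // mul1r.
  rewrite normrM normfV ler_pdivrMl ?normr_gt0 //.
  apply: (le_trans (H h)); rewrite -real_normK ?num_real // expr2 ler_wpM2l //.
  near: h; apply: dnbhs0_le => //.
by apply: DeriveDef; [apply/cvg_ex; exists D|exact: cvg_lim].
Unshelve. all: by end_near. Qed.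

(* Squaring the positive part makes it C^1 across 0. *)
Definition possq (x : R) : R := (Num.max 0 x) ^+ 2.

Lemma is_derive_possq (x : R) : is_derive x 1 possq (2 * Num.max 0 x).
Proof.
apply: is_derive_quadratic => h; rewrite /possq.
have [x0|x0] := leP 0 x; have [xh|xh] := leP 0 (x + h).
- have -> : (x + h) ^+ 2 - x ^+ 2 - h * (2 * x) = h ^+ 2 by ring.
  by rewrite ger0_norm // sqr_ge0.
- have -> : 0 ^+ 2 - x ^+ 2 - h * (2 * x) = - (x ^+ 2 + 2 * h * x) by ring.
  by rewrite normrN ler_norml; nra.
- have -> : (x + h) ^+ 2 - 0 ^+ 2 - h * (2 * 0) = (x + h) ^+ 2 by ring.
  by rewrite ger0_norm ?sqr_ge0 //; nra.
- have -> : 0 ^+ 2 - 0 ^+ 2 - h * (2 * 0) = 0 :> R by ring.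
  by rewrite normr0 sqr_ge0.
Qed.

End PieceEstimates.

Lemma cvg_sum_ord (R : realType) (T : topologicalType) (t0 : T) n
    (f : 'I_n -> T -> R) (l : 'I_n -> R) :
  (forall i, f i t @[t --> t0] --> l i) ->
  \sum_i f i t @[t --> t0] --> \sum_i l i.
Proof.
move=> fl; apply: cvg_big => [|i _]; last exact: fl.
exact: add_continuous.
Qed.

(** * A bump function and its variation along curves *)

Section Bump.
Context {R : realType} {d : nat} {M : topologicalType}.
Variables (S : smooth_manifold R d M) (g : riemannian_metric S).
Variable r : M -> R.
Hypothesis r_gt0 : forall p, 0 < r p.
Hypothesis r_img : forall p a,
  `|a - chart (chart_at S p) p| <= 3 * r p ->
  (chart (chart_at S p) @` dom (chart_at S p)) a.
Variables (p : M) (e : R).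
Hypothesis e_gt0 : 0 < e.
Hypothesis e_le : e <= r p.

Local Notation k := (chart_at S p).
Local Notation core := (core S r).

(** Euclidean, unlike the maximum norm used elsewhere, because it has to be differentiated. *)
Definition sqdist (a b : 'rV[R]_d) : R := \sum_i (a 0 i - b 0 i) ^+ 2.

Definition bump_arg (z : M) : R := e ^+ 2 - sqdist (chart k z) (chart k p).

(** Outside its domain the chart has no meaning, hence the test. The positive values occur in a
    chart ball of radius e <= r p, well inside the chart, so the extension by 0 is C^1 along C^1
    curves. *)
Definition bump (z : M) : R :=
  if `[< dom k z >] then possq (bump_arg z) else 0.

Lemma bump_arg_entry z i : 0 < bump_arg z ->
  `|chart k z 0 i - chart k p 0 i| <= e.
Proof.
rewrite subr_gt0 => H.
rewrite -(ler_pXn2r (n := 2)) ?nnegrE ?normr_ge0 ?(ltW e_gt0) //.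
rewrite real_normK ?num_real //; apply: le_trans (ltW H).
rewrite /sqdist (bigD1 i) //= lerDl; apply: sumr_ge0 => j _; exact: sqr_ge0.
Qed.

Lemma bump_arg_norm z : 0 < bump_arg z -> `|chart k z - chart k p| <= e.
Proof.
move=> H; apply: mx_norm_le => [|i j]; first exact: ltW.
by rewrite ord1 !mxE; exact: bump_arg_entry.
Qed.

Lemma bump_support z : bump z != 0 -> dom k z /\ `|chart k z - chart k p| <= e.
Proof.
rewrite /bump; case: asboolP => [kz|_]; last by rewrite eqxx.
move=> H; split=> //; apply: bump_arg_norm.
rewrite ltNge; apply: contraNN H => H.
by rewrite /possq max_l // expr0n.
Qed.

Lemma bump_center : bump p = e ^+ 4.
Proof.
rewrite /bump; case: asboolP => [_|[]]; last exact: dom_chart_at.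
have -> : bump_arg p = e ^+ 2.
  by rewrite /bump_arg /sqdist big1 ?subr0 // => i _; rewrite subrr expr0n.
by rewrite /possq max_r ?sqr_ge0 // -exprM; exact: erefl.
Qed.

Lemma bump_arg_out z : dom k z -> ~ core p 1 z -> bump_arg z <= 0.
Proof.
move=> kz nz; rewrite leNgt; apply/negP => /bump_arg_norm ze; apply: nz.
by split=> //; rewrite mul1r (le_trans ze).
Qed.

Lemma bump_continuous_center : {for p, continuous bump}.
Proof.
have kp := dom_chart_at S p.
have H : possq (bump_arg z) @[z --> p] --> possq (bump_arg p).
  have cs : possq \o bump_arg @ p --> (possq \o bump_arg) p.
    apply: continuous_comp; last first.
      apply: differentiable_continuous; apply/derivable1_diffP.
      by have [] := is_derive_possq (bump_arg p).
    apply: cvgB; first exact: cvg_cst.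
    apply: cvg_sum_ord => i.
    have c1 : chart k z 0 i - chart k p 0 i @[z --> p] --> chart k p 0 i - chart k p 0 i.
      apply: cvgB; last exact: cvg_cst.
      exact: cvg_entry (chart_continuous kp).
    exact: (cvgM c1 c1).
  exact: cs.
apply: (cvg_near_ext _ _ H); rewrite /bump.
  by case: asboolP.
by apply: filterS (dom_nbhs kp) => z kz; case: asboolP.
Qed.

Variables (U : set R) (c : R -> M).
Hypothesis U_open : open U.
Hypothesis c_C1 : C1_curve_on S U c.

Let v (t : R) : 'rV[R]_d := derive1 (chart k \o c) t.

Definition bump_slope (t : R) : R := 2 * Num.max 0 (bump_arg (c t)) *
  (- \sum_i 2 * (chart k (c t) 0 i - chart k p 0 i) * v t 0 i).

Lemma is_derive_bump_arg t : U t -> dom k (c t) ->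
  is_derive t 1 (bump_arg \o c) (- \sum_i 2 * (chart k (c t) 0 i - chart k p 0 i) * v t 0 i).
Proof.
move=> Ut kt; have dc := C1_curve_derivable c_C1 Ut kt.
have H i : is_derive t 1 (fun s => (chart k (c s) 0 i - chart k p 0 i) ^+ 2)
    (2 * (chart k (c t) 0 i - chart k p 0 i) * v t 0 i).
  have h1 := derivable_entry (0 : 'I_1) i dc.
  have h2 := is_deriveB h1 (is_derive_cst (chart k p 0 i) t 1).
  have h3 := is_deriveX 2 h2.
  apply: (near_eq_is_derive (f := ((fun s => (chart k \o c) s 0 i) - cst (chart k p 0 i)) ^+ 2)).
    by apply: near_all => s /=; rewrite !fctE.
  apply: (is_derive_eq h3).
  by rewrite /v /GRing.scale /= !fctE subr0 expr1; ring.
have hs := is_derive_sum H.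
have hd := is_deriveB (is_derive_cst (e ^+ 2) t 1) hs.
apply: (near_eq_is_derive
  (f := cst (e ^+ 2) - \sum_i (fun s => (chart k (c s) 0 i - chart k p 0 i) ^+ 2))).
  by apply: near_all => s; rewrite /bump_arg /sqdist /= fctE fct_sumE.
by apply: (is_derive_eq hd); rewrite sub0r.
Qed.

Lemma bump_slope_out s : dom k (c s) -> ~ core p 1 (c s) -> bump_slope s = 0.
Proof.
by move=> ks ns; rewrite /bump_slope max_l ?bump_arg_out // mulr0 mul0r.
Qed.

Lemma bump_out z : ~ core p 1 z -> bump z = 0.
Proof.
move=> nz; rewrite /bump; case: asboolP => // kz.
by rewrite /possq max_l ?bump_arg_out // expr0n.
Qed.

(** The core is closed in M, so staying outside it is an open condition. This covers the times at
    which the curve is outside the chart domain, where no coordinates are available. *)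
Lemma near_out t : U t -> ~ core p 1 (c t) -> \forall s \near t, U s /\ ~ core p 1 (c s).
Proof.
move=> Ut nt; apply: filterI; first exact: open_nbhs_nbhs.
have oC : open (~` core p 1) by apply: closed_openC; apply: core_closed => //; lra.
exact: (c_C1.1 t Ut _ (open_nbhs_nbhs (conj oC nt))).
Qed.

Lemma is_derive_bump t : U t -> is_derive t 1 (bump \o c)
  (if `[< dom k (c t) >] then bump_slope t else 0).
Proof.
move=> Ut; case: asboolP => [kt|nt].
  apply: (near_eq_is_derive (f := possq \o (bump_arg \o c))).
    apply: filterS (C1_curve_near U_open c_C1 Ut kt) => s [_ ks].
    by rewrite /bump /=; case: asboolP.
  exact: is_derive1_comp (is_derive_possq _) (is_derive_bump_arg Ut kt).
have h0 := is_derive_cst (0 : R) t 1.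
apply: (near_eq_is_derive _ h0).
have nc : ~ core p 1 (c t) by case.
by apply: filterS (near_out Ut nc) => s [_ ns]; rewrite /= bump_out.
Qed.

Lemma derive1_bumpE t : U t ->
  derive1 (bump \o c) t = if `[< dom k (c t) >] then bump_slope t else 0.
Proof. by move=> Ut; rewrite derive1E; have [] := is_derive_bump Ut. Qed.

Lemma bump_slope_continuous t : U t ->
  {for t, continuous (derive1 (bump \o c))}.
Proof.
move=> Ut; have [kt|nt] := pselect (dom k (c t)); last first.
  have nc : ~ core p 1 (c t) by case.
  have E s : U s -> ~ core p 1 (c s) -> 0 = derive1 (bump \o c) s.
    by move=> Us ns; rewrite derive1_bumpE //; case: asboolP => // ks; rewrite bump_slope_out.
  apply: (cvg_near_ext (f := fun=> 0) (E t Ut nc) _ (@cvg_cst _ (0 : R) _ (nbhs t) _)).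
  by apply: filterS (near_out Ut nc) => s [Us ns]; exact: E.
have vc := C1_curve_derive_continuous U_open c_C1 Ut kt.
have xc i : chart k (c s) 0 i - chart k p 0 i @[s --> t] --> chart k (c t) 0 i - chart k p 0 i.
  apply: cvgB; last exact: cvg_cst.
  apply: (cvg_entry (f := fun s => chart k (c s))).
  by apply: continuous_comp; [exact: c_C1.1|exact: chart_continuous].
have ac : bump_arg (c s) @[s --> t] --> bump_arg (c t).
  apply: cvgB; first exact: cvg_cst.
  by apply: cvg_sum_ord => i; exact: (cvgM (xc i) (xc i)).
have mc : 2 * Num.max 0 (bump_arg (c s)) @[s --> t] --> 2 * Num.max 0 (bump_arg (c t)).
  apply: cvgM; first exact: cvg_cst.
  exact: (@continuous_max _ _ (cst 0) (bump_arg \o c) t (@cvg_cst _ _ _ _ _) ac).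
have sc : - \sum_i 2 * (chart k (c s) 0 i - chart k p 0 i) * v s 0 i @[s --> t] -->
    - \sum_i 2 * (chart k (c t) 0 i - chart k p 0 i) * v t 0 i.
  apply: cvgN; apply: cvg_sum_ord => i; apply: cvgM; last exact: cvg_entry vc.
  by apply: cvgM; first exact: cvg_cst.
have E s : U s -> dom k (c s) -> bump_slope s = derive1 (bump \o c) s.
  by move=> Us ks; rewrite derive1_bumpE //; case: asboolP.
apply: (cvg_near_ext (E t Ut kt) _ (cvgM mc sc)).
by apply: filterS (C1_curve_near U_open c_C1 Ut kt) => s [Us ks]; exact: E.
Qed.

(** The constant is the product of [2 * e ^+ 2] from the square of the positive part,
    [d%:R * (2 * e)] from the gradient of the squared distance, and C from coordinate norm to
    speed. *)
Lemma bump_slope_bound C t : U t -> 0 <= C ->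
  (forall x, core p 2 x -> forall u : 'rV[R]_d, `|u| <= C * qnorm (chart_gram g k x) u) ->
  `|derive1 (bump \o c) t| <= 4 * d%:R * e ^+ 3 * C * tnorm g (velocity S c t).
Proof.
move=> Ut C0 HC; have e0 := ltW e_gt0.
have rhs0 : 0 <= 4 * d%:R * e ^+ 3 * C * tnorm g (velocity S c t).
  by rewrite !mulr_ge0 ?exprn_ge0 ?sqrtr_ge0.
rewrite derive1_bumpE //; case: asboolP => [kt|_]; last by rewrite normr0.
have [a0|a0] := leP (bump_arg (c t)) 0.
  by rewrite /bump_slope max_l // mulr0 mul0r normr0.
have c2 : core p 2 (c t).
  split=> //; apply: (le_trans (bump_arg_norm a0)); apply: (le_trans e_le).
  by rewrite ler_peMl ?(ltW (r_gt0 p)) // ler1n.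
have vE : `|v t| <= C * tnorm g (velocity S c t).
  have -> : tnorm g (velocity S c t) = qnorm (chart_gram g k (c t)) (v t).
    exact: (tnorm_velocity g (c_C1.1 t Ut) kt (C1_curve_derivable c_C1 Ut kt)).
  exact: HC.
have aE : bump_arg (c t) <= e ^+ 2.
  by rewrite gerBl; apply: sumr_ge0 => i _; exact: sqr_ge0.
have sE : `|\sum_i 2 * (chart k (c t) 0 i - chart k p 0 i) * v t 0 i| <= d%:R * (2 * e * `|v t|).
  apply: (le_trans (ler_norm_sum _ _ _)).
  apply: (@le_trans _ _ (\sum_(i < d) 2 * e * `|v t|)); last first.
    by rewrite sumr_const card_ord [leRHS]mulr_natl.
  apply: ler_sum => i _; rewrite !normrM (ger0_norm (ler0n R 2)).
  apply: ler_pM; [by rewrite mulr_ge0|by []| |exact: le_mx_entry].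
  by apply: ler_wpM2l => //; exact: bump_arg_entry.
rewrite /bump_slope max_r ?(ltW a0) // normrM normrN normrM (ger0_norm (ler0n R 2)).
rewrite (ger0_norm (ltW a0)).
have -> : 4 * d%:R * e ^+ 3 * C * tnorm g (velocity S c t) =
  2 * e ^+ 2 * (d%:R * (2 * e * (C * tnorm g (velocity S c t)))) by ring.
apply: ler_pM => //; first by rewrite mulr_ge0 ?(ltW a0).
  by apply: ler_wpM2l.
apply: (le_trans sE); apply: ler_wpM2l => //; apply: ler_wpM2l => //.
by rewrite mulr_ge0.
Qed.

End Bump.

Section CurveLength.
Context {R : realType} {d : nat} {M : topologicalType}.
Variables (S : smooth_manifold R d M) (g : riemannian_metric S).
Variable r : M -> R.
Hypothesis r_gt0 : forall p, 0 < r p.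
Hypothesis r_img : forall p a,
  `|a - chart (chart_at S p) p| <= 3 * r p ->
  (chart (chart_at S p) @` dom (chart_at S p)) a.

Lemma itv_partition_lt (s : seq R) : itv_partition 0 1 s -> path <%R 0 s /\ last 0 s = 1.
Proof. by move=> [s1 /eqP s2]. Qed.

(** Bounds lengths from below: a curve that changes the value of the bump cannot be short. *)
Lemma bump_length (p : M) (e C : R) (c : R -> M) : 0 < e -> e <= r p -> 0 <= C ->
  (forall x, core S r p 2 x -> forall u : 'rV[R]_d,
     `|u| <= C * qnorm (chart_gram g (chart_at S p) x) u) ->
  piecewise_C1 S c ->
  `|bump S p e (c 1) - bump S p e (c 0)| <= 4 * d%:R * e ^+ 3 * C * curve_length g c.
Proof.
move=> e0 er C0 HC /piecewise_C1P[s [/itv_partition_lt[s1 s2] H]].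
set K := 4 * d%:R * e ^+ 3 * C.
have K0 : 0 <= K by rewrite !mulr_ge0 ?exprn_ge0 ?(ltW e0).
pose f t := tnorm g (velocity S c t).
have f0 t : 0 <= f t by exact: sqrtr_ge0.
have P : path (fun a b => `[< dominated_piece K f (bump S p e \o c) a b >]) 0 s.
  apply: sub_path H => a b /asboolP[U [c' [oU abU Cc' cc']]]; apply/asboolP.
  exists U, (fun t => tnorm g (velocity S c' t)), (bump S p e \o c'); split.
  - exact: oU.
  - exact: abU.
  - split.
    + by move=> t; exact: sqrtr_ge0.
    + by move=> t Ut; exact: (@speed_continuous _ _ _ _ g U c' t oU Cc' Ut).
    + by move=> t Ut; have [] := is_derive_bump r_gt0 r_img e0 er oU Cc' Ut.
    + move=> t Ut.
      exact: (@bump_slope_continuous _ _ _ _ _ r_gt0 r_img p e e0 er U c' oU Cc' t Ut).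
    + by move=> t Ut; exact: (bump_slope_bound r_gt0 r_img e0 er oU Cc' Ut C0 HC).
  - move=> t tab; apply: velocity_near_eq.
    have : \forall z \near t, z \in `]a, b[ by exact: near_in_itvoo.
    by apply: filterS => z zab; apply: cc'; exact: subset_itv_oo_cc zab.
  - by move=> t tab; rewrite /= cc'.
have [] := partition_estimate K0 f0 s1 P; rewrite s2 => mf ef [B HB].
have mfE := (measurable_realfun.measurable_EFinP _ _).2 mf.
have int_fin : ((\int[lebesgue_measure]_(t in `]0%R, 1%R[) (f t)%:E)%E \is a fin_num).
  rewrite ge0_fin_numE; last by apply: integral_ge0 => t _; rewrite lee_fin.
  apply: (@le_lt_trans _ _ (\int[lebesgue_measure]_(t in `]0%R, 1%R[) (cst B%:E t))%E).
    apply: ge0_le_integral => //.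
    - by move=> t t01; rewrite lee_fin (le_trans (f0 t)) // HB //; exact: subset_itv_oo_cc t01.
    - by move=> t t01; rewrite lee_fin HB //; exact: subset_itv_oo_cc t01.
  rewrite integral_cst //; have := lebesgue_measure_itv (`]0, 1[ : interval R).
  by rewrite /= lte_fin ltr01 => ->; rewrite -EFinD -EFinM; exact: ltry.
have E : (\int[lebesgue_measure]_(t in `]0%R, 1%R[) (f t)%:E)%E = (curve_length g c)%:E.
  have Eb := integral_itv_bndoo true false mfE.
  by rewrite /curve_length /Rintegral fineK; rewrite Eb.
by rewrite E -EFinM lee_fin in ef.
Qed.

Lemma curve_length_ge0 (c : R -> M) : 0 <= curve_length g c.
Proof. by apply: Rintegral_ge0 => t _; exact: sqrtr_ge0. Qed.

End CurveLength.

(** * The topology of the Riemannian distance *)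

Section DistanceTopology.
Context {R : realType} {d : nat} {M : topologicalType}.
Variables (S : smooth_manifold R d M) (g : riemannian_metric S).
Hypothesis M_compact : compact [set: M].
Hypothesis M_connected : connected [set: M].
Variables (r : M -> R) (s : seq M).
Hypothesis r_gt0 : forall p, 0 < r p.
Hypothesis r_img : forall p a,
  `|a - chart (chart_at S p) p| <= 3 * r p ->
  (chart (chart_at S p) @` dom (chart_at S p)) a.
Hypothesis s_cover : forall x, exists2 p, p \in s & core S r p 1 x.

Local Notation ch p := (chart_at S p).
Local Notation core := (core S r).
Local Notation mu := (@lebesgue_measure R).

Lemma core_nbhs p x : core p 1 x -> nbhs x (core p 2).
Proof.
move=> [px xr]; have n1 := dom_nbhs px.
have /cvg_at_dist/(_ _ (r_gt0 p)) n2 := chart_continuous px.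
apply: filterS2 n1 n2 => z pz zx; split=> //.
have -> : chart (ch p) z - chart (ch p) p =
  (chart (ch p) z - chart (ch p) x) + (chart (ch p) x - chart (ch p) p) by rewrite subrKA.
rewrite (le_trans (ler_normD _ _)) // mulrDl !mul1r lerD //; last by rewrite -[r p]mul1r.
by rewrite distrC ltW.
Qed.

(** Coordinate balls are convex, so the straight segment stays in the core, where the speed is at
    most C times the coordinate norm. *)
Lemma core_segment p (C : R) (x y : M) :
  (forall z, core p 2 z -> forall u : 'rV[R]_d,
     qnorm (chart_gram g (ch p) z) u <= C * `|u|) ->
  core p 2 x -> core p 2 y ->
  exists c, [/\ piecewise_C1 S c, c 0 = x, c 1 = y &
    curve_length g c <= C * `|chart (ch p) y - chart (ch p) x|].
Proof.
move=> HC [px xr] [py yr]; set a := chart (ch p) x; set u := chart (ch p) y - a.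
have seg t : 0 <= t <= 1 -> core p 2 (segment_curve (ch p) a u t) /\
    (chart (ch p) @` dom (ch p)) (a + t *: u).
  move=> /andP[t0 t1].
  have B : `|a + t *: u - chart (ch p) p| <= 2 * r p.
    have -> : a + t *: u - chart (ch p) p =
        (1 - t) *: (a - chart (ch p) p) + t *: (chart (ch p) y - chart (ch p) p).
      by apply/rowP => i; rewrite /u !mxE; ring.
    apply: (le_trans (ler_normD _ _)); rewrite !normrZ.
    have -> : 2 * r p = (1 - t) * (2 * r p) + t * (2 * r p) by ring.
    by rewrite !ger0_norm ?subr_ge0 // lerD // ler_wpM2l ?subr_ge0.
  have I : (chart (ch p) @` dom (ch p)) (a + t *: u).
    by apply: r_img; apply: (le_trans B); rewrite ler_wpM2r ?ltW //; lra.
  split=> //; split; first exact: ichart_dom.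
  by rewrite ichartK.
have [oU CU] := segment_curve_C1 (ch p) a u.
set U := _ @^-1` _ in oU CU; set c := segment_curve (ch p) a u.
have IU : [set` `[0, 1]] `<=` U.
  by move=> t /=; rewrite in_itv /= => /seg[].
have pc : piecewise_C1 S c.
  apply/piecewise_C1P; exists [:: 1]; split.
    by split; rewrite /= ?ltr01.
  by rewrite /= andbT; apply/asboolP; exists U, c.
exists c; split=> //.
- by rewrite /c /segment_curve scale0r addr0 chartK.
- by rewrite /c /segment_curve scale1r addrC subrK chartK.
pose f t := tnorm g (velocity S c t).
have f0 t : 0 <= f t by exact: sqrtr_ge0.
have mf : measurable_fun [set` `[0 : R, 1]] f.
  apply: (continuous_on_measurable oU IU) => t Ut.
  exact: (@speed_continuous _ _ _ _ g U c t oU CU Ut).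
have mfE := (measurable_realfun.measurable_EFinP _ _).2 mf.
have fC t : t \in `[0, 1] -> f t <= C * `|u|.
  rewrite in_itv /= => t01; have [ct It] := seg t t01.
  by rewrite /f segment_curve_speed //; exact: HC.
have le1 : (\int[mu]_(t in `[0%R, 1%R]) (f t)%:E <= (C * `|u|)%:E)%E.
  apply: (@le_trans _ _ (\int[mu]_(t in `[0%R, 1%R]) (cst (C * `|u|)%:E t))%E).
    apply: ge0_le_integral => //.
    by move=> t _; rewrite lee_fin.
  rewrite integral_cst //; have := lebesgue_measure_itv (`[0, 1] : interval R).
  by rewrite /= lte_fin ltr01 => ->; rewrite -EFinD -EFinM subr0 mulr1.
have fin : (\int[mu]_(t in `[0%R, 1%R]) (f t)%:E)%E \is a fin_num.
  rewrite ge0_fin_numE; last by apply: integral_ge0 => t _; rewrite lee_fin.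
  by apply: (le_lt_trans le1); exact: ltry.
by rewrite -lee_fin /curve_length /Rintegral fineK.
Qed.

Lemma core_qnorm_bound p : exists2 C : R, 0 <= C & forall z, core p 2 z ->
  forall u : 'rV[R]_d, qnorm (chart_gram g (ch p) z) u <= C * `|u|.
Proof.
have c2 : 0 < (2 : R) <= 3 by lra.
have [B [_ HB]] := compact_bound (core_compact r_gt0 r_img (p := p) c2)
  (f := chart_gram g (ch p)) (fun z pz => @chart_gram_continuous _ _ _ _ g (ch p) z pz.1).
have HB1 z : core p 2 z -> `|chart_gram g (ch p) z| <= B + 1 by apply: HB; rewrite ltrDl.
exists (Num.sqrt (d%:R ^+ 2 * (B + 1))); first exact: sqrtr_ge0.
move=> z pz u; apply: (le_trans (qnorm_bound _ _)); apply: ler_wpM2r => //.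
by apply: ler_wsqrtr; apply: ler_wpM2l; [exact: sqr_ge0|exact: HB1].
Qed.

Lemma core_joined p x y : core p 2 x -> core p 2 y -> joined S x y.
Proof.
move=> px py; have [C _ HC] := core_qnorm_bound p.
by have [c [pc c0 c1 _]] := core_segment HC px py; exists c.
Qed.

(** Each core is a neighbourhood of its inner points whose points are mutually joined, so the points
    joined to x form an open and closed set. *)
Lemma all_joined x y : joined S x y.
Proof.
have [p0 _ px0] := s_cover x.
have refl z : joined S z z.
  have [p _ pz1] := s_cover z; have pz := nbhs_singleton (core_nbhs pz1).
  exact: (core_joined pz pz).
have open_near (B : set M) : (forall z w p, core p 2 z -> core p 2 w -> B z -> B w) -> open B.
  move=> HB; rewrite openE => z Bz; have [p _ pz] := s_cover z.
  have nz := core_nbhs pz; apply: filterS nz => w pw.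
  exact: HB (nbhs_singleton (core_nbhs pz)) pw Bz.
have oA : open [set z | joined S x z].
  apply: open_near => z w p pz pw xz; exact: joined_trans xz (core_joined pz pw).
have cA : closed [set z | joined S x z].
  rewrite -openC; apply: open_near => z w p pz pw xz xw; apply: xz.
  exact: joined_trans xw (core_joined pw pz).
have E : [set z | joined S x z] = [set: M].
  apply: M_connected; first by exists x; exact: refl.
  - by exists [set z | joined S x z] => //; rewrite setTI.
  - by exists [set z | joined S x z] => //; rewrite setTI.
have : [set: M] y by [].
by rewrite -E.
Qed.

Lemma rdist_le_length c : piecewise_C1 S c -> rdist g (c 0) (c 1) <= curve_length g c.
Proof.
move=> pc; apply: ge_inf; last by exists c.
by exists 0 => _ [c' [_ _ _ ->]]; exact: curve_length_ge0.
Qed.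

(* Relies on [all_joined]: otherwise [rdist] might be the infimum of the empty
   set, which is 0. *)
Lemma rdist_lt_curve x y e : rdist g x y < e ->
  exists c, [/\ piecewise_C1 S c, c 0 = x, c 1 = y & curve_length g c < e].
Proof.
have [c [pc c0 c1]] := all_joined x y.
have ne : [set l | exists c, [/\ piecewise_C1 S c, c 0 = x, c 1 = y &
    l = curve_length g c]] !=set0 by exists (curve_length g c), c.
by move=> /(inf_lt ne)[l [c' [pc' c0' c1' ->]] le]; exists c'.
Qed.

Lemma rdist_near_diag (x : M) (e : R) : 0 < e ->
  \forall z \near (x, x), rdist g z.1 z.2 < e.
Proof.
move=> e0; have [p _ pxc] := s_cover x; have px : dom (ch p) x := pxc.1.
have [C C0 HC] := core_qnorm_bound p.
have n1 := core_nbhs pxc.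
(* C may vanish, hence the division by C + 1; the last half is for the two distances to x. *)
have he : 0 < e / (C + 1) / 2 by rewrite !divr_gt0 // ltr_wpDl.
have /cvg_at_dist/(_ _ he) n2 := chart_continuous px.
have n3 : \forall y \near x, core p 2 y /\ `|chart (ch p) x - chart (ch p) y| < e / (C + 1) / 2.
  exact: filterI n1 n2.
have n4 : \forall z \near (x, x),
   (core p 2 z.1 /\ `|chart (ch p) x - chart (ch p) z.1| < e / (C + 1) / 2) /\
   (core p 2 z.2 /\ `|chart (ch p) x - chart (ch p) z.2| < e / (C + 1) / 2).
  by apply: filterI; [exact: near_fst n3|exact: near_snd n3].
apply: filterS n4 => -[y z] /= [[py ye] [pz ze]].
have [c [pc c0 c1 cl]] := core_segment HC py pz.
rewrite -c0 -c1; apply: (le_lt_trans (rdist_le_length pc)); apply: (le_lt_trans cl).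
have dl : `|chart (ch p) z - chart (ch p) y| < e / (C + 1).
  have -> : chart (ch p) z - chart (ch p) y =
      (chart (ch p) x - chart (ch p) y) - (chart (ch p) x - chart (ch p) z).
    by apply/rowP => i; rewrite !mxE; ring.
  by rewrite (le_lt_trans (ler_normB _ _)) // [e / _]splitr ltrD.
apply: (@le_lt_trans _ _ ((C + 1) * `|chart (ch p) z - chart (ch p) y|)).
  by rewrite ler_wpM2r // lerDl.
by rewrite mulrC -ltr_pdivlMr // ltr_wpDl.
Qed.

Lemma rdist_entourage (W : M * M -> Prop) : (forall x : M, \forall z \near (x, x), W z) ->
  exists2 e : R, 0 < e & forall x y, rdist g x y <= e -> W (x, y).
Proof.
move=> HW.
have He : \forall e \near (0 : R)^'+,
    forall x, [set: M] x -> forall y, rdist g x y <= e -> W (x, y).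
  apply: ((compact_near_coveringP _).1 M_compact _ (0 : R)^'+
    (fun e x => forall y, rdist g x y <= e -> W (x, y))) => p _.
  have pp := dom_chart_at S p.
  have [[N1 N2] /= [n1 n2] NW] := HW p.
  have /(near_ichart pp) : \forall z \near p, N2 z by [].
  move=> /nbhs_ballP[e1 /= e10 He1].
  (* A curve from a point near p out of N2 has to cross the whole slope of the
     bump of radius e at p. *)
  pose e := Num.min (r p) (e1 / 2).
  have e0 : 0 < e by rewrite lt_min r_gt0 divr_gt0.
  have er : e <= r p by rewrite ge_min lexx.
  have eN z : dom (ch p) z -> `|chart (ch p) z - chart (ch p) p| <= e -> N2 z.
    move=> pz ze; rewrite -(chartK pz); apply: He1; rewrite -ball_normE /= distrC.
    apply: (le_lt_trans ze); apply: (@le_lt_trans _ _ (e1 / 2)); first by rewrite ge_min lexx orbT.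
    by rewrite ltr_pdivrMr // ltr_pMr // ltr1n.
  have [B [_ HB]] := qnorm_lower g r_gt0 r_img p.
  pose C := Num.max 0 (B + 1).
  have C0 : 0 <= C by rewrite le_max lexx.
  have HC : forall x, core p 2 x -> forall u : 'rV[R]_d,
      `|u| <= C * qnorm (chart_gram g (ch p) x) u.
    by apply: HB; rewrite lt_max ltrDl ltr01 orbT.
  pose K := 4 * d%:R * e ^+ 3 * C.
  have K0 : 0 <= K by rewrite !mulr_ge0 ?exprn_ge0 ?(ltW e0).
  (* Half the peak [e ^+ 4] of the bump. Near p the bump exceeds h, so reaching the value 0 would
     need a variation above h, while a curve shorter than dl produces less than h. *)
  pose h := e ^+ 4 / 2.
  have h0 : 0 < h by rewrite divr_gt0 // exprn_gt0.
  pose dl := h / (K + 1).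
  have dl0 : 0 < dl by rewrite divr_gt0 // ltr_wpDl.
  have /cvg_at_dist/(_ _ h0) nb := @bump_continuous_center _ _ _ S p e.
  have nd : \forall e' \near (0 : R)^'+, e' < dl by exact: nbhs_right_lt.
  have nx : \forall x \near p, N1 x /\ `|bump S p e p - bump S p e x| < h.
    exact: filterI n1 nb.
  exists ([set x | N1 x /\ `|bump S p e p - bump S p e x| < h], [set e' | e' < dl]); first by split.
  move=> [x e'] /= [[Nx bx] e'l] y xy.
  apply: (NW (x, y)); split=> //=.
  have [c [pc c0 c1 cl]] := rdist_lt_curve (le_lt_trans xy e'l).
  have := bump_length r_gt0 r_img e0 er C0 HC pc; rewrite c0 c1 -/K => bl.
  have Kd : K * curve_length g c < h.
    apply: (@le_lt_trans _ _ (K * dl)); first by rewrite ler_wpM2l // ltW.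
    by rewrite /dl mulrA ltr_pdivrMr ?ltr_wpDl // mulrC ltr_pM2l // ltrDl.
  have : bump S p e y != 0.
    apply: contraTneq bx => by0; rewrite -leNgt; move: bl; rewrite by0 sub0r normrN => bl.
    rewrite bump_center //.
    have e4 : e ^+ 4 = h + h by rewrite /h -splitr.
    have bxh : bump S p e x < h by apply: (le_lt_trans (ler_norm _)); apply: le_lt_trans Kd.
    by rewrite (le_trans _ (ler_norm _)) // e4 -addrA lerDl subr_ge0 ltW.
  by move=> /(bump_support e0)[py ye]; exact: eN.
have [e [He' e_gt0]] := filter_ex (filterI He (nbhs_right_gt (0 : R))).
by exists e => // x y; exact: He'.
Qed.

End DistanceTopology.

(** * Shadowing and expansivity on M *)

(** On a compact Hausdorff space these are the entourages of its only uniformity; the type of M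
    carries just a topology. *)
Definition diag_nbhd (M : topologicalType) (W : M * M -> Prop) :=
  forall x : M, \forall z \near (x, x), W z.

Lemma diag_nbhd_refl (M : topologicalType) (W : M * M -> Prop) x :
  diag_nbhd W -> W (x, x).
Proof. by move=> /(_ x)/nbhs_singleton. Qed.

Section PseudoOrbits.
Context {R : realType} {d : nat} {M : topologicalType}.
Variables (S : smooth_manifold R d M) (g : riemannian_metric S).
Hypothesis M_compact : compact [set: M].
Variables (r : M -> R) (s : seq M).
Hypothesis r_gt0 : forall p, 0 < r p.
Hypothesis r_img : forall p a,
  `|a - chart (chart_at S p) p| <= 3 * r p ->
  (chart (chart_at S p) @` dom (chart_at S p)) a.
Hypothesis s_cover : forall x, exists2 p, p \in s & core S r p 1 x.
Context {Omega : metricType R}.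
Hypothesis Omega_compact : compact [set: Omega].
Variables (theta : Omega -> Omega) (F : Omega -> diff2 S).
Hypothesis F_cont : continuous F.
Hypothesis F_anosov : anosov_on_fibers g theta F.

Local Notation ch p := (chart_at S p).
Local Notation core := (core S r).

(** All charts of the atlas around [z.2] are tested, because shadowing selects one of them at each
    time without further control. *)
Definition chart_close (e : R) (z : M * M) : Prop := forall p, p \in s ->
  core p 1 z.2 -> dom (ch p) z.1 /\ `|chart (ch p) z.1 - chart (ch p) z.2| <= e.

Lemma chart_close_diag e : 0 < e -> diag_nbhd (chart_close e).
Proof.
move=> e0 x; apply: (filter_all_seq (F := nbhs (x, x)) (P := fun p z => core p 1 z.2 ->
  dom (ch p) z.1 /\ `|chart (ch p) z.1 - chart (ch p) z.2| <= e)) => p _.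
have [px|npx] := pselect (core p 1 x); last first.
  have oC : open (~` core p 1) by apply: closed_openC; apply: core_closed => //; lra.
  have n : \forall z \near x, ~ core p 1 z by exact: open_nbhs_nbhs (conj oC npx).
  by apply: filterS (near_snd x n) => z /= nz /nz.
have e2 : 0 < e / 2 by rewrite divr_gt0.
have /cvg_at_dist/(_ _ e2) n1 := chart_continuous px.1.
have n2 : \forall z \near x, dom (ch p) z /\ `|chart (ch p) x - chart (ch p) z| < e / 2.
  exact: filterI (dom_nbhs px.1) n1.
have n3 : \forall z \near (x, x),
   (dom (ch p) z.1 /\ `|chart (ch p) x - chart (ch p) z.1| < e / 2) /\
   (dom (ch p) z.2 /\ `|chart (ch p) x - chart (ch p) z.2| < e / 2).
  by apply: filterI; [exact: near_fst n2|exact: near_snd n2].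
apply: filterS n3 => -[y z] /= [[py ye] [_ ze]] _; split=> //.
have -> : chart (ch p) y - chart (ch p) z =
   (chart (ch p) x - chart (ch p) z) - (chart (ch p) x - chart (ch p) y).
  by apply/rowP => i; rewrite !mxE; ring.
by rewrite (le_trans (ler_normB _ _)) // [leRHS]splitr lerD // ltW.
Qed.

Lemma shift_near_diag (W : M * M -> Prop) : diag_nbhd W ->
  \forall rho \near (0 : R)^'+, forall p, p \in s -> forall x, core p 1 x ->
    forall v : 'rV[R]_d, `|v| <= rho -> W (x, shift_in (ch p) x v).
Proof.
move=> HW; apply: filter_all_seq => p _.
have c1 : 0 < (1 : R) <= 3 by lra.
apply: ((compact_near_coveringP _).1 (core_compact r_gt0 r_img (p := p) c1) _ ((0 : R)^'+)
  (fun rho x => forall v : 'rV[R]_d, `|v| <= rho -> W (x, shift_in (ch p) x v))) => x [px _].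
have [[A B] /= [nA nB] AB] := HW x.
have nAx : \forall z \near x, A z by [].
have := shift_in_cvg px; move=> /(_ _ nB).
move=> [[C D] /= [nC nD] CD].
move: nD => /nbhs_ballP[e /= e0 He].
exists ([set z | A z /\ C z], [set rho | rho < e]).
  by split; [exact: filterI|exact: nbhs_right_lt].
move=> [y rho] /= [[Ay Cy] re] v vr; apply: (AB (_, _)); split=> //=.
by apply: (CD (y, v)); split=> //=; apply: He; rewrite -ball_normE /= sub0r normrN (le_lt_trans vr).
Qed.

Let shadowing_in_charts : exists2 rho0 : R, 0 < rho0 & forall rho, 0 < rho <= rho0 ->
  exists2 eps : R, 0 < eps & forall (w : int -> Omega) (x p : int -> M),
    (forall n, w (n + 1) = theta (w n)) -> (forall n, p n \in s) ->
    (forall n, core (p n) 1 (x n)) ->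
    (forall n, dom (ch (p (n + 1))) (F (w n) (x n))) ->
    (forall n, `|chart (ch (p (n + 1))) (F (w n) (x n)) -
       chart (ch (p (n + 1))) (x (n + 1))| <= eps) ->
    (exists v, (forall n, `|v n| <= rho) /\ chart_orbit F w x p v) /\
    (forall v v', (forall n, `|v n| <= rho) -> (forall n, `|v' n| <= rho) ->
       chart_orbit F w x p v -> chart_orbit F w x p v' -> forall n, v n = v' n).
Proof.
have [Es [Eu [lam [lam0 [Es_cont Eu_cont] split_ inv exp_]]]] := F_anosov.
apply: (@chart_shadowing _ _ _ S g M_compact r s r_gt0 r_img Omega Omega_compact theta F F_cont
  Es Eu lam lam0 Es_cont Eu_cont).
- by move=> w x; have [] := split_ w x.
- by move=> w x; have [] := split_ w x.
- by move=> w x; have [] := inv w x.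
- by move=> w x; have [] := inv w x.
- by move=> w x; have [] := exp_ w x.
- by move=> w x; have [] := exp_ w x.
Qed.

Definition is_orbit (w : int -> Omega) (z : int -> M) :=
  forall n, z (n + 1) = F (w n) (z n).

Lemma pseudo_orbit_shadowing (W : M * M -> Prop) : diag_nbhd W ->
  exists2 D : M * M -> Prop, diag_nbhd D &
    forall (w : int -> Omega) (x : int -> M),
      (forall n, w (n + 1) = theta (w n)) ->
      (forall n, D (F (w n) (x n), x (n + 1))) ->
      exists2 z, is_orbit w z & forall n, W (x n, z n).
Proof.
move=> HW; have [rho0 rho00 H] := shadowing_in_charts.
have [rho [[rhoW rhole] rho_gt0]] := filter_ex (filterI (filterI (shift_near_diag HW)
  (nbhs_right_le rho00)) (nbhs_right_gt (0 : R))).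
have rho_in : 0 < rho <= rho0 by rewrite rho_gt0.
have [eps eps0 Heps] := H rho rho_in.
exists (chart_close eps); first exact: chart_close_diag.
move=> w x wn xn; have /choice[p Hp] : forall n, exists p, p \in s /\ core p 1 (x n).
  by move=> n; have [p ps px] := s_cover (x n); exists p.
have xd n := xn n (p (n + 1)) (Hp (n + 1)).1 (Hp (n + 1)).2.
have [[v [vr ov]] _] := Heps w x p wn (fun n => (Hp n).1) (fun n => (Hp n).2)
  (fun n => (xd n).1) (fun n => (xd n).2).
exists (fun n => shift_in (ch (p n)) (x n) (v n)); first by move=> n; exact: esym (ov n).
by move=> n; apply: rhoW; [exact: (Hp n).1|exact: (Hp n).2|exact: vr].
Qed.

(** In charts around the orbit x, a pseudo-orbit without jumps, the orbit z has small displacements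
    and x itself has displacement 0; uniqueness identifies them. *)
Lemma orbit_expansivity : exists2 W : M * M -> Prop, diag_nbhd W &
  forall (w : int -> Omega) (x z : int -> M),
    (forall n, w (n + 1) = theta (w n)) -> is_orbit w x -> is_orbit w z ->
    (forall n, W (z n, x n)) -> forall n, x n = z n.
Proof.
have [rho0 rho00 H] := shadowing_in_charts.
have rho_in : 0 < rho0 <= rho0 by rewrite rho00 /=.
have [eps eps0 Heps] := H rho0 rho_in.
exists (chart_close rho0); first exact: chart_close_diag.
move=> w x z wn ox oz xz n; have /choice[p Hp] : forall n, exists p, p \in s /\ core p 1 (x n).
  by move=> m; have [p ps px] := s_cover (x m); exists p.
have zd m := xz m (p m) (Hp m).1 (Hp m).2.
pose v m := chart (ch (p m)) (z m) - chart (ch (p m)) (x m).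
have vz m : shift_in (ch (p m)) (x m) (v m) = z m by exact: shift_in_sub (zd m).1.
have vx m : shift_in (ch (p m)) (x m) 0 = x m.
  by rewrite /shift_in addr0 chartK //; exact: (Hp m).2.1.
have o1 : chart_orbit F w x p v by move=> m; rewrite !vz oz.
have o2 : chart_orbit F w x p (fun=> 0) by move=> m; rewrite !vx ox.
have [||_ U] := Heps w x p wn (fun n => (Hp n).1) (fun n => (Hp n).2).
- by move=> m; rewrite -ox; exact: (Hp (m + 1)).2.1.
- by move=> m; rewrite -ox subrr normr0 ltW.
have v0 : v n = 0.
  by apply: (U v (fun=> 0)) => // m; [exact: (zd m).2|rewrite normr0 ltW].
by rewrite -(vz n) v0 vx.
Qed.

End PseudoOrbits.

(** * Gluing orbits *)

Section Iterates.
Context {R : realType} {d : nat} {M : topologicalType}.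
Variables (S : smooth_manifold R d M).
Context {Omega : metricType R}.
Variables (theta thetaV : Omega -> Omega) (F : Omega -> diff2 S).
Hypothesis thetaVK : cancel thetaV theta.

Local Notation titer := (theta_iter theta thetaV).
Local Notation fiter := (fiber_iter theta thetaV F).

Lemma theta_iterS t w : titer (t + 1) w = theta (titer t w).
Proof.
case: t => [n|[|n]].
- by have -> : Posz n + 1 = Posz n.+1 by lia.
- by rewrite /= thetaVK.
- have -> : Negz n.+1 + 1 = Negz n by lia.
  by rewrite /= thetaVK.
Qed.

Lemma fiber_iterS t w x : fiter (t + 1) w x = F (titer t w) (fiter t w x).
Proof.
case: t => [n|[|n]].
- by have -> : Posz n + 1 = Posz n.+1 by lia.
- by rewrite /= diff2_invK.
- have -> : Negz n.+1 + 1 = Negz n by lia.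
  by rewrite /= diff2_invK.
Qed.

Lemma int_ind2 (P : int -> Prop) : P 0 -> (forall t, P t <-> P (t + 1)) -> forall t, P t.
Proof.
move=> P0 PS [n|n].
  by elim: n => // n /PS; rewrite -addn1 PoszD.
elim: n => [|n IH]; first by apply/PS.
by apply/PS; have -> : Negz n.+1 + 1 = Negz n by lia.
Qed.

Lemma orbit_fiber_iter w z : is_orbit F (fun t => titer t w) z ->
  forall t, z t = fiter t w (z 0).
Proof.
move=> oz; apply: int_ind2 => // t; rewrite oz fiber_iterS; split=> [->//|].
exact: (can_inj (@diff2_funK _ _ _ _ (F (titer t w)))).
Qed.

Lemma fiber_iter_surj t w y : exists x, fiter t w x = y.
Proof.
move: t y; apply: int_ind2 => [y|t]; first by exists y.
split=> H y.
  have [x Hx] := H (diff2_inv (F (titer t w)) y).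
  by exists x; rewrite fiber_iterS Hx diff2_invK.
have [x Hx] := H (F (titer t w) y); exists x; move: Hx; rewrite fiber_iterS.
exact: (can_inj (@diff2_funK _ _ _ _ (F (titer t w)))).
Qed.

Lemma theta_iterD t n w : titer (t + n%:Z) w = iter n theta (titer t w).
Proof. by elim: n => [|n IH]; rewrite ?addr0 // -addn1 PoszD addrA theta_iterS IH addn1. Qed.

Lemma fiber_iterD t n w x : fiter (t + n%:Z) w x = fiber_pos theta F n (titer t w) (fiter t w x).
Proof.
elim: n => [|n IH]; first by rewrite addr0.
by rewrite -addn1 PoszD addrA fiber_iterS IH theta_iterD addn1.
Qed.

Lemma skew_iterE n w x :
  iter n (Defs.skew theta F) (w, x) = (iter n theta w, fiber_pos theta F n w x).
Proof. by elim: n => //= n ->. Qed.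

End Iterates.

Section Gluing.
Context {R : realType} {d : nat} {M : topologicalType}.
Variables (S : smooth_manifold R d M) (M_compact : compact [set: M]).
Context {Omega : metricType R}.
Variables (theta thetaV : Omega -> Omega) (F : Omega -> diff2 S).
Hypothesis thetaVK : cancel thetaV theta.

Local Notation titer := (theta_iter theta thetaV).
Local Notation fiter := (fiber_iter theta thetaV F).

Definition connects (D : M * M -> Prop) (N : nat) : Prop :=
  forall n : nat, (N <= n)%N -> forall w x y, exists q,
    D (x, q) /\ D (fiber_pos theta F n w q, y).

(** Rectangles A1 x A2 and B1 x B2 inside D near (x, x) and (y, y) are chosen; the time for which
    mixing leads from A2 to B1 serves all x' in A1 and y' in B2. Near-covering of M x M over [\oo]
    makes it uniform. *)
Lemma mixing_connects (D : M * M -> Prop) : mixing_on_fibers theta F -> diag_nbhd D ->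
  exists N, connects D N.
Proof.
move=> mix HD.
have cMM : compact ([set: M] `*` [set: M]) by exact: compact_setX.
have H : \forall N \near \oo, forall z, ([set: M] `*` [set: M]) z ->
    forall n : nat, (N <= n)%N -> forall w, exists q,
      D (z.1, q) /\ D (fiber_pos theta F n w q, z.2).
  apply: ((compact_near_coveringP _).1 cMM _ \oo (fun N z =>
    forall n : nat, (N <= n)%N -> forall w, exists q,
      D (z.1, q) /\ D (fiber_pos theta F n w q, z.2))).
  move=> [x y] _.
  have [[A1 A2] /= [nA1 nA2] AD] := HD x.
  have [[B1 B2] /= [nB1 nB2] BD] := HD y.
  have [||N _ HN] := mix A2^° B1^° (@open_interior _ _) _ (@open_interior _ _).
  - by exists x.
  - by exists y.
  exists ([set z : M * M | A1 z.1 /\ B2 z.2], [set n | (N <= n)%N]).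
    split; last by exists N.
    by exists (A1, B2); [split|move=> z []].
  move=> [[x' y'] N'] /= [[Ax By] NN'] n N'n w.
  have [_ [[[w' q] [/= -> Aq] <-]]] := HN n (leq_trans NN' N'n) w.
  rewrite skew_iterE => -[/= _ Bq]; exists q; split.
    by apply: (AD (x', q)); split=> //=; exact: interior_subset Aq.
  by apply: (BD (_, y')); split=> //=; exact: interior_subset Bq.
have [N HN] := filter_ex H.
by exists N => n Nn w x y; exact: (HN (x, y) _ n Nn w).
Qed.

Section Pseudo.
Variables (D : M * M -> Prop) (D_diag : diag_nbhd D) (N : nat).
Hypothesis D_connects : connects D N.
Variable w : Omega.

Definition pseudo_orbit (x : int -> M) := forall t, D (F (titer t w) (x t), x (t + 1)).

Lemma orbit_pseudo z : pseudo_orbit (fun t => fiter t w z).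
Proof. by move=> t; rewrite fiber_iterS //; exact: diag_nbhd_refl. Qed.

(* The gap between b and a is filled by an orbit segment that starts near the
   image of x b and ends near the orbit of z. *)
Lemma glue_orbit (x : int -> M) (b a : int) z : pseudo_orbit x -> b + N.+1%:Z < a ->
  exists x', [/\ pseudo_orbit x', forall t, t <= b -> x' t = x t &
    forall t, a <= t -> x' t = fiter t w z].
Proof.
move=> px ba; pose n := absz (a - (b + 1))%R.
have na : b + 1 + n%:Z = a by lia.
have Nn : (N <= n)%N by lia.
have [q [Dq Dqz]] := D_connects Nn (titer (b + 1) w) (F (titer b w) (x b)) (fiter a w z).
(* Pulling q back to time 0 writes the connecting segment as the orbit of a single point q'; jumps
   can then occur only at the steps from b to b + 1 and from a - 1 to a. *)
have [q' Hq'] := fiber_iter_surj theta thetaV F (b + 1) w q.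
exists (fun t => if t <= b then x t else if a <= t then fiter t w z else fiter t w q').
split=> [t|t ->//|t at_]; last by rewrite at_ ifF //; lia.
have [tb|bt] := leP t b.
  have [tb'|bt'] := leP (t + 1) b; first exact: px.
  have -> : t = b by lia.
  by rewrite ifF ?Hq' //; lia.
have -> : (t + 1 <= b) = false by lia.
have [at_|ta] := leP a t.
  by rewrite ifT; [rewrite fiber_iterS //; exact: diag_nbhd_refl|lia].
case: ifP => [at1|_]; last by rewrite -fiber_iterS //; exact: diag_nbhd_refl.
have -> : t + 1 = a by lia.
rewrite -fiber_iterS // ; have -> : t + 1 = b + 1 + n%:Z by lia.
by rewrite fiber_iterD // Hq'.
Qed.

End Pseudo.
End Gluing.

Section Specification.
Context {R : realType} {d : nat} {M : topologicalType}.
Variables (S : smooth_manifold R d M).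
Context {Omega : metricType R}.
Variables (theta thetaV : Omega -> Omega) (F : Omega -> diff2 S).
Hypothesis thetaVK : cancel thetaV theta.
Variables (D : M * M -> Prop) (D_diag : diag_nbhd D) (N : nat).
Hypothesis D_connects : connects theta F D N.
Variable w : Omega.

Local Notation titer := (theta_iter theta thetaV).
Local Notation fiter := (fiber_iter theta thetaV F).
Local Notation pseudo := (pseudo_orbit theta thetaV F D w).

Lemma specification_orbit (tau : seq (int * int)) (P : int -> M) I :
  is_specification theta thetaV F w tau P -> I \in tau ->
  exists z, forall t, I.1 <= t <= I.2 -> P t = fiter t w z.
Proof.
move=> [Ile HP] Itau; have [z Hz] := fiber_iter_surj theta thetaV F I.1 w (P I.1).
exists z => t /andP[It tI]; have I1 : I.1 <= I.1 <= I.2 by rewrite lexx Ile.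
rewrite -(HP I Itau _ _ I1 _) ?It //.
have -> : t - I.1 = (absz (t - I.1)%R)%:Z by lia.
have E := fiber_iterD F thetaVK I.1 (absz (t - I.1)%R) w z.
rewrite -Hz; apply: etrans (esym E) _; congr fiber_iter; lia.
Qed.

(** Each gluing leaves the past up to the right end of the last treated interval unchanged, so what
    has been arranged is never lost. *)
Lemma glue_path (tau : seq (int * int)) (P : int -> M) (x : int -> M) I0 :
  is_specification theta thetaV F w tau P ->
  path (fun I J : int * int => I.2 + N.+1%:Z < J.1) I0 tau -> pseudo x ->
  exists x', [/\ pseudo x', forall t, t <= I0.2 -> x' t = x t &
    forall I, I \in tau -> forall t, I.1 <= t <= I.2 -> x' t = P t].
Proof.
elim: tau I0 x => [|I tau IH] I0 x sp /=; first by exists x.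
move=> /andP[I0I pth] px.
have [z Hz] := specification_orbit sp (mem_head _ _).
have [x1 [px1 x1b x1a]] := glue_orbit thetaVK D_diag D_connects z px I0I.
have sp' : is_specification theta thetaV F w tau P.
  by case: sp => sp1 sp2; split=> J Jt; [apply: sp1|apply: sp2]; rewrite inE Jt orbT.
have [x' [px' x'b x'P]] := IH I x1 sp' pth px1.
have II : I.1 <= I.2 by case: sp => sp1 _; apply: sp1; exact: mem_head.
exists x'; split=> // [t tI0|J].
  by rewrite x'b ?x1b //; lia.
rewrite inE => /predU1P[->|/x'P//] t /andP[It tI].
by rewrite x'b // x1a // Hz // It.
Qed.

Lemma glue_specification (tau : seq (int * int)) (P : int -> M) :
  is_specification theta thetaV F w tau P -> spaced N.+1 tau ->
  exists2 x, pseudo x & forall I, I \in tau -> forall t, I.1 <= t <= I.2 -> x t = P t.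
Proof.
case: tau => [|I tau] sp.
  move=> _; exists (fun t => fiter t w (P 0)) => //.
  by apply: orbit_pseudo.
rewrite /spaced /= => pth.
have [z Hz] := specification_orbit sp (mem_head _ _).
have sp' : is_specification theta thetaV F w tau P.
  by case: sp => sp1 sp2; split=> J Jt; [apply: sp1|apply: sp2]; rewrite inE Jt orbT.
have pz : pseudo (fun t => fiter t w z) by apply: orbit_pseudo.
have [x' [px' x'b x'P]] := glue_path sp' pth pz.
exists x' => // J; rewrite inE => /predU1P[->|/x'P//] t /andP[It tI].
by rewrite x'b // Hz // It.
Qed.

Lemma glue_blocks (k : nat) (x : nat -> M) (a b : nat -> int) (bO aO : \bar int) :
  (1 <= k)%N ->
  (forall i, (1 <= i <= k)%N -> a i < b i) ->
  (bO < (a 1%N)%:E)%E -> ((b k)%:E < aO)%E ->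
  (forall n : int, bO = n%:E -> n + N.+1%:Z < a 1%N) ->
  (forall i, (1 <= i < k)%N -> b i + N.+1%:Z < a i.+1) ->
  (forall n : int, aO = n%:E -> b k + N.+1%:Z < n) ->
  exists z, [/\ pseudo z,
    forall i, (1 <= i <= k)%N -> forall j : int, a i <= j <= b i -> z j = fiter j w (x i) &
    forall j : int, (aO <= j%:E)%E \/ (j%:E <= bO)%E -> z j = fiter j w (x 0%N)].
Proof.
move=> k1 ab bOa baO gapO gap gapk.
(* The bounds by [b m] record that everything treated so far lies left of the next gluing. If [bO]
   is infinite no past is prescribed, and the orbit of [x 1] starts the induction. *)
have H m : (1 <= m <= k)%N -> exists z, [/\ pseudo z,
    forall i, (1 <= i <= m)%N -> b i <= b m /\
      forall j : int, a i <= j <= b i -> z j = fiter j w (x i) &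
    forall j : int, (j%:E <= bO)%E -> j <= b m /\ z j = fiter j w (x 0%N)].
  elim: m => // -[_ _|m IH /andP[_ mk]].
    have ab1 : a 1%N < b 1%N by apply: ab; rewrite k1.
    case: bO bOa gapO => [n|//|] bOa gapO.
      have px0 : pseudo (fun t => fiter t w (x 0%N)) by apply: orbit_pseudo.
      have [z [pz zb za]] := glue_orbit thetaVK D_diag D_connects (x 1%N) px0 (gapO n erefl).
      exists z; split=> // [i i1|j].
        have -> : i = 1%N by lia.
        by split=> // j /andP[aj _]; exact: za.
      rewrite lee_fin => jn; split; last exact: zb.
      by move: bOa; rewrite lte_fin; lia.
    exists (fun t => fiter t w (x 1%N)); split.
    - by apply: orbit_pseudo.
    - by move=> i i1; have -> : i = 1%N by lia.
    - by move=> j; rewrite leeNy_eq.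
  have [|z [pz zi zO]] := IH; first by lia.
  have gm : b m.+1 + N.+1%:Z < a m.+2 by apply: gap; lia.
  have abm : a m.+2 < b m.+2 by apply: ab; lia.
  have [z' [pz' zb za]] := glue_orbit thetaVK D_diag D_connects (x m.+2) pz gm.
  exists z'; split=> // [i /andP[i1]|j jO].
    rewrite leq_eqVlt => /predU1P[->|im]; first by split=> // j /andP[aj _]; exact: za.
    have [|bi Hi] := zi i; first by rewrite i1.
    split; first by lia.
    by move=> j aj; rewrite zb; [exact: Hi|lia].
  have [jb Hj] := zO j jO; split; first by lia.
  by rewrite zb.
have [|z [pz zi zO]] := H k; first by rewrite k1 leqnn.
case: aO baO gapk => [n||//] baO gapk.
  have [z' [pz' zb za]] := glue_orbit thetaVK D_diag D_connects (x 0%N) pz (gapk n erefl).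
  exists z'; split=> // [i ik j aj|j [|jO]].
  - by have [bi Hi] := zi i ik; rewrite zb; [exact: Hi|lia].
  - by rewrite lee_fin; exact: za.
  - by have [jb Hj] := zO j jO; rewrite zb.
exists z; split=> // [i ik j aj|j [|jO]].
- by have [_ Hi] := zi i ik; exact: Hi.
- by rewrite leye_eq.
- by have [_] := zO j jO.
Qed.

End Specification.

(** * From shadowing and mixing to specification and expansivity *)

Section Main.
Context {R : realType} {d : nat} {M : topologicalType}.
Variables (S : smooth_manifold R d M) (g : riemannian_metric S).
Hypothesis M_compact : compact [set: M].
Hypothesis M_connected : connected [set: M].
Context {Omega : metricType R}.
Hypothesis Omega_compact : compact [set: Omega].
Variables (theta thetaV : Omega -> Omega) (F : Omega -> diff2 S).
Hypothesis thetaVK : cancel thetaV theta.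
Hypothesis F_cont : continuous F.
Hypothesis F_anosov : anosov_on_fibers g theta F.

Local Notation titer := (theta_iter theta thetaV).
Local Notation fiter := (fiber_iter theta thetaV F).

Lemma core_atlas : exists (s : seq M) (r : M -> R),
  [/\ forall p, 0 < r p,
      forall p a, `|a - chart (chart_at S p) p| <= 3 * r p ->
        (chart (chart_at S p) @` dom (chart_at S p)) a &
      forall x, exists2 p, p \in s & core S r p 1 x].
Proof.
have [s [r [r0 ri sc]]] := finite_atlas S M_compact.
exists s, r; split=> // x; have [p ps [px xr]] := sc x.
by exists p => //; split; rewrite ?mul1r.
Qed.

(** D is the jump allowed when shadowing within W, and N the mixing time for that D. *)
Lemma anosov_specification (W : M * M -> Prop) : mixing_on_fibers theta F -> diag_nbhd W ->
  exists D N, [/\ diag_nbhd D, connects theta F D N &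
    forall w x, pseudo_orbit theta thetaV F D w x ->
      exists z, forall t, W (x t, fiter t w z)].
Proof.
move=> mix HW; have [s [r [r0 ri sc]]] := core_atlas.
have [D HD Dsh] := pseudo_orbit_shadowing M_compact r0 ri sc Omega_compact F_cont F_anosov HW.
have [N HN] := mixing_connects M_compact mix HD.
exists D, N; split=> // w x px.
have [z oz Wz] := Dsh (fun t => titer t w) x (fun t => theta_iterS thetaVK t w) px.
by exists (z 0) => t; rewrite -(orbit_fiber_iter oz).
Qed.

Lemma diag_rdist (e : R) : 0 < e -> diag_nbhd (fun z => rdist g z.1 z.2 < e).
Proof.
move=> e0 x; have [s [r [r0 ri sc]]] := core_atlas.
exact: (rdist_near_diag g r0 ri sc x e0).
Qed.

Lemma anosov_expansive : exists eta, expansive_characteristic g theta thetaV F eta.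
Proof.
have [s [r [r0 ri sc]]] := core_atlas.
have [W HW exW] := orbit_expansivity M_compact r0 ri sc Omega_compact F_cont F_anosov.
have [e e0 He] := rdist_entourage g M_compact M_connected r0 ri sc HW.
exists e; split=> // w x y xy.
have ox z : is_orbit F (fun t => titer t w) (fun t => fiter t w z).
  by move=> t; exact: fiber_iterS.
apply: esym; have := exW (fun t => titer t w) (fun t => fiter t w y) (fun t => fiter t w x)
  (fun t => theta_iterS thetaVK t w) (ox y) (ox x) (fun t => He _ _ (xy t)) 0.
exact.
Qed.

End Main.

Theorem theorem1 (R : realType) (d : nat) (M : topologicalType)
    (S : smooth_manifold R d M) (g : riemannian_metric S)
    (M_compact : compact [set: M]) (M_connected : connected [set: M])
    (Omega : metricType R) (Omega_compact : compact [set: Omega])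
    (theta thetaV : Omega -> Omega)
    (thetaK : cancel theta thetaV) (thetaVK : cancel thetaV theta)
    (theta_cont : continuous theta) (thetaV_cont : continuous thetaV)
    (F : Omega -> diff2 S) (F_cont : continuous F)
    (F_anosov : anosov_on_fibers g theta F)
    (F_mixing : mixing_on_fibers theta F) :
  fiber_specification g theta thetaV F /\
  forall (w0 : Omega) (P : probability (borel w0) R),
    invariant_probability theta P ->
    (exists eta : R, expansive_characteristic g theta thetaV F eta) /\
    forall eta : R, expansive_characteristic g theta thetaV F eta ->
      GK_specification g theta thetaV F P eta.
Proof.
have spec := anosov_specification M_compact Omega_compact thetaVK F_cont F_anosov F_mixing.
split=> [e e0|w0 P _].
  have [D [N [HD DN Dsh]]] := spec _ (diag_rdist g M_compact e0).
  exists N.+1 => // w tau P sp sd.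
  have [x px xP] := glue_specification thetaVK HD DN sp sd.
  have [z Hz] := Dsh w x px; exists z => I It t tI.
  by rewrite -(xP I It t tI); exact: Hz.
split=> [|eta [eta0 _] c c0].
  exact: (anosov_expansive M_compact M_connected Omega_compact thetaVK F_cont F_anosov).
have ce0 : 0 < c * eta by rewrite mulr_gt0.
have [D [N [HD DN Dsh]]] := spec _ (diag_rdist g M_compact ce0).
(* A constant is measurable, and the estimates hold for every omega. The gap condition is non-strict
   whereas gluing needs more than N + 1, hence N + 2. *)
exists (fun=> N.+2); split=> //.
apply: aeW => w k x a b bO aO k1 ab _ bOa baO gapO gap gapk.
have [|||z [pz zi zO]] := glue_blocks thetaVK HD DN w x k1 ab bOa baO.
- by move=> n /gapO; lia.
- by move=> i /gap; lia.
- by move=> n /gapk; lia.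
have [y Hy] := Dsh w z pz; exists y; split=> [i ik j aj|j jO].
  by rewrite -(zi i ik j aj); apply: ltW; exact: Hy.
by rewrite -(zO j jO); apply: ltW; exact: Hy.
Qed.
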